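(* Let $\lambda$ be a partition of $N$. For every standard Young tableau $T$ of shape $\lambda$, there are a critical point $t=t(z)$ of the master function $S'_{\mathbf m}(t,z)$ (defined for $z$ in the asymptotic zone $|z_1|\ll|z_2|\ll\cdots\ll|z_N|$) and positive rational constants $0<\beta_i^{(j)}<1$ (for $1\le j\le N$ and $1\le i<x(T,j)$) such that, in the asymptotic zone, $$t_i^{(j)}=\beta_i^{(j)}z_j+o(z_j)\qquad\text{for all } 1\le j\le N,\ 1\le i<x(T,j).$$ At this critical point, $$\frac{\partial S'_{\mathbf m}}{\partial z_j}=\frac{y(T,j)-x(T,j)}{z_j}+o\!\left(\frac1{z_j}\right)\qquad\text{for all }1\le j\le N.$$ Moreover, every critical point of $S'_{\mathbf m}$ which is defined over the asymptotic zone is of this form for some standard Young tableau $T$ of shape $\lambda$ (after indexing its variables by the boxes of $T$ as in the notation).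
   Context: Let $\lambda=(\lambda_1\ge\lambda_2\ge\cdots)$ be a partition of $N$ and $m_i=\sum_{j>i}\lambda_j$ for $i\ge1$ (so $m_i=0$ for $i$ large). For $z=(z_1,\dots,z_N)\in\mathbb C^N$ with pairwise distinct coordinates and variables $t=(t_i^{(a)})_{i\ge1,\,1\le a\le m_i}$, the master function is $$S'_{\mathbf m}(t,z)=\sum_{k<\ell}\log(z_k-z_\ell)-\sum_{k=1}^N\sum_{a}\log\bigl(z_k-t_1^{(a)}\bigr)+2\sum_{i\ge1}\sum_{a<b}\log\bigl(t_i^{(a)}-t_i^{(b)}\bigr)-\sum_{i\ge1}\sum_{a,b}\log\bigl(t_i^{(a)}-t_{i+1}^{(b)}\bigr).$$ Only its partial derivatives (rational functions) are used, at points where all differences inside logarithms are nonzero. A critical point for fixed $z$ is a $t$ with $\partial S'_{\mathbf m}/\partial t_i^{(a)}(t,z)=0$ for all $i,a$; the derivatives $\partial S'_{\mathbf m}/\partial z_j$ are taken with $t$ held fixed and then evaluated at the critical point $t=t(z)$. Critical points depending on $z$ are understood as families varying holomorphically in $z$. A standard Young tableau $T$ of shape $\lambda$ is a bijective filling of the boxes of the Young diagram of $\lambda$ (left-aligned, $\lambda_r$ boxes in row $r$, rows numbered from the top) by $1,\dots,N$, increasing along rows and down columns; $x(T,j)$ and $y(T,j)$ denote the row and column, respectively, of the box containing $j$. Indexing of the variables: since $m_i$ is the number of boxes not lying in the first $i$ rows of the diagram, the variables $t_i^{(a)}$, $1\le a\le m_i$, can (for each $i$, via any chosen bijection) be indexed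 by those boxes, and via $T$ by the entries $j$ with $x(T,j)>i$. Thus $t_i^{(j)}$ denotes the variable attached to the box of $T$ containing $j$, and it exists exactly when $i<x(T,j)$. ($S'_{\mathbf m}$ is, up to constants, invariant under permuting the variables with the same lower index $i$.) Asymptotic zone: the regime in which $|z_i/z_j|\to\infty$ whenever $i>j$ (with all $z_j\neq0$). A family is defined over the asymptotic zone if it is defined for all $z$ with all ratios $|z_{i+1}/z_i|$ sufficiently large, and $f=o(g)$ means $f/g\to0$ in this regime. *)

(* Defs.v *)
From mathcomp Require Import all_boot all_order all_algebra.
From mathcomp Require Import all_classical all_reals all_analysis.
From mathcomp Require Import complex.

Set Implicit Arguments.
Unset Strict Implicit.
Unset Printing Implicit Defensive.

Import Order.TTheory GRing.Theory Num.Theory numFieldNormedType.Exports.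
Local Open Scope ring_scope.
Local Open Scope classical_set_scope.

(* Packed as a numClosedFieldType so that the normed-module structure which
   MathComp-Analysis puts on every such field applies to it. *)
Definition Cplx (R : realType) : numClosedFieldType := R[i].

Definition is_partition_of (N : nat) (lam : seq nat) : Prop :=
  [/\ sorted geq lam, all (leq 1) lam & sumn lam = N].

(* Number of boxes strictly below the first i rows: the sum of lambda_j over
   j > i. *)
Definition below (lam : seq nat) (i : nat) : nat := sumn (drop i lam).

(* Boxes are pairs (row, column), both counted from 0. *)
Definition box (lam : seq nat) : Type :=
  {p : nat * nat | (p.2 < nth 0%N lam p.1)%N}.

(* The element j of 'I_N stands for the entry j + 1 (and for the variable
   z_(j+1)). A bijective filling is given together with its inverse. *)
Record std_tableau (N : nat) (lam : seq nat) := StdTableau {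
  entry : box lam -> 'I_N;
  box_of : 'I_N -> box lam;
  entryK : cancel entry box_of;
  box_ofK : cancel box_of entry;
  entry_row : forall b c : box lam, (val b).1 = (val c).1 ->
    ((val b).2 < (val c).2)%N -> (entry b < entry c)%N;
  entry_col : forall b c : box lam, (val b).2 = (val c).2 ->
    ((val b).1 < (val c).1)%N -> (entry b < entry c)%N
}.

(* x(T, j) and y(T, j), counted from 1. *)
Definition row_of (N : nat) (lam : seq nat) (T : std_tableau N lam)
  (j : 'I_N) : nat := (val (box_of T j)).1.+1.
Definition col_of (N : nat) (lam : seq nat) (T : std_tableau N lam)
  (j : 'I_N) : nat := (val (box_of T j)).2.+1.

(* The variables t_i^(a). The lower index i starts at 1: the component i = 0
   is not a variable and is never referred to below. *)
Definition tvars (R : realType) (lam : seq nat) : Type :=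
  forall i : nat, 'I_(below lam i) -> Cplx R.

Section Master.
Variables (R : realType) (N : nat) (lam : seq nat).
Local Notation C := (Cplx R).
Implicit Types (t : tvars R lam) (z : 'rV[C]_N).

(* exp S'. There are no variables t_i for i >= size lam. *)
Definition exp_master t z : C :=
  (\prod_(k < N) \prod_(l < N | (k < l)%N) (z 0 k - z 0 l))
  * (\prod_(k < N) \prod_(a < below lam 1) (z 0 k - t 1%N a)^-1)
  * (\prod_(1 <= i < size lam)
      \prod_(a < below lam i) \prod_(b < below lam i | (a < b)%N)
        (t i a - t i b) ^+ 2)
  * (\prod_(1 <= i < size lam)
      \prod_(a < below lam i) \prod_(b < below lam i.+1)
        (t i a - t i.+1 b)^-1).

Definition tupdate t (i : nat) (a : 'I_(below lam i)) (s : C) : tvars R lam :=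
  fun i' b => if (i' == i) && (b == a :> nat) then s else t i' b.

(* S' is multivalued but its partial derivatives are not: each of them is
   the logarithmic derivative of exp S'. *)
Definition dmaster_dt t z (i : nat) (a : 'I_(below lam i)) : C :=
  derive1 (fun s : C => exp_master (tupdate t a s) z) (t i a) / exp_master t z.

Definition dmaster_dz t z (j : 'I_N) : C :=
  'D_(delta_mx 0 j) (exp_master t) z / exp_master t z.

Definition nondegenerate t z : Prop :=
  [/\ forall k l : 'I_N, k != l -> z 0 k != z 0 l,
      forall (k : 'I_N) (a : 'I_(below lam 1)), z 0 k != t 1%N a,
      forall (i : nat) (a b : 'I_(below lam i)), (0 < i)%N ->
        a != b -> t i a != t i b &
      forall (i : nat) (a : 'I_(below lam i)) (b : 'I_(below lam i.+1)),
        (0 < i)%N -> t i a != t i.+1 b].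

Definition critical_point t z : Prop :=
  nondegenerate t z /\
  forall (i : nat) (a : 'I_(below lam i)), (0 < i)%N -> dmaster_dt t z a = 0.

End Master.

Section Zone.
Variables (R : realType) (N : nat).
Local Notation C := (Cplx R).

(* Only M > 0 is used; in the order of the complex field this makes M real. *)
Definition zone (M : C) : set 'rV[C]_N :=
  [set z : 'rV[C]_N | (forall j, z 0 j != 0) /\
    forall i j : 'I_N, j = i.+1 :> nat -> M < `|z 0 j / z 0 i|].

Definition asymptotic_zone : set_system 'rV[C]_N :=
  filter_from [set M : C | 0 < M] zone.

Global Instance asymptotic_zone_filter : Filter asymptotic_zone.
Proof.
apply: filter_from_filter; first by exists 1; rewrite /= ltr01.
move=> M M' /= M0 M'0; exists (M + M'); first exact: addr_gt0.
move=> z [z0 zM]; split; split=> // i j ij; apply: lt_trans (zM _ _ ij).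
  by rewrite ltrDl.
by rewrite ltrDr.
Qed.

Canonical asymptotic_zone_filter_on := FilterType asymptotic_zone _.

End Zone.

Arguments asymptotic_zone {R N}.

Section Families.
Variables (R : realType) (N : nat) (lam : seq nat).
Local Notation C := (Cplx R).
Implicit Types (t : 'rV[C]_N -> tvars R lam) (T : std_tableau N lam).

(* The sets zone M are open, so being complex differentiable near the
   asymptotic zone is being holomorphic on some zone M. *)
Definition critical_family t : Prop :=
  \forall z \near asymptotic_zone,
    critical_point (t z) z /\
    forall (i : nat) (a : 'I_(below lam i)), (0 < i)%N ->
      differentiable (fun w : 'rV[C]_N => t w i a) z.

(* For each i, idx i is a bijection from the upper indices of the t_i^(a) onto
   the entries j with i < x(T, j); then t_i^(j) is t i a for j = idx i a. *)
Definition tableau_indexing T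
    (idx : forall i : nat, 'I_(below lam i) -> 'I_N) : Prop :=
  forall i : nat, (0 < i)%N ->
    injective (idx i) /\
    forall j : 'I_N, (exists a, idx i a = j) <-> (i < row_of T j)%N.

Definition has_tableau_asymptotics T (beta : nat -> 'I_N -> rat) t : Prop :=
  (exists idx : forall i : nat, 'I_(below lam i) -> 'I_N,
    tableau_indexing T idx /\
    forall (i : nat) (a : 'I_(below lam i)), (0 < i)%N ->
      (fun z : 'rV[C]_N => t z i a - ratr (beta i (idx i a)) * z 0 (idx i a))
        =o_asymptotic_zone (fun z : 'rV[C]_N => z 0 (idx i a))) /\
  forall j : 'I_N,
    (fun z : 'rV[C]_N => dmaster_dz (t z) z j
       - ((col_of T j)%:R - (row_of T j)%:R) / z 0 j)
      =o_asymptotic_zone (fun z : 'rV[C]_N => (z 0 j)^-1).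

End Families.

(* Main.v *)
Require Import Defs.
From HB Require Import structures.
From mathcomp Require Import all_boot all_order all_algebra.
From mathcomp Require Import all_classical all_reals all_analysis.
From mathcomp Require Import complex.
From mathcomp Require Import ring lra zify.
(* nondegenerate also names a notion for sesquilinear forms. *)
Import Defs.

Set Implicit Arguments.
Unset Strict Implicit.
Unset Printing Implicit Defensive.

Import Order.TTheory GRing.Theory Num.Theory numFieldNormedType.Exports.
Local Open Scope ring_scope.

(** The variables t_i^(a) form level i, and level 0 consists of the z_j. The critical
    equations are the Bethe equations: for t in level i > 0, the sum of 2 / (t - u)
    over the other u of the same level equals the sum of 1 / (t - u) over the levels
    i - 1 and i + 1 (dmaster_dtE).

    A standard tableau T is encoded by the word rho of the rows (from 0) of its
    entries; the words that occur are those in whose initial segments no letter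
    r + 1 is more frequent than r (word_of_lattice, tableau_of_word). The constants
    are products over r < i of g_r / (g_r + 1), where g_r > 0 is, up to a shift,
    the difference of the lengths of the rows r and rho j when the entry j is
    added (beta_of, gap); so they are in (0, 1) and decrease strictly with i.

    Existence. With t_i^(j) = w_i^(j) z_j, the equation of t_i^(j) multiplied by z_j
    is rational in the unknowns w and the ratios z_j / z_l with j < l, and these
    ratios tend to 0. At ratios 0 the system decouples into one system for each j,
    which the constants above solve (bethe_base), and its Jacobian is tridiagonal
    with signs that make it injective (tridiagonal_injective). The solution for small
    ratios comes from an implicit function theorem (implicit_function), proved with
    Newton's map and continuous slopes. It is nondegenerate, since variables of
    different scales, or of the same scale with different constants, are distinct.

    Uniqueness of the form. Given a critical family, consider an ultrafilter
    finer than the asymptotic zone. Functions of z modulo the ultrafilter form a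
    field K, and limits along it define a place from K to the complex numbers
    (ulim_place), for which each z_j / z_(j+1) is infinitesimal. The problem becomes
    algebraic. Let n be the number of rows, and Y_k the monic polynomial whose roots
    are the elements of level n - k. By the Bethe equations there are polynomials
    phi_0, ..., phi_(n-1) such that the Wronskian of the first k of them, for the
    derivation X d/dX, is a power of X times Y_k (bethe_polys). Look at their span
    after the substitution X -> z_j X and passage to the limit. The full Wronskian
    becomes X^M (X - 1) up to a constant, which forces the set of orders at 0 of the
    limiting space to be obtained from the set of its degrees by lowering a single
    element by one (scale_step); moreover these orders bound the degrees at the
    scale of z_(j-1). So from the largest scale to the smallest, the exponents
    descend from the shifted parts of lambda to 0, ..., n - 1 one step at a time,
    and remain distinct: this is a standard tableau (tower_limits). The Wronskians
    of the initial segments have limits with a linear factor whose root is a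
    ratio of Vandermonde determinants; it is the constant of the variable
    of scale z_j (place_tableau).

    It remains to see that the result does not depend on the ultrafilter. Each
    variable has, everywhere near the asymptotic zone, the scale of some z_j. Zones are
    connected up to a factor in their bounds (zone_connected), so by continuity this
    j is constant (constant_index); hence all ultrafilters give the same tableau
    and the same limits, which are then limits along the zone (completeness).

    Finally, z_j / (z_j - u) has a limit for each u = z_l and u = t_1^(l), and counting
    shows that these sum to y - x (dz_limit). *)

(** * Wronskians in a differential domain *)
Lemma det2 (R : comPzRingType) (A : 'M[R]_2) :
  \det A = A 0 0 * A 1 1 - A 0 1 * A 1 0.
Proof.
rewrite (expand_det_row _ 0) !big_ord_recl big_ord0 /cofactor !det_mx11 !mxE /=.
rewrite /bump /= !addn0 expr0 mul1r expr1 mulN1r mulrN addr0.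
by congr (A _ _ * A _ _ - A _ _ * A _ _); apply: val_inj.
Qed.

Section Wronskian.
Variables (R : idomainType) (d : {additive R -> R}).
Hypothesis dM : forall x y, d (x * y) = d x * y + x * d y.

Definition wronskian_mx (k : nat) (f : nat -> R) : 'M[R]_k :=
  \matrix_(a, b) iter a d (f b).
Definition wronskian k f := \det (wronskian_mx k f).

Definition with_last (k : nat) (f : nat -> R) (u : R) (b : nat) : R :=
  if (b < k)%N then f b else u.

Lemma wronskian_ext k (f g : nat -> R) :
  (forall b, (b < k)%N -> f b = g b) -> wronskian k f = wronskian k g.
Proof.
move=> fg; congr (\det _); apply/matrixP=> a b; rewrite !mxE fg //.
Qed.

(** The Wronskian of f_0, ..., f_(k-1), u is a differential operator applied to
    u; these are its coefficients. *)
Definition wcof (k : nat) (f : nat -> R) (a : nat) : R :=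
  cofactor (wronskian_mx k.+1 f) (inord a) ord_max.

Lemma wronskian_last k f u :
  wronskian k.+1 (with_last k f u) = \sum_(a < k.+1) wcof k f a * iter a d u.
Proof.
rewrite /wronskian (expand_det_col _ ord_max); apply: eq_bigr => a _.
rewrite !mxE /with_last ltnn mulrC; congr (_ * _).
rewrite /wcof inord_val /cofactor; congr (_ * \det _).
apply/matrixP=> i j; rewrite !mxE /=.
have -> : bump k j = j by rewrite /bump leqNgt ltn_ord.
by rewrite ltn_ord.
Qed.

Lemma wcof_last k f : wcof k f k = wronskian k f.
Proof.
rewrite /wcof /cofactor.
have -> : inord k = ord_max :> 'I_k.+1 by apply: val_inj; rewrite /= inordK.
rewrite addnn -signr_odd odd_double expr0 mul1r; congr (\det _).
apply/matrixP=> i j; rewrite !mxE /=.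
have bk (x : 'I_k) : bump k x = x by rewrite /bump leqNgt ltn_ord.
by rewrite !bk.
Qed.

Lemma wronskian_repeat k f b : (b < k)%N ->
  wronskian k.+1 (with_last k f (f b)) = 0.
Proof.
move=> bk.
have bk1 : (b < k.+1)%N by apply: ltnW.
rewrite /wronskian -det_tr.
apply: (@determinant_alternate _ _ _ (Ordinal bk1) ord_max).
  by rewrite -val_eqE /= neq_ltn bk.
by move=> i; rewrite !mxE /with_last /= bk ltnn.
Qed.

(** Sylvester's identity W(f, a) d(W(f, b)) - d(W(f, a)) W(f, b) = W(f) W(f, a, b), for
    f = (f_0, ..., f_(k-1)), a = f_k and b = f_(k+1). Row operations turn the last
    two rows of the Wronskian matrix of (f, a, b) into L and d o L, where
    L u = W(f, u); the result is block triangular because L kills f, and the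
    operations multiply the determinant by W(f)^2. *)
Lemma wronskian_sylvester k f :
  wronskian k f != 0 ->
  wronskian k.+1 f * d (wronskian k.+1 (with_last k f (f k.+1)))
    - d (wronskian k.+1 f) * wronskian k.+1 (with_last k f (f k.+1))
  = wronskian k f * wronskian k.+2 f.
Proof.
move=> w0.
pose L u := wronskian k.+1 (with_last k f u).
have Lk : wronskian k.+1 f = L (f k).
  apply: wronskian_ext => b; rewrite ltnS leq_eqVlt /with_last.
  by case/orP => [/eqP -> | ->]; rewrite ?ltnn.
rewrite Lk -/(L _).
pose c := wcof k f.
have LE u : L u = \sum_(a < k.+1) c a * iter a d u by exact: wronskian_last.
pose c' a := if a is a'.+1 then c a' else 0.
have dL u : d (L u) = \sum_(a < k.+2) (d (c a) *+ (a < k.+1)%N + c' a) * iter a d u.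
  rewrite LE raddf_sum /=.
  under [RHS]eq_bigr do rewrite mulrDl.
  rewrite big_split /= [X in _ = X + _]big_ord_recr [X in _ = _ + X]big_ord_recl /=.
  rewrite ltnn mulr0n !mul0r addr0 add0r -big_split /=.
  apply: eq_bigr => a _; rewrite dM ltn_ord mulr1n; congr (_ + _ * _).
(* The row operations: the identity on the first k rows, then the coefficients of L
   and of d o L. *)
pose Q : 'M[R]_(k + 2) := \matrix_(a, b)
  if (a < k)%N then (a == b)%:R
  else if a == k :> nat then c b *+ (b < k.+1)%N
  else d (c b) *+ (b < k.+1)%N + c' b.
pose M : 'M[R]_(k + 2) := wronskian_mx (k + 2) f.
have QM a b : (Q *m M) a b = if (a < k)%N then iter a d (f b)
    else if a == k :> nat then L (f b) else d (L (f b)).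
  rewrite mxE; case: ifP => ak.
    rewrite (bigD1 a) //= big1 ?addr0.
      by rewrite !mxE ak eqxx mul1r.
    by move=> j ja; rewrite !mxE ak eq_sym (negbTE ja) mul0r.
  have sumk2 (F : 'I_(k + 2) -> R) (G : nat -> R) :
      (forall j, F j = G j) -> \sum_j F j = \sum_(j < k.+2) G j.
    by move=> FG; rewrite (eq_bigr (G \o val)) // -(big_mkord xpredT G) addn2 big_mkord.
  case: ifP => ak'.
    rewrite LE (sumk2 _ (fun n => c n *+ (n < k.+1)%N * iter n d (f b))).
      rewrite big_ord_recr /= ltnn mulr0n mul0r addr0.
      by apply: eq_bigr => j _; rewrite ltn_ord.
    by move=> j; rewrite !mxE ak ak'.
  rewrite dL; apply: (sumk2 _ (fun n => (d (c n) *+ (n < k.+1)%N + c' n) * iter n d (f b))).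
  by move=> j; rewrite !mxE ak ak'.
have detQ : \det Q = wronskian k f ^+ 2.
  rewrite det_trig.
    rewrite big_split_ord /= big1 ?mul1r; last first.
      by move=> i _; rewrite mxE /= ltn_ord eqxx.
    rewrite !big_ord_recl big_ord0 !mxE /= mulr1 /bump /=.
    rewrite !addn0 !addn1 ltnn eqxx ltnSn ltnn mulr0n mulr1n add0r /=.
    have -> : (k.+1 < k)%N = false by lia.
    have -> : (k.+1 == k)%N = false by lia.
    by rewrite /c wcof_last expr2.
  apply/is_trig_mxP => i j ij; rewrite mxE.
  case: ifP => ik; first by rewrite -val_eqE ltn_eqF.
  have ki : (k <= i)%N by rewrite leqNgt ik.
  have jk : (j < k.+1)%N = false by apply/negbTE; rewrite -leqNgt (leq_trans _ ij).
  case: ifP => ik'; first by rewrite jk.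
  rewrite jk mulr0n add0r.
  have : (k.+1 < j)%N by apply: leq_trans ij; rewrite ltnS ltn_neqAle eq_sym ik'.
  by have := ltn_ord j; lia.
have Lb b : (b < k)%N -> L (f b) = 0 by exact: wronskian_repeat.
have detQM : \det (Q *m M) = wronskian k f * (L (f k) * d (L (f k.+1)) - d (L (f k)) * L (f k.+1)).
  rewrite -[Q *m M]submxK.
  have -> : dlsubmx (Q *m M) = 0.
    apply/matrixP=> i j; rewrite mxE [RHS]mxE mxE QM /=.
    by rewrite ltnNge leq_addr /= Lb //= raddf0; case: ifP.
  rewrite det_ublock; congr (_ * _).
    congr (\det _); apply/matrixP=> i j.
    by rewrite mxE mxE QM [RHS]mxE /= ltn_ord.
  have drE i j : drsubmx (Q *m M) i j = (Q *m M) (rshift k i) (rshift k j).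
    by rewrite mxE mxE.
  rewrite det2 !drE !QM /= !addn0 !addn1 ltnn eqxx.
  have -> : (k.+1 < k)%N = false by lia.
  have -> : (k.+1 == k)%N = false by lia.
  rewrite /=; ring.
have := detQM; rewrite det_mulmx detQ.
have -> : \det M = wronskian k.+2 f by rewrite /M -/(wronskian (k + 2) f) addn2.
by rewrite expr2 -mulrA => /(mulfI w0) ->.
Qed.

End Wronskian.

(** * Wronskians of polynomials for the Euler derivation *)
(** The Euler derivation is homogeneous, so that its Wronskians commute with the
    changes of scale and multiply monomials by constants; this is why it replaces
    the ordinary derivative, whose Wronskians differ by a power of X. *)
Definition euler (K : fieldType) (p : {poly K}) : {poly K} := 'X * p^`().

Section Euler.
Variable K : fieldType.
Implicit Types (p q : {poly K}) (f : nat -> {poly K}).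

Fact euler_is_linear : linear (@euler K).
Proof. by move=> a p q; rewrite /euler derivD derivZ mulrDr scalerAr. Qed.
HB.instance Definition _ := GRing.isLinear.Build K {poly K} {poly K} _ (@euler K) euler_is_linear.

Lemma eulerM p q : euler (p * q) = euler p * q + p * euler q.
Proof. by rewrite /euler derivM; ring. Qed.

Lemma euler_Xn m : euler 'X^m = m%:R *: 'X^m :> {poly K}.
Proof.
rewrite /euler derivXn scaler_nat mulrnAr.
by case: m => [|m] /=; rewrite ?mulr0n // -exprS.
Qed.

Lemma iter_eulerZ a c p : iter a (@euler K) (c *: p) = c *: iter a (@euler K) p.
Proof. by elim: a => //= a ->; rewrite linearZ. Qed.

Lemma iter_euler_sum a I (r : seq I) (P : pred I) (F : I -> {poly K}) :
  iter a (@euler K) (\sum_(i <- r | P i) F i) =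
  \sum_(i <- r | P i) iter a (@euler K) (F i).
Proof. by elim: a => //= a ->; rewrite linear_sum. Qed.

Notation wron := (wronskian (@euler K)).

Lemma wron_triangular k f (h : nat -> {poly K}) (c : nat -> nat -> K) :
  (forall b, (b < k)%N -> h b = \sum_(j < b.+1) c b j *: f j) ->
  wron k h = (\prod_(b < k) c b b) *: wron k f.
Proof.
move=> hE; pose C : 'M[{poly K}]_k := \matrix_(i, j) ((c j i) *+ (i <= j)%N)%:P.
have -> : wron k h = \det (wronskian_mx (@euler K) k f *m C).
  congr (\det _); apply/matrixP=> a b; rewrite !mxE hE // iter_euler_sum.
  under [RHS]eq_bigr => j _ do rewrite !mxE.
  rewrite -(big_mkord xpredT (fun j => iter a (@euler K) (c b j *: f j))).
  rewrite -(big_mkord xpredT (fun j => iter a (@euler K) (f j) * (c b j *+ (j <= b)%N)%:P)).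
  rewrite [RHS](big_cat_nat _ (n := b.+1)) //=.
  rewrite [X in _ = _ + X]big1_seq ?addr0.
    apply: eq_big_nat => j /andP[_ jb]; rewrite iter_eulerZ -ltnS jb mulr1n.
    by rewrite mulrC mul_polyC.
  move=> j; rewrite mem_index_iota => /andP[_ /andP[jb _]].
  by rewrite leqNgt jb mulr0n mulr0.
rewrite det_mulmx mulrC -mul_polyC; congr (_ * _).
rewrite -det_tr det_trig.
  by rewrite rmorph_prod /=; apply: eq_bigr => i _; rewrite !mxE leqnn.
by apply/is_trig_mxP=> i j ij; rewrite !mxE leqNgt ij.
Qed.

(** Vandermonde determinant of the exponents *)
Definition vand (k : nat) (q : nat -> nat) : K :=
  \prod_(j < k) \prod_(i < j) ((q j)%:R - (q i)%:R).

Lemma vandE k (q : nat -> nat) :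
  vand k q = \prod_(i < k) \prod_(j < k | (i < j)%N) ((q j)%:R - (q i)%:R).
Proof.
rewrite (exchange_big_dep xpredT) //=; apply: eq_bigr => j _.
rewrite (big_ord_widen_cond k xpredT (fun i => (q j)%:R - (q i)%:R)) //=.
exact: ltnW.
Qed.

Lemma det_Vandermonde_vand k (q : nat -> nat) :
  \det (Vandermonde k (\row_(b < k) (q b)%:R)) = vand k q.
Proof.
rewrite det_Vandermonde vandE.
by apply: eq_bigr => i _; apply: eq_bigr => j _; rewrite !mxE.
Qed.

(** At X = 0 the Euler derivation acts on X^o g as multiplication by o, so the
    lowest coefficient of the Wronskian is a Vandermonde determinant in the
    orders: it does not vanish when the orders are distinct. *)
Lemma wron_order k f (o : nat -> nat) (g : nat -> {poly K}) :
  (forall b, (b < k)%N -> f b = 'X^(o b) * g b) ->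
  exists G, wron k f = 'X^(\sum_(b < k) o b) * G /\
    G.[0] = (\prod_(b < k) (g b).[0]) * vand k o.
Proof.
move=> fE.
(* Conjugation of the derivation by multiplication with X^(o b). *)
pose e b p := euler p + (o b)%:R *: p.
have iE a b p : iter a (@euler K) ('X^(o b) * p) = 'X^(o b) * iter a (e b) p.
  elim: a p => //= a IH p; rewrite IH eulerM /e mulrDr addrC euler_Xn.
  by rewrite -scalerAl -scalerAr.
pose A : 'M[{poly K}]_k := \matrix_(a, b) iter a (e b) (g b).
exists (\det A); split.
  have -> : wron k f = \det (A *m diag_mx (\row_b 'X^(o b))).
    congr (\det _); apply/matrixP=> a b; rewrite !mxE fE // iE.
    rewrite (bigD1 b) //= big1 ?addr0; last first.
      by move=> j jb; rewrite !mxE (negbTE jb) mulr0n mulr0.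
    by rewrite !mxE eqxx mulr1n mulrC.
  rewrite det_mulmx det_diag mulrC; congr (_ * _).
  by rewrite -prodrXr; apply: eq_bigr => i _; rewrite mxE.
have -> : (\det A).[0] = horner_eval 0 (\det A) by [].
rewrite -det_map_mx.
have -> : map_mx (horner_eval 0) A = Vandermonde k (\row_(b < k) (o b)%:R) *m diag_mx (\row_b (g b).[0]).
  apply/matrixP=> a b; rewrite !mxE (bigD1 b) //= big1 ?addr0; last first.
    by move=> j jb; rewrite !mxE (negbTE jb) mulr0n mulr0.
  rewrite !mxE eqxx mulr1n /horner_eval.
  elim: (a : nat) => [|m IH] /=; first by rewrite expr0 mul1r.
  by rewrite /e /euler hornerD hornerZ IH hornerM hornerX mul0r add0r exprS mulrA.
rewrite det_mulmx det_Vandermonde_vand det_diag mulrC; congr (_ * _).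
by apply: eq_bigr => i _; rewrite mxE.
Qed.

Lemma wron_monomials k (a : nat -> K) (q : nat -> nat) :
  wron k (fun b => a b *: 'X^(q b)) =
  ((\prod_(b < k) a b) * vand k q) *: 'X^(\sum_(b < k) q b).
Proof.
have iE m b : iter m (@euler K) (a b *: 'X^(q b)) = (a b * (q b)%:R ^+ m) *: 'X^(q b).
  rewrite iter_eulerZ -scalerA; congr (_ *: _).
  elim: m => [|m IH] /=; first by rewrite expr0 scale1r.
  by rewrite IH linearZ /= euler_Xn exprSr scalerA.
have -> : wron k (fun b => a b *: 'X^(q b)) =
    \det (map_mx polyC (Vandermonde k (\row_(b < k) (q b)%:R)) *m
          diag_mx (\row_b (a b *: 'X^(q b)))).
  congr (\det _); apply/matrixP=> i b; rewrite !mxE iE.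
  rewrite (bigD1 b) //= big1 ?addr0; last first.
    by move=> j jb; rewrite !mxE (negbTE jb) mulr0n mulr0.
  by rewrite !mxE eqxx mulr1n mul_polyC scalerA mulrC.
rewrite det_mulmx det_map_mx det_Vandermonde_vand det_diag mul_polyC.
under [X in _ *: X]eq_bigr do rewrite mxE -mul_polyC.
by rewrite big_split /= -rmorph_prod prodrXr mul_polyC scalerA mulrC.
Qed.

Lemma wron_add_at k f (c : nat) (u v : {poly K}) : (c < k)%N ->
  wron k (fun b => if b == c then u + v else f b) =
  wron k (fun b => if b == c then u else f b) +
  wron k (fun b => if b == c then v else f b).
Proof.
move=> ck; rewrite /wronskian -[LHS]det_tr -[X in _ = X + _]det_tr -[X in _ = _ + X]det_tr.
have iD m (x y : {poly K}) : iter m (@euler K) (x + y) = iter m (@euler K) x + iter m (@euler K) y.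
  by elim: m => //= m ->; rewrite linearD.
rewrite (@determinant_multilinear _ _ _ (wronskian_mx (@euler K) k (fun b => if b == c then u else f b))^T
  (wronskian_mx (@euler K) k (fun b => if b == c then v else f b))^T (Ordinal ck) 1 1) ?mul1r //.
- by apply/rowP=> j; rewrite !mxE /= eqxx !mul1r iD.
- by apply/matrixP=> i j; rewrite !mxE /= eq_sym (negbTE (neq_bump _ _)).
- by apply/matrixP=> i j; rewrite !mxE /= eq_sym (negbTE (neq_bump _ _)).
Qed.

Definition rescale (s : K) (p : {poly K}) := p \Po (s *: 'X).

Lemma coef_rescale s p e : (rescale s p)`_e = p`_e * s ^+ e.
Proof.
rewrite /rescale comp_polyE coef_sum.
have E (i : 'I_(size p)) : (p`_i *: (s *: 'X) ^+ i)`_e = p`_i * s ^+ i * (e == i)%:R.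
  by rewrite exprZn !coefZ coefXn mulrA.
under eq_bigr do rewrite E.
have [ep|pe] := ltnP e (size p).
  rewrite (bigD1 (Ordinal ep)) //= eqxx mulr1 big1 ?addr0 // => i.
  by rewrite -val_eqE /= eq_sym => /negbTE ->; rewrite mulr0.
rewrite nth_default // mul0r big1 // => i _.
by rewrite gtn_eqF ?mulr0 // (leq_trans _ pe).
Qed.

Lemma wron_rescale s k f : wron k (fun b => rescale s (f b)) = rescale s (wron k f).
Proof.
have iE m p : iter m (@euler K) (rescale s p) = rescale s (iter m (@euler K) p).
  elim: m => //= m ->; rewrite /rescale /euler deriv_comp derivZ derivX.
  by rewrite comp_polyM comp_polyX mulrA alg_polyC mulrC mul_polyC; rewrite -scalerAl.
rewrite /rescale -[RHS]/(comp_poly _ _) -det_map_mx; congr (\det _).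
by apply/matrixP=> a b; rewrite !mxE iE.
Qed.

End Euler.
Notation wron := (wronskian (@euler _)).

(** * From the critical equations to a space of polynomials *)
Section BetheToWronskian.
Variable K : fieldType.
Hypothesis K0 : forall m : nat, m.+1%:R != 0 :> K.
Implicit Types (p y : {poly K}).

Definition roots_poly (rs : seq K) : {poly K} := \prod_(x <- rs) ('X - x%:P).

Lemma antiderivative p : exists P : {poly K}, P^`() = p.
Proof.
exists (\poly_(i < (size p).+1) (p`_i.-1 / i%:R)).
apply/polyP=> i; rewrite coef_deriv coef_poly ltnS.
have [ip|pi] := ltnP i (size p); last by rewrite mul0rn nth_default.
by rewrite -(mulr_natr (_ / _)) mulfVK // K0.
Qed.

Lemma roots_poly_dvdp rs p : uniq rs -> (forall x, x \in rs -> p.[x] = 0) ->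
  roots_poly rs %| p.
Proof.
move=> u h; apply: uniq_roots_dvdp; first by apply/allP=> x /h /eqP.
by rewrite uniq_rootsE.
Qed.

Lemma root_roots_poly rs x : ((roots_poly rs).[x] == 0) = (x \in rs).
Proof. by rewrite -root_prod_XsubC. Qed.

Lemma roots_poly_deriv_neq0 rs x : uniq rs -> x \in rs ->
  (roots_poly rs)^`().[x] != 0.
Proof.
move=> u xr; have := perm_to_rem xr => pr.
have -> : roots_poly rs = ('X - x%:P) * roots_poly (rem x rs).
  by rewrite /roots_poly (perm_big _ pr) big_cons.
rewrite derivM derivXsubC mul1r hornerD hornerM hornerXsubC subrr mul0r addr0.
by rewrite root_roots_poly mem_rem_uniqF.
Qed.

Lemma roots_poly_coprime rs : uniq rs -> coprimep (roots_poly rs) (roots_poly rs)^`().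
Proof.
move=> u; have : forall s, {subset s <= rs} -> coprimep (roots_poly s) (roots_poly rs)^`().
  elim=> [|x s IH] sr; first by rewrite /roots_poly big_nil coprime1p.
  rewrite /roots_poly big_cons coprimepMl; apply/andP; split; last first.
    by apply: IH => z zs; apply: sr; rewrite inE zs orbT.
  rewrite coprimep_sym coprimep_XsubC /root.
  by apply: roots_poly_deriv_neq0 => //; apply: sr; rewrite inE eqxx.
exact.
Qed.

Definition wron2 y p := y * p^`() - y^`() * p.

(** Solving y P' - y' P = r amounts to integrating r / y^2, and the hypothesis
    at the roots of y says exactly that r / y^2 has no residues. Concretely, a
    particular solution modulo y comes from a Bezout relation between y and y',
    the residue condition lifts it modulo y^2, and the rest is y^2 times an
    antiderivative. The normalization of P uses up the freedom to add a multiple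
    of y. *)
Lemma wron2_solve rs (r : {poly K}) : uniq rs ->
  (forall x, x \in rs ->
     r^`().[x] * (roots_poly rs)^`().[x] = r.[x] * (roots_poly rs)^`()^`().[x]) ->
  exists P, wron2 (roots_poly rs) P = r /\ P`_(size rs) = 0.
Proof.
move=> u rE; set y := roots_poly rs in rE *.
have /Bezout_eq1_coprimepP [[v w] /= vw] := roots_poly_coprime u.
rewrite -/y in vw.
(* At a root x of y, w is the inverse of y', so y P0' - y' P0 agrees with r there. *)
pose P0 := - (w * r).
pose E := r - wron2 y P0.
have yx x : x \in rs -> y.[x] = 0 by rewrite -root_roots_poly => /eqP.
have wx x : x \in rs -> w.[x] * y^`().[x] = 1.
  move=> xr; have := congr1 (fun p => p.[x]) vw.
  by rewrite hornerD !hornerM yx // mulr0 add0r hornerC.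
have yE : y %| E.
  apply: roots_poly_dvdp => // x xr.
  rewrite /E /wron2 /P0 !hornerE yx // derivN.
  by have := wx x xr => h; ring: h.
have [Q EQ] := dvdpP _ _ yE.
have yQ : y %| Q.
  apply: roots_poly_dvdp => // x xr.
  have dE : E^`().[x] = 0.
    rewrite /E /wron2 /P0 !poly.derivE !hornerE yx //.
    have := wx x xr; have := rE x xr; rewrite -/y => h1 h2.
    suff -> : r^`().[x] = r.[x] * y^`()^`().[x] * w.[x] by ring.
    by rewrite -h1 -mulrA [_ * w.[x]]mulrC h2 mulr1.
  move: dE; rewrite EQ derivM hornerD !hornerM yx // mulr0 add0r => /eqP.
  rewrite mulf_eq0 (negbTE (roots_poly_deriv_neq0 u xr)) orbF => /eqP //.
have [S QS] := dvdpP _ _ yQ.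
have [T TS] := antiderivative S.
pose P1 := P0 + y * T.
have WP c : wron2 y (P1 - c *: y) = r.
  rewrite /wron2 /P1 derivB derivD derivM derivZ TS -!mul_polyC.
  have -> : r = wron2 y P0 + S * y * y by rewrite -QS -EQ /E; ring.
  by rewrite /wron2; ring.
exists (P1 - P1`_(size rs) *: y); split; first exact: WP.
rewrite coefB coefZ.
suff -> : y`_(size rs) = 1 by rewrite mulr1 subrr.
have /monicP : y \is monic by apply: monic_prod_XsubC.
by rewrite lead_coefE size_prod_XsubC.
Qed.

Lemma coefM_top (a b : {poly K}) (l p : nat) : (size a <= l.+1)%N -> (size b <= p.+1)%N ->
  (a * b)`_(l + p) = a`_l * b`_p.
Proof.
move=> sa sb; have lp : (l < (l + p).+1)%N by rewrite ltnS leq_addr.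
rewrite coefM (bigD1 (Ordinal lp)) //= addKn big1 ?addr0 // => i.
rewrite -val_eqE /= neq_ltn => /orP[il|li].
  rewrite [b`_ _]nth_default ?mulr0 // (leq_trans sb) //; lia.
by rewrite nth_default ?mul0r // (leq_trans sa).
Qed.

Lemma size_roots_poly rs : size (roots_poly rs) = (size rs).+1.
Proof. by rewrite size_prod_XsubC. Qed.

(** The top coefficient of y P' - y' P is the difference of the degrees times the
    leading coefficients, and the normalization of P makes the degrees differ. *)
Lemma wron2_size rs (r P : {poly K}) : r != 0 ->
  wron2 (roots_poly rs) P = r -> P`_(size rs) = 0 ->
  (size P + size rs <= (size r).+1)%N.
Proof.
move=> r0 WP P0; set y := roots_poly rs in WP.
have Pn0 : P != 0.
  by apply: contra_neq r0 => PE; rewrite -WP PE /wron2 deriv0 !mulr0 subrr.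
have sy : size y = (size rs).+1 by rewrite size_roots_poly.
have : (0 < size P)%N by rewrite size_poly_gt0.
case sP : (size P) => [//|p] _.
have lP : P`_p != 0 by move: Pn0; rewrite -lead_coef_eq0 lead_coefE sP.
have pl : p != size rs by apply: contraNneq lP => ->; rewrite P0.
have y1 : y`_(size rs) = 1.
  have /monicP : y \is monic by apply: monic_prod_XsubC.
  by rewrite lead_coefE sy.
have se (a : {poly K}) m : (size a <= m.+1)%N -> (size (euler a) <= m.+1)%N.
  move=> am; apply/leq_sizeP => j mj; rewrite /euler coefXM.
  case: j mj => [|j] mj //=; rewrite coef_deriv nth_default ?mul0rn //.
  exact: leq_trans mj.
have ce (a : {poly K}) m : (euler a)`_m = m%:R * a`_m.
  by rewrite /euler coefXM; case: m => [|m] /=; rewrite ?mul0r // coef_deriv mulr_natl.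
have : ('X * r)`_(size rs + p) != 0.
  have -> : 'X * r = y * euler P - euler y * P by rewrite -WP /wron2 /euler; ring.
  rewrite coefB !coefM_top ?se ?sP ?sy // !ce y1 mul1r mulr1 -mulrBl.
  rewrite mulf_neq0 //.
  have [lt|gt|/eqP] := ltngtP p (size rs); last by rewrite (negbTE pl).
    rewrite -opprB oppr_eq0 -natrB; last by rewrite ltnW.
    by rewrite -[(size rs - p)%N]prednK ?K0 // subn_gt0.
  rewrite -natrB; last by rewrite ltnW.
  by rewrite -[(p - size rs)%N]prednK ?K0 // subn_gt0.
rewrite coefXM; case: ifP => [|_ h]; first by rewrite eqxx.
rewrite leqNgt; apply: contra h => h; rewrite nth_default //.
by rewrite -ltnS prednK; move: h; rewrite ?addSn addnC ?ltnS //; apply: leq_ltn_trans.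
Qed.

Local Notation Y rts k := (roots_poly (rts k)).

Section Chain.
Variables (n : nat) (rts : nat -> seq K).
Hypothesis rts0 : rts 0%N = [::].
Hypothesis rts_uniq : forall k, (k <= n)%N -> uniq (rts k).
Hypothesis rts_disj : forall k x, (k < n)%N -> x \in rts k -> x \notin rts k.+1.
Hypothesis bethe : forall k x, (k.+1 < n)%N -> x \in rts k.+1 ->
  (Y rts k * Y rts k.+2)^`().[x] * (Y rts k.+1)^`().[x] =
  (Y rts k * Y rts k.+2).[x] * (Y rts k.+1)^`()^`().[x].

(** The equations at level k + 1 are the residue conditions for passing from
    Q_(k+1) to Q_k; the remaining part of the hypothesis of wron2_solve comes from
    the equation satisfied by Q_(k+1) itself. *)
Lemma bethe_chain l : (l < n)%N -> exists Q : nat -> {poly K},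
  [/\ Q l = Y rts l.+1,
     forall k, (k < l)%N -> wron2 (Y rts k.+1) (Q k) = Y rts k * Q k.+1 &
     (size (Q 0%N) + size (rts l) <= size (rts l.+1) + l.+1)%N].
Proof.
move=> ln.
have Y0 k : Y rts k != 0 by rewrite monic_neq0 // monic_prod_XsubC.
suff : forall m, (m <= l)%N -> exists Q : nat -> {poly K},
  [/\ Q l = Y rts l.+1,
     forall k, (l - m <= k < l)%N -> wron2 (Y rts k.+1) (Q k) = Y rts k * Q k.+1,
     Q (l - m)%N != 0 &
     (size (Q (l - m)%N) + size (rts l) <= size (rts l.+1) + size (rts (l - m)%N) + m.+1)%N].
  move=> /(_ l (leqnn l)) [Q [h1 h2 _ h4]]; exists Q; split=> //.
    by move=> k kl; apply: h2; rewrite subnn.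
  by move: h4; rewrite subnn rts0 addn0.
elim=> [|m IH] ml.
  exists (fun=> Y rts l.+1); split=> //; last by rewrite subn0 size_roots_poly; lia.
  by move=> k; rewrite subn0; lia.
have [Q [Ql Qeq Qn0 Qs]] := IH (ltnW ml).
pose k := (l - m.+1)%N.
have kE : (l - m = k.+1)%N by rewrite /k; lia.
have kl : (k < l)%N by rewrite /k; lia.
rewrite kE in Qeq Qn0 Qs.
have WQ x : x \in rts k.+1 -> (wron2 (Y rts k.+2) (Q k.+1)).[x] = 0.
  move=> xr; have [kl1|] := ltnP k.+1 l; last first.
    move=> lk; have -> : k.+1 = l by lia.
    by rewrite Ql /wron2 mulrC subrr horner0.
  rewrite Qeq ?kl1 ?leqnn // hornerM.
  have /eqP -> : (Y rts k.+1).[x] == 0 by rewrite root_roots_poly.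
  by rewrite mul0r.
have [||P [WP P0]] := @wron2_solve (rts k.+1) (Y rts k * Q k.+1).
- by apply: rts_uniq; lia.
- move=> x xr.
  have b0 : (Y rts k.+2).[x] != 0 by rewrite root_roots_poly rts_disj //; lia.
  have := WQ x xr; have := bethe (x := x) (k := k) _ xr.
  rewrite /wron2 !derivM !hornerE => /(_ _) h1 h2.
  apply: (mulfI b0).
  have {}h1 := h1 (leq_ltn_trans kl ln).
  have {}h2 := subr0_eq h2.
  set a := (Y rts k).[x] in h1 *; set a' := (Y rts k)^`().[x] in h1 *.
  set b := (Y rts k.+2).[x] in h1 h2 *; set b' := (Y rts k.+2)^`().[x] in h1 h2 *.
  set q := (Q k.+1).[x] in h2 *; set q' := (Q k.+1)^`().[x] in h2 *.
  set y' := (Y rts k.+1)^`().[x] in h1 *; set y'' := (Y rts k.+1)^`()^`().[x] in h1 *.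
  transitivity (q * ((a' * b + a * b') * y')); last by rewrite h1; ring.
  transitivity (a' * q * b * y' + a * (b * q') * y'); first by ring.
  by rewrite h2; ring.
have R0 : Y rts k * Q k.+1 != 0 by rewrite mulf_neq0.
have sP := wron2_size R0 WP P0.
exists (fun j => if (j <= k)%N then P else Q j).
rewrite -/k leqnn; split.
- by rewrite leqNgt kl.
- move=> j /andP[kj jl].
  have [jk|kj'] := leqP j k.
    have -> : j = k by lia.
    by rewrite ltnn.
  by rewrite leqNgt ltnS (ltnW kj') /= Qeq // kj' jl.
- by apply: contra_neq R0 => PE; rewrite -WP PE /wron2 deriv0 !mulr0 subrr.
- have := size_mul (Y0 k) Qn0; rewrite size_roots_poly.
  move: sP Qs => + + sYQ; rewrite sYQ.
  move: (size P) (size (Q k.+1)) (size (rts k)) (size (rts k.+1)) (size (rts l)) (size (rts l.+1)).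
  by lia.
Qed.

(** The polynomials phi_l end the chains of bethe_chain. By Sylvester's identity
    the Euler Wronskian of phi_0, ..., phi_(k-1), phi_l is the power of X times
    the k-th member of the l-th chain, and for l = k this is Y_(k+1). *)
Lemma bethe_polys : exists phi : nat -> {poly K},
  (forall k, (k <= n)%N -> wron k phi = 'X^('C(k, 2)) * Y rts k) /\
  (forall l, (l < n)%N -> (size (phi l) + size (rts l) <= size (rts l.+1) + l.+1)%N).
Proof.
have Y0 k : Y rts k != 0 by rewrite monic_neq0 // monic_prod_XsubC.
have /fin_all_exists[Q hQ] : forall l : 'I_n, exists Q : nat -> {poly K},
  [/\ Q l = Y rts l.+1,
     forall k, (k < l)%N -> wron2 (Y rts k.+1) (Q k) = Y rts k * Q k.+1 &
     (size (Q 0%N) + size (rts l) <= size (rts l.+1) + l.+1)%N].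
  by move=> l; apply: bethe_chain.
pose q l k := if insub l is Some i then Q i k else 0.
have {hQ} hq l : (l < n)%N ->
  [/\ q l l = Y rts l.+1,
     forall k, (k < l)%N -> wron2 (Y rts k.+1) (q l k) = Y rts k * q l k.+1 &
     (size (q l 0%N) + size (rts l) <= size (rts l.+1) + l.+1)%N].
  by move=> ln; have := hQ (Ordinal ln); rewrite /q insubT.
pose phi l := q l 0%N; exists phi; split; last by move=> l /hq [].
suff main : forall k l, (k <= l < n)%N ->
    wron k.+1 (with_last k phi (phi l)) = 'X^('C(k.+1, 2)) * q l k /\
    wron k phi = 'X^('C(k, 2)) * Y rts k.
  case=> [|k] kn.
    by rewrite /wronskian det_mx00 rts0 /roots_poly big_nil mulr1.
  have [] := main k k; first by rewrite leqnn.
  have [-> _ _] := hq _ kn; move=> <- _.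
  apply: wronskian_ext => b; rewrite ltnS leq_eqVlt /with_last.
  by case/orP => [/eqP -> | ->]; rewrite ?ltnn.
have Xn0 m : 'X^m != 0 :> {poly K} by rewrite monic_neq0 // monicXn.
elim=> [|k IH] l.
  move=> _; split; last by rewrite /wronskian det_mx00 rts0 /roots_poly big_nil mulr1.
  by rewrite /wronskian det_mx11 mxE /= /with_last /= expr0 mul1r.
move=> /andP[kl ln].
have kln : (k <= l < n)%N by rewrite ln (ltnW kl).
have kkn : (k <= k < n)%N by rewrite leqnn (leq_trans kl (ltnW ln)).
have [e1 wk] := IH l kln.
have [e2 _] := IH k kkn.
have [qk _ _] := hq k (leq_trans kl (ltnW ln)).
have [_ qeq _] := hq l ln.
rewrite qk in e2.
(* Sylvester's identity is applied to phi_0, ..., phi_k, phi_l. *)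
pose f' := with_last k.+1 phi (phi l).
have wf m : (m <= k.+1)%N -> wron m f' = wron m phi.
  by move=> mk; apply: wronskian_ext => b bm; rewrite /f' /with_last (leq_trans bm mk).
have wk1 : wron k.+1 phi = 'X^('C(k.+1, 2)) * Y rts k.+1.
  rewrite -e2; apply: wronskian_ext => b; rewrite ltnS leq_eqVlt /with_last.
  by case/orP => [/eqP -> | ->]; rewrite ?ltnn.
split; last exact: wk1.
have := wronskian_sylvester (@eulerM K) (k := k) (f := f').
rewrite (wf k (leqnSn k)) wk => /(_ (mulf_neq0 (Xn0 _) (Y0 _))).
have -> : wron k.+1 (with_last k f' (f' k.+1)) = wron k.+1 (with_last k phi (phi l)).
  apply: wronskian_ext => b bk; rewrite /with_last /f' /with_last ltnn.
  by case: ifP => // bk'; rewrite bk.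
rewrite (wf k.+1 (leqnn _)) wk1 e1 => syl.
apply: (mulfI (mulf_neq0 (Xn0 'C(k, 2)) (Y0 k))).
rewrite -syl.
have h := qeq _ kl; rewrite /wron2 in h.
have ex : forall m (a : {poly K}), euler ('X^m * a) = 'X^m * euler a + m%:R *: ('X^m * a).
  by move=> m a; rewrite eulerM euler_Xn -scalerAl addrC.
rewrite /= !ex !mulrDr !mulrDl.
transitivity ('X^('C(k.+1, 2)) * 'X^('C(k.+1, 2)) * 'X * (Y rts k * q l k.+1)).
  by rewrite -h /euler -!mul_polyC; ring.
have -> : 'X^('C(k, 2)) * Y rts k * ('X^('C(k.+2, 2)) * q l k.+1) =
  'X^('C(k, 2) + 'C(k.+2, 2)) * (Y rts k * q l k.+1) by rewrite exprD; ring.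
by rewrite -exprD -exprSr; congr ('X^_ * _); rewrite !binS !bin1 !bin0; lia.
Qed.
End Chain.
End BetheToWronskian.

(** * Limits given by a place *)
(** A place of K with values in k, as the relation of having a limit: the finite
    elements are those with a limit, and the others have an inverse that tends
    to 0. A relation serves better than a valuation ring with its residue map,
    because limits of functions along an ultrafilter come in this form. *)
Record place (K k : fieldType) (lim : K -> k -> Prop) : Prop := Place {
  lim_uniq : forall x a b, lim x a -> lim x b -> a = b;
  lim1 : lim 1 1;
  limD : forall x y a b, lim x a -> lim y b -> lim (x + y) (a + b);
  limN : forall x a, lim x a -> lim (- x) (- a);
  limM : forall x y a b, lim x a -> lim y b -> lim (x * y) (a * b);
  lim_total : forall x, (exists a, lim x a) \/ lim x^-1 0
}.

Section Place.
Variables (K k : fieldType) (lim : K -> k -> Prop).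
Hypothesis limP : place lim.

Lemma lim0 : lim 0 0.
Proof. by rewrite -(subrr (1 : K)) -(subrr (1 : k)); apply: (limD limP (lim1 limP) (limN limP (lim1 limP))). Qed.

Lemma limB x y a b : lim x a -> lim y b -> lim (x - y) (a - b).
Proof. by move=> xa yb; apply: (limD limP xa (limN limP yb)). Qed.

Lemma lim_neq0 x a : lim x a -> a != 0 -> x != 0.
Proof.
move=> xa; apply: contra_neq => x0; rewrite x0 in xa.
exact: lim_uniq limP _ _ _ xa lim0.
Qed.

Lemma limV x a : lim x a -> a != 0 -> lim x^-1 a^-1.
Proof.
move=> xa a0; have x0 := lim_neq0 xa a0.
case: (lim_total limP x^-1) => [[b xb]|].
  have := limM limP xa xb; rewrite divff // => /(lim_uniq limP (lim1 limP)) ab.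
  suff -> : a^-1 = b by [].
  by rewrite -[LHS]mulr1 ab mulrA mulVf ?mul1r.
by rewrite invrK => /(lim_uniq limP xa) a0'; rewrite a0' eqxx in a0.
Qed.

Lemma lim_sum I (r : seq I) (P : pred I) F G :
  (forall i, P i -> lim (F i) (G i)) ->
  lim (\sum_(i <- r | P i) F i) (\sum_(i <- r | P i) G i).
Proof.
move=> h; elim: r => [|i r IH]; first by rewrite !big_nil; apply: lim0.
by rewrite !big_cons; case: ifP => // Pi; apply: (limD limP) => //; apply: h.
Qed.

Lemma limX x a m : lim x a -> lim (x ^+ m) (a ^+ m).
Proof.
move=> xa; elim: m => [|m IH]; first by rewrite !expr0; apply: lim1.
by rewrite !exprS; apply: (limM limP).
Qed.

Lemma lim_nat m : lim m%:R m%:R.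
Proof.
elim: m => [|m IH]; first exact: lim0.
by rewrite -!natr1; apply: (limD limP) => //; apply: lim1.
Qed.

Lemma lim_exprV x m : lim x 0 -> (0 < m)%N -> lim (x ^+ m) 0.
Proof. by move=> x0 m0; have := limX m x0; rewrite expr0n gtn_eqF. Qed.

(** Of two elements of K one divides the other up to a finite factor; hence a
    finite family can be rescaled to have finite limits, not all of them 0. *)
Lemma lim_dominant m (a : nat -> K) : (exists2 j, (j < m)%N & a j != 0) ->
  exists2 j0, (j0 < m)%N & a j0 != 0 /\
    forall j, (j < m)%N -> exists b, lim (a j / a j0) b.
Proof.
elim: m => [|m IH] [j jm aj] //.
have [/existsP[i ai]|/existsPn h] := boolP [exists i : 'I_m, a i != 0].
  have [|j0 j0m [aj0 h]] := IH; first by exists i.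
  case: (lim_total limP (a m / a j0)) => [|am].
    move=> [b hb]; exists j0; first exact: ltnW.
    split=> // i'; rewrite ltnS leq_eqVlt => /orP[/eqP ->|/h //].
    by exists b.
  have [am0|am0] := eqVneq (a m) 0.
    exists j0; first exact: ltnW.
    split=> // i'; rewrite ltnS leq_eqVlt => /orP[/eqP ->|/h //].
    by exists 0; rewrite am0 mul0r; apply: lim0.
  exists m => //; split=> // i'; rewrite ltnS leq_eqVlt => /orP[/eqP ->|/h [b hb]].
    by exists 1; rewrite divff //; apply: lim1.
  exists (b * 0); have -> : a i' / a m = (a i' / a j0) * (a m / a j0)^-1.
    by rewrite invf_div mulrA divfK.
  exact: (limM limP).
have a0 i : (i < m)%N -> a i = 0.
  by move=> im; have := h (Ordinal im); rewrite negbK => /eqP.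
have am0 : a m != 0.
  by move: jm; rewrite ltnS leq_eqVlt => /orP[/eqP <- //|/a0 aj0]; rewrite aj0 eqxx in aj.
exists m => //; split=> // i; rewrite ltnS leq_eqVlt => /orP[/eqP ->|/a0 ->].
  by exists 1; rewrite divff //; apply: lim1.
by exists 0; rewrite mul0r; apply: lim0.
Qed.

Definition plim (p : {poly K}) (q : {poly k}) := forall e, lim p`_e q`_e.

Lemma plim_uniq p q r : plim p q -> plim p r -> q = r.
Proof. by move=> pq pr; apply/polyP=> e; apply: (lim_uniq limP (pq e) (pr e)). Qed.

Lemma plimD p p' q q' : plim p q -> plim p' q' -> plim (p + p') (q + q').
Proof. by move=> h h' e; rewrite !coefD; apply: (limD limP). Qed.

Lemma plimM p p' q q' : plim p q -> plim p' q' -> plim (p * p') (q * q').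
Proof. by move=> h h' e; rewrite !coefM; apply: lim_sum => i _; apply: (limM limP). Qed.

Lemma plimZ x a p q : lim x a -> plim p q -> plim (x *: p) (a *: q).
Proof. by move=> xa pq e; rewrite !coefZ; apply: (limM limP). Qed.

Lemma plimC x a : lim x a -> plim x%:P a%:P.
Proof. by move=> xa e; rewrite !coefC; case: ifP => // _; apply: lim0. Qed.

Lemma plimX : plim 'X 'X.
Proof. by move=> e; rewrite !coefX; apply: lim_nat. Qed.

Lemma plim1 : plim 1 1.
Proof. exact: (plimC (lim1 limP)). Qed.

Lemma plim_sum I (r : seq I) (P : pred I) F G :
  (forall i, P i -> plim (F i) (G i)) ->
  plim (\sum_(i <- r | P i) F i) (\sum_(i <- r | P i) G i).
Proof. by move=> h e; rewrite !coef_sum; apply: lim_sum => i Pi; apply: h. Qed.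

Lemma plim_prod I (r : seq I) (P : pred I) F G :
  (forall i, P i -> plim (F i) (G i)) ->
  plim (\prod_(i <- r | P i) F i) (\prod_(i <- r | P i) G i).
Proof.
move=> h; elim: r => [|i r IH]; first by rewrite !big_nil; apply: plim1.
by rewrite !big_cons; case: ifP => // Pi; apply: plimM => //; apply: h.
Qed.

Lemma plim_det m (A : 'M[{poly K}]_m) (B : 'M[{poly k}]_m) :
  (forall i j, plim (A i j) (B i j)) -> plim (\det A) (\det B).
Proof.
move=> h; apply: plim_sum => s _; apply: plimM; last by apply: plim_prod.
case: (perm.odd_perm s) => e; rewrite ?expr0 ?expr1; last exact: plim1.
by rewrite !coefN; apply: (limN limP); apply: plim1.
Qed.

Lemma plim_euler p q : plim p q -> plim (euler p) (euler q).
Proof.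
move=> pq; apply: plimM; first exact: plimX.
by move=> e; rewrite !coef_deriv -(mulr_natl p`_e.+1) -(mulr_natl q`_e.+1); apply: (limM limP) => //; apply: lim_nat.
Qed.

Lemma plim_wron m f g : (forall b, (b < m)%N -> plim (f b) (g b)) ->
  plim (wron m f) (wron m g).
Proof.
move=> h; apply: plim_det => i j; rewrite !mxE.
by elim: (i : nat) => [|a IH] /=; [apply: h | apply: plim_euler].
Qed.

Lemma plim_exists (p : {poly K}) : (forall e, exists a, lim p`_e a) ->
  exists2 q, plim p q & (size q <= size p)%N.
Proof.
move=> h; have /fin_all_exists[g hg] : forall e : 'I_(size p), exists a, lim p`_e a by [].
exists (\poly_(e < size p) (if insub e is Some i then g i else 0)); last exact: size_poly.
move=> e; rewrite coef_poly; case: ltnP => ep; first by rewrite insubT; apply: (hg (Ordinal ep)).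
by rewrite nth_default //; apply: lim0.
Qed.

(** Division by a dominant coefficient. *)
Lemma plim_normalize (p : {poly K}) : p != 0 ->
  exists2 x, x != 0 & exists2 q, plim (x *: p) q & q != 0.
Proof.
move=> p0; have sp : (0 < size p)%N by rewrite size_poly_gt0.
have [|j jp [pj h]] := @lim_dominant (size p) (fun i => p`_i).
  by exists (size p).-1; rewrite ?prednK // -lead_coefE lead_coef_eq0.
exists (p`_j)^-1; first by rewrite invr_eq0.
have [|q pq _] := @plim_exists ((p`_j)^-1 *: p).
  move=> e; rewrite coefZ mulrC; have [/h //|pe] := ltnP e (size p).
  by exists 0; rewrite nth_default // mul0r; apply: lim0.
exists q => //; apply/eqP=> q0; have := pq j.
rewrite q0 coefZ mulVf // coef0 => /(lim_uniq limP (lim1 limP))/eqP.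
by rewrite oner_eq0.
Qed.

Lemma plim_proportional x y (p : {poly K}) (q r : {poly k}) : plim (x *: p) q -> plim (y *: p) r ->
  q != 0 -> r != 0 -> exists2 a, a != 0 & q = a *: r.
Proof.
move=> pq pr q0 r0.
have y0 : y != 0.
  apply: contra_neq r0 => y0; apply: (plim_uniq pr).
  by rewrite y0 scale0r -(polyC0 k); apply/plimC/lim0.
have re : r`_(size r).-1 != 0 by rewrite -lead_coefE lead_coef_eq0.
set e := _.-1 in re.
have ye := lim_neq0 (pr e) re.
have L := limM limP (pq e) (limV (pr e) re).
have qE : q = (q`_e / r`_e) *: r.
  apply: (plim_uniq pq).
  have -> : x *: p = ((x *: p)`_e / (y *: p)`_e) *: (y *: p).
    rewrite scalerA; congr (_ *: _); rewrite !coefZ.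
    by move: ye; rewrite coefZ mulf_eq0 => /norP[_ pe]; rewrite -mulf_div divff // mulr1 divfK.
  exact: plimZ.
exists (q`_e / r`_e) => //; apply: contra_neq q0 => a0.
by rewrite qE a0 scale0r.
Qed.

Definition pspan (f : nat -> {poly K}) m p :=
  exists c : nat -> K, p = \sum_(j < m) c j *: f j.

Lemma pspanD f m p q : pspan f m p -> pspan f m q -> pspan f m (p + q).
Proof.
move=> [c ->] [c' ->]; exists (fun j => c j + c' j); rewrite -big_split /=.
by apply: eq_bigr => i _; rewrite scalerDl.
Qed.

Lemma pspanZ f m a p : pspan f m p -> pspan f m (a *: p).
Proof.
move=> [c ->]; exists (fun j => a * c j); rewrite scaler_sumr.
by apply: eq_bigr => i _; rewrite scalerA.
Qed.

Lemma pspan0 f m : pspan f m 0.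
Proof. by exists (fun=> 0); rewrite big1 // => i _; rewrite scale0r. Qed.

Lemma pspan_le f m m' p : (m <= m')%N -> pspan f m p -> pspan f m' p.
Proof.
move=> mm' [c ->]; exists (fun j => c j *+ (j < m)%N).
rewrite (big_ord_widen m' (fun j => c j *: f j)) // big_mkcond; apply: eq_bigr => i _.
by case: ltnP; rewrite ?mulr0n ?scale0r.
Qed.

Lemma pspan_mem f m : pspan f m.+1 (f m).
Proof.
exists (fun j => (j == m)%:R); rewrite big_ord_recr /= eqxx scale1r big1 ?add0r //.
by move=> i _; rewrite ltn_eqF ?scale0r.
Qed.

Lemma pspan_sum f m I (r : seq I) (P : pred I) (F : I -> {poly K}) :
  (forall i, P i -> pspan f m (F i)) -> pspan f m (\sum_(i <- r | P i) F i).
Proof. by move=> h; elim/big_rec: _ => [|i p /h]; [apply: pspan0 | apply: pspanD]. Qed.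

(** h arises from f by a triangular change of basis with diagonal c, which
    preserves the spans of initial segments and multiplies Wronskians by a
    constant. *)
Definition unitriangular f h (c : nat -> K) b :=
  c b != 0 /\ pspan f b (h b - c b *: f b).

Lemma wron_unitriangular n f h c : (forall b, (b < n)%N -> unitriangular f h c b) ->
  wron n h = (\prod_(b < n) c b) *: wron n f.
Proof.
move=> H; have /fin_all_exists[d hd] : forall b : 'I_n, exists d : nat -> K,
   h b - c b *: f b = \sum_(j < b) d j *: f j by move=> b; have [] := H b (ltn_ord b).
pose d' b j : K := if insub b is Some i then (if (j < b)%N then d i j else c b) else 0.
rewrite (@wron_triangular _ n f h d') => [|b bn].
  by congr (_ *: _); apply: eq_bigr => i _; rewrite /d' valK ltnn.
rewrite big_ord_recr /d' insubT /= ltnn; apply/eqP; rewrite -subr_eq; apply/eqP.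
by rewrite (hd (Ordinal bn)); apply: eq_bigr => j _; rewrite ltn_ord.
Qed.

Lemma wron_not_span n f p : wron n.+1 f != 0 -> pspan f n p -> f n - p != 0.
Proof.
move=> w0 fp; apply: contra_neq w0 => e0.
have := @wron_unitriangular n.+1 f (with_last n f (f n - p)) (fun=> 1).
rewrite big1 // scale1r => <-.
  rewrite e0 wronskian_last big1 // => a _.
  by rewrite (_ : iter a _ 0 = 0) ?mulr0 //; elim: (a : nat) => //= m ->; rewrite raddf0.
move=> b; rewrite ltnS leq_eqVlt /unitriangular oner_eq0 scale1r /with_last.
case/orP => [/eqP -> | ->]; rewrite ?ltnn; split=> //.
  by rewrite addrC addKr -scaleN1r; apply: pspanZ.
by rewrite subrr; apply: pspan0.
Qed.

Lemma pspan_unitriangular n f h c : (forall b, (b < n)%N -> unitriangular f h c b) ->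
  forall m p, (m <= n)%N -> pspan f m p -> pspan h m p.
Proof.
move=> H; elim=> [|m IH] p mn [d ->].
  by rewrite big_ord0; apply: pspan0.
rewrite big_ord_recr /=; apply: pspanD.
  by apply: (pspan_le (leqnSn m)); apply: IH; [apply: ltnW | exists d].
apply: pspanZ; have [c0 hs] := H m mn.
have -> : f m = (c m)^-1 *: (h m - (h m - c m *: f m)).
  by rewrite subKr scalerA mulVf // scale1r.
apply/pspanZ/pspanD; first exact: pspan_mem.
rewrite -scaleN1r; apply/pspanZ/(pspan_le (leqnSn m))/IH => //; exact: ltnW.
Qed.

(** Gaussian elimination at the coefficients of index o 0, o 1, ... *)
Lemma eliminate_pivots n (h : nat -> {poly K}) (o : nat -> nat) :
  (forall b, (b < n)%N -> (h b)`_(o b) != 0) ->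
  (forall a b, (a < b)%N -> (b < n)%N -> (h b)`_(o a) = 0) ->
  forall p, exists d : nat -> K, forall a, (a < n)%N ->
    (p - \sum_(j < n) d j *: h j)`_(o a) = 0.
Proof.
elim: n => [|n IH] h0 h1 p; first by exists (fun=> 0).
have [||d hd] := IH _ _ p; first by move=> b bn; apply: h0; apply: ltnW.
  by move=> a b ab bn; apply: h1 => //; apply: ltnW.
pose r := p - \sum_(j < n) d j *: h j.
exists (fun j => if (j < n)%N then d j else r`_(o n) / (h n)`_(o n)) => a.
rewrite big_ord_recr /= ltnn opprD addrA.
have -> : p - \sum_(i < n) (if (i < n)%N then d i else r`_(o n) / (h n)`_(o n)) *: h i = r.
  by congr (_ - _); apply: eq_bigr => i _; rewrite ltn_ord.
rewrite coefB coefZ ltnS leq_eqVlt => /orP[/eqP ->|an].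
  by rewrite divfK ?subrr // h0.
have := hd a an; rewrite -/r => ->.
by rewrite (h1 a n an (ltnSn n)) mulr0 subrr.
Qed.

Lemma poly_order (q : {poly k}) : q != 0 ->
  exists o g, q = 'X^o * g /\ g.[0] != 0 /\ q`_o != 0.
Proof.
move=> q0; have [m [g h ->]] := multiplicity_XsubC q 0.
have g0 : ~~ root g 0.
  by move: h; rewrite q0.
exists m, g; rewrite subr0 mulrC; split=> //; split=> //.
by rewrite coefXnM ltnn subnn -horner_coef0.
Qed.

(** A basis adapted to the flag whose limits have distinct orders at 0: before
    each new member is normalized, its coefficients at the orders already used are
    eliminated, so its limit cannot have any of these orders. *)
Lemma order_basis n (f : nat -> {poly K}) :
  (forall m, (m <= n)%N -> wron m f != 0) ->
  exists h : nat -> {poly K}, exists hh : nat -> {poly k},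
  exists c : nat -> K, exists o : nat -> nat, exists g : nat -> {poly k},
  [/\ forall b, (b < n)%N -> unitriangular f h c b,
      forall b, (b < n)%N -> plim (h b) (hh b),
      forall b, (b < n)%N -> hh b = 'X^(o b) * g b /\ (g b).[0] != 0 &
      forall a b, (a < b)%N -> (b < n)%N -> o a != o b].
Proof.
move=> w0.
suff : exists h : nat -> {poly K}, exists hh : nat -> {poly k},
  exists c : nat -> K, exists o : nat -> nat, exists g : nat -> {poly k},
  [/\ forall b, (b < n)%N -> unitriangular f h c b,
      forall b, (b < n)%N -> plim (h b) (hh b),
      forall b, (b < n)%N -> hh b = 'X^(o b) * g b /\ (g b).[0] != 0,
      forall b, (b < n)%N -> (hh b)`_(o b) != 0 &
      forall a b, (a < b)%N -> (b < n)%N -> (h b)`_(o a) = 0].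
  move=> [h [hh [c [od [g [h1 h2 h3 h4 h5]]]]]]; exists h, hh, c, od, g; split=> // a b ab bn.
  apply: contraTneq (h4 b bn) => oab; rewrite negbK.
  have := h2 b bn (od b); rewrite -oab h5 // => /(lim_uniq limP lim0) <-.
  by rewrite eqxx.
elim: n w0 => [|n IH] w0; first by exists (fun=> 0), (fun=> 0), (fun=> 0), (fun=> 0%N), (fun=> 0).
have [|h [hh [c [ o [g [h1 h2 h3 h4 h5]]]]]] := IH; first by move=> m mn; apply/w0/ltnW.
have hn0 b : (b < n)%N -> (h b)`_(o b) != 0.
  by move=> bn; apply: lim_neq0 (h2 _ bn _) (h4 _ bn).
have [d hd] := eliminate_pivots hn0 h5 (f n).
set p := f n - _ in hd.
have sp : pspan f n (\sum_(j < n) d j *: h j).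
  apply: pspan_sum => i _; apply: pspanZ; apply: (pspan_le (ltn_ord i)).
  have [_ hs] := h1 i (ltn_ord i); rewrite -(subrK (c i *: f i) (h i)).
  by apply: pspanD; [apply: pspan_le hs | apply/pspanZ/pspan_mem].
have p0 : p != 0 by apply: wron_not_span sp; apply: w0.
have [x x0 [q pq q0]] := plim_normalize p0.
have [on [gn [qE [gn0 qo]]]] := poly_order q0.
pose upd T (u : nat -> T) v b := if (b < n)%N then u b else v.
exists (upd _ h (x *: p)), (upd _ hh q), (upd _ c x), (upd _ o on), (upd _ g gn).
have cs b : (b < n.+1)%N -> (b < n)%N \/ b = n.
  by rewrite ltnS leq_eqVlt => /orP[/eqP|]; [right|left].
split=> [b /cs[bn|->]|b /cs[bn|->]|b /cs[bn|->]|b /cs[bn|->]|a b ab /cs[bn|bn]];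
  rewrite /upd ?bn ?ltnn //.
- by rewrite /unitriangular /= bn; apply: h1.
- rewrite /unitriangular /= ltnn; split=> //.
  rewrite /p scalerBr addrAC subrr add0r -scalerN -scaleN1r.
  exact/pspanZ/pspanZ.
- exact: h2.
- exact: h3.
- exact: h4.
- by rewrite (ltn_trans ab bn) h5.
- by rewrite -{1}bn ab coefZ hd ?mulr0 // -bn.
Qed.

End Place.

(** * The limiting space at one scale *)
Definition lower_at (q : nat -> nat) (c b : nat) : nat := (q b - (b == c))%N.

Section Vand.
Variable k : fieldType.
Hypothesis k0 : forall m : nat, m.+1%:R != 0 :> k.

Lemma natr_inj_char0 (a b : nat) : (a < b)%N -> b%:R - a%:R != 0 :> k.
Proof. by move=> ab; rewrite -natrB ?(ltnW ab) // -[(b - a)%N]prednK ?subn_gt0. Qed.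

Lemma vandS m q : vand k m.+1 q = vand k m q * \prod_(i < m) ((q m)%:R - (q i)%:R).
Proof. by rewrite /vand big_ord_recr. Qed.

Lemma vand_neq0 m (q : nat -> nat) :
  (forall a b, (a < b)%N -> (b < m)%N -> (q a < q b)%N) -> vand k m q != 0.
Proof.
move=> h; apply/prodf_neq0 => j _; apply/prodf_neq0 => i _.
by apply: natr_inj_char0; apply: h.
Qed.

(** Lowering q c by one changes only the differences that involve q c; those with
    b > c become one larger. *)
Lemma vand_ratio m n (q : nat -> nat) c : (c < m)%N -> (m <= n)%N -> (0 < q c)%N ->
  (forall a b, (a < b)%N -> (b < n)%N -> (q a < q b)%N) ->
  (forall a b, (a < b)%N -> (b < n)%N -> (lower_at q c a < lower_at q c b)%N) ->
  vand k n q / vand k n (lower_at q c) = vand k m q / vand k m (lower_at q c) *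
    \prod_(m <= b < n) (((q b)%:R - (q c)%:R) / ((q b)%:R - (q c)%:R + 1)).
Proof.
move=> cm + qc; set o := lower_at q c; elim: n => [|n IH].
  by rewrite leqn0 => /eqP ->; rewrite big_nil mulr1.
rewrite leq_eqVlt => /orP[/eqP -> _ _|]; first by rewrite big_geq ?mulr1.
rewrite ltnS => mn hq ho.
have {}IH := IH mn (fun a b ab bn => hq a b ab (ltnW bn)) (fun a b ab bn => ho a b ab (ltnW bn)).
rewrite big_nat_recr //= [RHS]mulrA -IH.
rewrite !vandS -mulf_div; congr (_ * _).
have cn : (c < n)%N by apply: leq_trans mn.
rewrite (bigD1 (Ordinal cn)) //= [X in _ / X = _](bigD1 (Ordinal cn)) //=.
rewrite -mulf_div [X in _ * X = _](_ : _ = 1).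
  rewrite mulr1 /o /lower_at eqxx (gtn_eqF cn) subn0 natrB //.
  by rewrite opprB addrA addrAC.
rewrite (eq_bigr (fun i : 'I_n => (o n)%:R - (o i)%:R)).
  rewrite divff //; apply/prodf_neq0 => i _; apply: natr_inj_char0.
  by apply: ho.
by move=> i; rewrite -val_eqE /= /o /lower_at => /negbTE ->; rewrite (gtn_eqF cn) !subn0.
Qed.

Lemma eq_XnM (a b : nat) (G H : {poly k}) : 'X^a * G = 'X^b * H ->
  G.[0] != 0 -> H.[0] != 0 -> a = b.
Proof.
have key (c d : nat) (P Q : {poly k}) :
    (c < d)%N -> 'X^c * P = 'X^d * Q -> P.[0] = 0.
  move=> cd E; have := congr1 (fun p : {poly k} => p`_c) E.
  by rewrite !coefXnM ltnn subnn cd -horner_coef0.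
move=> E G0 H0; have [ab|ba|//] := ltngtP a b.
  by rewrite (key _ _ _ _ ab E) eqxx in G0.
by rewrite (key _ _ _ _ ba (esym E)) eqxx in H0.
Qed.

Lemma poly_monomial (p g : {poly k}) q : p = 'X^q * g -> (size p <= q.+1)%N ->
  p = p`_q *: 'X^q.
Proof.
move=> E s; apply/polyP=> e; rewrite coefZ coefXn.
have [->|] := eqVneq e q; first by rewrite mulr1.
rewrite neq_ltn mulr0 => /orP[lt|gt]; last by rewrite nth_default // (leq_trans s).
by rewrite E coefXnM lt.
Qed.

End Vand.

Section Scale.
Variables (K k : fieldType) (lim : K -> k -> Prop).
Hypothesis limP : place lim.
Hypothesis k0 : forall m : nat, m.+1%:R != 0 :> k.
Notation plim := (plim lim).

Definition box_ratio n (q : nat -> nat) c m : k :=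
  \prod_(m <= b < n) (((q b)%:R - (q c)%:R) / ((q b)%:R - (q c)%:R + 1)).

(** What the space spanned by f looks like at the scale of a z_j. The q b bound
    the degrees of the limits, and the limit X^M (X - 1) of the full Wronskian has
    order M, one less than the sum of the q b. So the orders of the limits are
    the q b except that one of them, of index c, is lowered by one. All limits
    are then monomials except the c-th, which has two terms, and the
    Wronskians of initial segments of length m > c become monomials times a
    linear factor, whose root box_ratio is a quotient of Vandermonde determinants.
    The last claim says that the orders bound below the growth of elements of the
    space: it gives the degree bounds at the next smaller scale. *)
Lemma scale_step n (f : nat -> {poly K}) (q : nat -> nat) x M :
  (forall m, (m <= n)%N -> wron m f != 0) ->
  (forall a b, (a < b)%N -> (b < n)%N -> (q a < q b)%N) ->
  (forall b g gg, (b < n)%N -> pspan f b.+1 g -> plim g gg -> (size gg <= (q b).+1)%N) ->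
  plim (x *: wron n f) ('X^M * ('X - 1)) ->
  (\sum_(b < n) q b)%N = M.+1 ->
  exists2 c, (c < n)%N & let o := lower_at q c in
  [/\ (0 < q c)%N,
      forall a b, (a < b)%N -> (b < n)%N -> (o a < o b)%N,
      forall m, (c < m <= n)%N -> exists y, exists2 a, a != 0 & exists d,
        plim (y *: wron m f) (a *: ('X^d * ('X - (box_ratio n q c m)%:P))) &
      forall b g, (b < n)%N -> pspan f b.+1 g -> g != 0 ->
        exists2 y, y != 0 & exists2 gg, plim (y *: g) gg &
          exists2 e, (e <= o b)%N & gg`_e != 0].
Proof.
move=> w0 qinc fdeg wlim qsum.
have [h [hh [c [ o [g [h1 h2 h3 o_neq]]]]]] := order_basis limP w0.
pose C m := \prod_(b < m) c b.
have C0 m : (m <= n)%N -> C m != 0.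
  by move=> mn; apply/prodf_neq0 => i _; have [] := h1 i (leq_trans (ltn_ord i) mn).
have wh m : (m <= n)%N -> plim (C m *: wron m f) (wron m hh).
  move=> mn; rewrite -(@wron_unitriangular _ m f h c).
    by apply: (plim_wron limP) => b bm; apply/h2/(leq_trans bm).
  by move=> b bm; apply/h1/(leq_trans bm).
have fn b p : (b < n)%N -> pspan f b p -> pspan f b.+1 p by move=> _; apply: pspan_le.
have hspan b : (b < n)%N -> pspan f b.+1 (h b).
  move=> bn; have [_ hs] := h1 b bn; rewrite -(subrK (c b *: f b) (h b)).
  by apply: pspanD; [apply: pspan_le hs | apply/pspanZ/pspan_mem].
have shh b : (b < n)%N -> (size (hh b) <= (q b).+1)%N.
  by move=> bn; apply: fdeg (hspan b bn) (h2 b bn).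
have hho b : (b < n)%N -> (hh b)`_(o b) != 0.
  by move=> bn; have [-> g0] := h3 b bn; rewrite coefXnM ltnn subnn -horner_coef0.
have oq b : (b < n)%N -> (o b <= q b)%N.
  move=> bn; rewrite -ltnS; apply: leq_trans (shh b bn).
  by rewrite ltnNge; apply: contra (hho b bn) => s; rewrite nth_default.
(* The orders are distinct, so the Wronskian of the limits has no cancellation
   at 0 and its order there determines their sum. *)
have vo : vand k n o != 0.
  apply/prodf_neq0 => j _; apply/prodf_neq0 => i _.
  have := o_neq i j (ltn_ord i) (ltn_ord j); rewrite neq_ltn => /orP[|] lt.
    exact: natr_inj_char0.
  by rewrite -opprB oppr_eq0; apply: natr_inj_char0.
have [G [GE G0]] := @wron_order _ n hh o g (fun b bn => (h3 b bn).1).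
have {}G0 : G.[0] != 0.
  by rewrite G0 mulf_neq0 //; apply/prodf_neq0 => i _; have [] := h3 i (ltn_ord i).
have X10 : ('X - 1 : {poly k}).[0] != 0 by rewrite hornerD hornerN hornerX hornerC sub0r oppr_eq0 oner_eq0.
have X1n0 : 'X^M * ('X - 1) != 0 :> {poly k}.
  apply: mulf_neq0; first by rewrite monic_neq0 ?monicXn.
  by rewrite -(polyC1 k) polyXsubC_eq0.
have wn0 : wron n hh != 0.
  rewrite GE; apply: mulf_neq0; first by rewrite monic_neq0 ?monicXn.
  by apply: contra_neq G0 => ->; rewrite horner0.
have [a a0 whE] := plim_proportional limP (wh n (leqnn n)) wlim wn0 X1n0.
have osum : (\sum_(b < n) o b)%N = M.
  apply: (@eq_XnM _ _ _ G (a *: ('X - 1))) => //; last by rewrite hornerZ mulf_neq0.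
  by rewrite -GE whE scalerAr.
(* o <= q pointwise and the sums differ by one. *)
have [c0 c0n oE] : exists2 c0, (c0 < n)%N & (0 < q c0)%N /\ forall b, (b < n)%N -> o b = (q b - (b == c0))%N.
  have /existsP[j oj] : [exists j : 'I_n, (o j < q j)%N].
    apply: contraT => /existsPn H.
    have : (\sum_(b < n) q b <= \sum_(b < n) o b)%N.
      by apply: leq_sum => i _; rewrite leqNgt.
    by rewrite qsum osum ltnn.
  exists j => //; split; first exact: leq_ltn_trans oj.
  have S1 : (\sum_(b < n | b != j) o b <= \sum_(b < n | b != j) q b)%N.
    by apply: leq_sum => i _; apply: oq.
  have S2 : (o j + \sum_(b < n | b != j) o b = M)%N by rewrite -osum [RHS](bigD1 j).
  have S3 : (q j + \sum_(b < n | b != j) q b = M.+1)%N by rewrite -qsum [RHS](bigD1 j).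
  have S4 : (\sum_(b < n | b != j) o b = \sum_(b < n | b != j) q b)%N.
    by move: oj S1 S2 S3; move: (\sum_(b < n | b != j) o b)%N (\sum_(b < n | b != j) q b)%N; lia.
  move=> b bn; have [->|bj] := eqVneq b (j : nat); first by rewrite /=; lia.
  rewrite subn0; have bj' : Ordinal bn != j by rewrite -val_eqE.
  move: S4; rewrite (bigD1 (Ordinal bn)) //= [X in _ = X](bigD1 (Ordinal bn)) //=.
  have : (\sum_(i < n | (i != j) && (i != Ordinal bn)) o i <= \sum_(i < n | (i != j) && (i != Ordinal bn)) q i)%N.
    by apply: leq_sum => i _; apply: oq.
  move: (oq b bn) => /=.
  move: (\sum_(i < n | (i != j) && (i != Ordinal bn)) o i)%N.
  by move: (\sum_(i < n | (i != j) && (i != Ordinal bn)) q i)%N; lia.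
have [qc0 {}oE] := oE.
exists c0 => //; set oo := lower_at q c0.
have ooE b : (b < n)%N -> o b = oo b by exact: oE.
have oo_inc : forall a b, (a < b)%N -> (b < n)%N -> (oo a < oo b)%N.
  move=> b b' bb' b'n; have := qinc b b' bb' b'n.
  have := o_neq b b' bb' b'n; rewrite !ooE ?(ltn_trans bb') // /oo /lower_at.
  by move: bb'; case: (eqVneq b c0) => [->|_]; case: (eqVneq b' c0) => [->|_] /=; lia.
split=> //.
(* Of order at least o b and degree at most q b, every limit but the one of
   index c0 is a monomial, and that one has two terms. *)
- pose u := hh c0.
  have mono b : (b < n)%N -> b != c0 -> hh b = (hh b)`_(q b) *: 'X^(q b).
    move=> bn bc; have [E _] := h3 b bn.
    apply: (poly_monomial (g := g b)) (shh b bn); rewrite E oE // (negbTE bc) subn0 //.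
  have uE : u = u`_(q c0) *: 'X^(q c0) + u`_((q c0).-1) *: 'X^((q c0).-1).
    apply/polyP=> e; rewrite coefD !coefZ !coefXn.
    have [[E _] s] := (h3 c0 c0n, shh c0 c0n).
    have [->|e1] := eqVneq e (q c0).
      by rewrite gtn_eqF ?mulr0 ?addr0 ?mulr1 // ltn_predL.
    have [->|e2] := eqVneq e (q c0).-1; first by rewrite mulr0 add0r mulr1.
    rewrite !mulr0 addr0; have [lt|ge] := ltnP e (q c0).-1.
      by rewrite /u E coefXnM oE // eqxx subn1 lt.
    rewrite nth_default // (leq_trans s) //; move: e1 e2 ge; rewrite !neq_ltn; lia.
  pose A b := (hh b)`_(q b).
  pose A' b := if b == c0 then u`_((q c0).-1) else A b.
  have wE m : (c0 < m <= n)%N -> wron m hh =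
     ((\prod_(b < m) A b) * vand k m q) *: 'X^(\sum_(b < m) q b) +
     ((\prod_(b < m) A' b) * vand k m oo) *: 'X^(\sum_(b < m) oo b).
    move=> /andP[cm mn].
    rewrite (@wronskian_ext _ _ m hh (fun b => if b == c0 then u`_(q c0) *: 'X^(q c0) + u`_((q c0).-1) *: 'X^((q c0).-1) else hh b)); last first.
      by move=> b bm; case: eqP => // ->.
    rewrite wron_add_at // -!wron_monomials; congr (_ + _); apply: wronskian_ext => b bm.
      case: (eqVneq b c0) => [->|bc] //; apply: mono => //; exact: leq_trans mn.
    rewrite /A' /oo /lower_at; case: (eqVneq b c0) => [->|bc]; first by rewrite subn1.
    by rewrite subn0; apply: mono => //; exact: leq_trans mn.
  have sums m : (c0 < m)%N -> (\sum_(b < m) q b)%N = (\sum_(b < m) oo b).+1.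
    move=> cm; rewrite (bigD1 (Ordinal cm)) //= [in RHS](bigD1 (Ordinal cm)) //=.
    rewrite /oo /lower_at eqxx -addSn subn1 prednK //; congr (_ + _)%N.
    by apply: eq_bigr => i; rewrite -val_eqE /= => /negbTE ->; rewrite subn0.
  have prodA m : (c0 < m)%N -> \prod_(b < m) A' b * A c0 = \prod_(b < m) A b * u`_((q c0).-1).
    move=> cm; rewrite (bigD1 (Ordinal cm)) //= [in RHS](bigD1 (Ordinal cm)) //=.
    rewrite /A' eqxx [in LHS](eq_bigr (fun i : 'I_m => A i)); first by ring.
    by move=> i; rewrite -val_eqE /= => /negbTE ->.
  have vq m : (m <= n)%N -> vand k m q != 0.
    by move=> mn; apply: vand_neq0 => // b b' bb' b'm; apply: qinc => //; apply: leq_trans mn.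
  have voo m : (m <= n)%N -> vand k m oo != 0.
    by move=> mn; apply: vand_neq0 => // b b' bb' b'm; apply: oo_inc => //; apply: leq_trans mn.
  (* For m = n the limit is known, and this fixes the ratio of the two
     coefficients of the exceptional limit. *)
  have topE : (\prod_(b < n) A b) * vand k n q = a /\ (\prod_(b < n) A' b) * vand k n oo = - a.
    have sn := sums n c0n.
    have oosum : (\sum_(b < n) oo b)%N = M by rewrite -osum; apply: eq_bigr => i _; rewrite ooE.
    have := whE; rewrite wE ?c0n ?leqnn // sn oosum => E; split.
      have := congr1 (fun p : {poly k} => p`_(M.+1)) E.
      rewrite coefD !coefZ !coefXn eqxx gtn_eqF // mulr0 addr0 mulr1 => ->.
      by rewrite coefXnM ltnNge leqnSn subSnn coefD coefN coefX coefC /= subr0 mulr1.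
    have := congr1 (fun p : {poly k} => p`_M) E.
    rewrite coefD !coefZ !coefXn eqxx ltn_eqF // mulr0 add0r mulr1 => ->.
    by rewrite coefXnM ltnn subnn coefD coefN coefX coefC /= sub0r mulrN1.
  move=> m cmn; have /andP[cm mn] := cmn.
  have An0 i : (i < n)%N -> A i != 0.
    move=> i_n; have := a0; rewrite -topE.1 mulf_eq0 negb_or => /andP[/prodf_neq0 H _].
    exact: (H (Ordinal i_n)).
  pose D := \prod_(b < m) A b * vand k m q.
  have D0 : D != 0.
    rewrite mulf_neq0 ?vq //; apply/prodf_neq0 => i _; apply: An0; exact: leq_trans mn.
  have ratio : (\prod_(b < m) A' b) * vand k m oo = - (D * box_ratio n q c0 m).
    have r1 : u`_((q c0).-1) / A c0 = - (vand k n q / vand k n oo).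
      have Ac0 := An0 _ c0n.
      have PA : \prod_(b < n) A b != 0 by apply/prodf_neq0 => i _; apply: An0.
      apply: (mulIf (voo n (leqnn n))); rewrite mulNr divfK ?voo //.
      apply: (mulfI PA); rewrite mulrN topE.1 -topE.2 mulrA; congr (_ * _).
      by apply: (mulIf Ac0); rewrite -mulrA divfK // prodA.
    have vr := vand_ratio (m := m) k0 cm mn qc0 qinc oo_inc.
    rewrite -/(box_ratio n q c0 m) -/oo in vr.
    apply: (mulIf (An0 _ c0n)); rewrite mulrAC prodA //.
    rewrite -[u`_((q c0).-1)](divfK (An0 _ c0n)) r1 vr /D.
    have := voo m mn => v0; field; by [].
  exists (C m), D => //; exists (\sum_(b < m) oo b)%N.
  suff <- : wron m hh = D *: ('X^(\sum_(b < m) oo b) * ('X - (box_ratio n q c0 m)%:P)).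
    exact: wh.
  rewrite wE // ratio sums // -/D mulrBr -exprSr scalerBr scaleNr; congr (_ - _).
  by rewrite mulrC [in RHS]mulrC mul_polyC !scalerA [in RHS]mulrC.
- move=> b p bn fp p0.
  have [d pE] := pspan_unitriangular (n := n) h1 bn fp.
  have [|j0 j0b [dj0 hd]] := @lim_dominant _ _ _ limP b.+1 d.
    have /existsP[i di] : [exists i : 'I_b.+1, d i != 0].
      apply: contraT => /existsPn H; case/negP: p0; rewrite pE big1 // => i _.
      by have := H i; rewrite negbK => /eqP ->; rewrite scale0r.
    by exists i.
  have /fin_all_exists[dd hdd] : forall i : 'I_b.+1, exists x, lim (d i / d j0) x by move=> i; apply: hd.
  exists (d j0)^-1; first by rewrite invr_eq0.
  exists (\sum_(i < b.+1) dd i *: hh i).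
    rewrite pE scaler_sumr; apply: (plim_sum limP) => i _.
    rewrite scalerA mulrC; apply: (plimZ limP) => //; apply: h2; exact: leq_trans bn.
  have ddj0 : dd (Ordinal j0b) != 0.
    have := hdd (Ordinal j0b); rewrite /= divff // => /(lim_uniq limP (lim1 limP)) <-.
    exact: oner_neq0.
  have [i ddi imin] := @arg_minnP _ (Ordinal j0b) (fun i => dd i != 0) val ddj0.
  exists (oo i).
    have := ltn_ord i; rewrite ltnS leq_eqVlt => /orP[/eqP -> //|ib].
    by apply/ltnW/oo_inc.
  have i_n : (i < n)%N by apply: leq_trans bn.
  rewrite coef_sum (bigD1 i) //= big1 ?addr0.
    by rewrite coefZ mulf_neq0 // -ooE // hho.
  move=> j ji; rewrite coefZ; have [ij|ji'|/val_inj e] := ltngtP i j; last by rewrite e eqxx in ji.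
    have j_n : (j < n)%N by apply: leq_trans bn.
    have [-> _] := h3 j j_n; rewrite coefXnM ooE // oo_inc //= mulr0 //.
  have [->|dj] := eqVneq (dd j) 0; first by rewrite mul0r.
  by have := imin j dj; rewrite leqNgt ji'.
Qed.
End Scale.

(** * Descending through the scales *)
Section Scales.
Variables (K k : fieldType) (lim : K -> k -> Prop).
Hypothesis limP : place lim.
Hypothesis k0 : forall m : nat, m.+1%:R != 0 :> k.
Notation plim := (plim lim).

Lemma rescale_prod s I (r : seq I) (P : pred I) (F : I -> {poly K}) :
  rescale s (\prod_(i <- r | P i) F i) = \prod_(i <- r | P i) rescale s (F i).
Proof. exact: rmorph_prod. Qed.

Lemma rescaleX (s : K) m : rescale s 'X^m = s ^+ m *: 'X^m :> {poly K}.
Proof. by rewrite /rescale rmorphXn /= comp_polyX exprZn. Qed.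

Lemma rescaleXsubC s (x : K) : rescale s ('X - x%:P) = s *: 'X - x%:P.
Proof. by rewrite /rescale comp_polyB comp_polyX comp_polyC. Qed.

Lemma rescaleM s (p q : {poly K}) : rescale s (p * q) = rescale s p * rescale s q.
Proof. exact: comp_polyM. Qed.

Lemma rescale_eq0 s (p : {poly K}) : s != 0 -> (rescale s p == 0) = (p == 0).
Proof.
move=> s0; apply/eqP/eqP => [E|->]; last by rewrite /rescale comp_poly0.
apply/polyP=> e; have := congr1 (fun p : {poly K} => p`_e) E.
rewrite coef_rescale !coef0 => /eqP.
by rewrite mulf_eq0 expf_eq0 (negbTE s0) andbF orbF => /eqP.
Qed.

Lemma linear_limit s x : s != 0 -> exists y, exists2 L : {poly k},
  plim (y *: rescale s ('X - x%:P)) L & L != 0 /\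
  forall b, L.[b] = 0 -> lim (x / s) b.
Proof.
move=> s0; rewrite rescaleXsubC; case: (lim_total limP (x / s)) => [[b xb]|].
  exists s^-1, ('X - b%:P); last first.
    rewrite polyXsubC_eq0; split=> // b'; rewrite hornerXsubC => /subr0_eq ->; exact: xb.
  rewrite scalerBr scalerA mulVf // scale1r -mul_polyC -polyCM mulrC => e.
  rewrite !coefB; apply: limB => //; first exact: (plimX limP).
  exact: (plimC limP).
rewrite invf_div => sx.
have [x0|x0] := eqVneq x 0.
  exists s^-1, 'X; last first.
    rewrite polyX_eq0; split=> // b; rewrite hornerX => ->; rewrite x0 mul0r.
    exact: (lim0 limP).
  by rewrite x0 subr0 scalerA mulVf // scale1r; apply: (plimX limP).
exists (- x^-1), 1; last first.
  by rewrite oner_eq0; split=> // b; rewrite hornerC => /eqP; rewrite oner_eq0.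
have -> : - x^-1 *: (s *: 'X - x%:P) = - ((s / x) *: 'X) + 1%:P.
  rewrite scaleNr scalerBr scalerA mulrC opprB addrC; congr (_ + _).
  by rewrite -mul_polyC -polyCM mulVf.
rewrite -[X in plim _ X]add0r; apply: (plimD limP); last exact: (plim1 limP).
have := plimZ limP (limN limP sx) (plimX limP); rewrite scaleNr oppr0 scale0r.
exact.
Qed.

Lemma roots_limit s rs : s != 0 -> exists y, exists2 L : {poly k},
  plim (y *: rescale s (roots_poly rs)) L & L != 0 /\
  forall b, L.[b] = 0 -> exists2 x, x \in rs & lim (x / s) b.
Proof.
move=> s0; elim: rs => [|x rs [y [L yL [L0 HL]]]].
  exists 1, 1; last first.
    by rewrite oner_eq0; split=> // b; rewrite hornerC => /eqP; rewrite oner_eq0.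
  rewrite /roots_poly big_nil scale1r /rescale -(polyC1 K) comp_polyC.
  exact: (plim1 limP).
have [y' [L' yL' [L'0 HL']]] := linear_limit x s0.
exists (y' * y), (L' * L).
  rewrite /roots_poly big_cons rescaleM -scalerA scalerAr scalerAl.
  exact: (plimM limP).
split; first exact: mulf_neq0.
move=> b /eqP; rewrite hornerM mulf_eq0 => /orP[/eqP /HL' h|/eqP /HL [w wr h]].
  by exists x => //; rewrite inE eqxx.
by exists w => //; rewrite inE wr orbT.
Qed.

(** Roots are continuous: up to a constant, the limit of a rescaled product of
    linear factors is the product of the limits of the normalized factors, so that
    each of its roots is the limit of a rescaled root. *)
Lemma root_limit s rs y a (L : {poly k}) b : s != 0 ->
  plim (y *: rescale s (roots_poly rs)) (a *: L) -> a != 0 -> L != 0 -> L.[b] = 0 ->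
  exists2 x, x \in rs & lim (x / s) b.
Proof.
move=> s0 yL a0 L0 Lb.
have [y' [L' yL' [L'0 H]]] := roots_limit rs s0.
have aL0 : a *: L != 0 by rewrite scaler_eq0 negb_or a0.
have [c c0 E] := plim_proportional limP yL' yL L'0 aL0.
by apply: H; rewrite E !hornerZ Lb !mulr0.
Qed.

Section Tower.
Variables (n N : nat) (rts : nat -> seq K) (z : nat -> K) (phi : nat -> {poly K}).
Hypothesis z0 : forall j, (j < N)%N -> z j != 0.
Hypothesis zlim : forall j, (j.+1 < N)%N -> lim (z j / z j.+1) 0.
Hypothesis rtsn : rts n = mkseq z N.
Hypothesis rts_mono : forall b, (b < n)%N -> (size (rts b) <= size (rts b.+1))%N.
Hypothesis rts0 : rts 0%N = [::].
Hypothesis rts_conv : forall b, (b.+1 < n)%N ->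
  (size (rts b.+1) - size (rts b) <= size (rts b.+2) - size (rts b.+1))%N.
Hypothesis phiW : forall m, (m <= n)%N -> wron m phi = 'X^('C(m, 2)) * roots_poly (rts m).
Hypothesis phis : forall b, (b < n)%N ->
  (size (phi b) + size (rts b) <= size (rts b.+1) + b.+1)%N.

Lemma zlim_lt i j : (i < j)%N -> (j < N)%N -> lim (z i / z j) 0.
Proof.
elim: j => // j IH; rewrite ltnS leq_eqVlt => /orP[/eqP ->|ij] jN; first exact: zlim.
have jn := ltnW jN.
have -> : z i / z j.+1 = (z i / z j) * (z j / z j.+1) by rewrite mulrA divfK // z0.
rewrite -(mulr0 (0 : k)); apply: (limM limP); [exact: IH | exact: zlim].
Qed.

(** At the scale of z_j the factor X - z_i of the full Wronskian becomes X for
    i < j, X - 1 for i = j, and a constant for i > j. *)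
Lemma wron_top_limit j : (j < N)%N -> exists x,
  plim (x *: rescale (z j) (wron n phi)) ('X^(j + 'C(n, 2)) * ('X - 1)).
Proof.
move=> jN; rewrite phiW // rtsn /roots_poly /mkseq big_map.
pose y i := if (i <= j)%N then (z j)^-1 else - (z i)^-1.
exists ((z j)^-1 ^+ 'C(n, 2) * \prod_(i <- iota 0 N) y i).
rewrite rescaleM rescaleX rescale_prod -scalerA scalerAr scalerAl.
have -> : \prod_(i <- iota 0 N) y i *: \prod_(i <- iota 0 N) rescale (z j) ('X - (z i)%:P)
   = \prod_(i <- iota 0 N) (y i *: rescale (z j) ('X - (z i)%:P)).
  by rewrite scaler_prod.
rewrite scalerA -exprMn mulVf ?z0 // expr1n scale1r.
pose l i : {poly k} := if (i < j)%N then 'X else if i == j then 'X - 1 else 1.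
have -> : 'X^(j + 'C(n, 2)) * ('X - 1) = 'X^('C(n, 2)) * \prod_(i <- iota 0 N) l i.
  rewrite addnC exprD -mulrA; congr (_ * _).
  have -> : iota 0 N = iota 0 j ++ j :: iota j.+1 (N - j.+1).
    by rewrite -[j :: _]/(iota j (N - j.+1).+1) -iotaD; congr iota; lia.
  rewrite big_cat big_cons /= /l ltnn eqxx.
  rewrite (eq_big_seq (fun=> 'X)) => [|i]; last by rewrite mem_iota add0n => /= ->.
  rewrite big_const_seq count_predT size_iota.
  rewrite [X in _ * (_ * X)]big1_seq ?mulr1 => [|i]; last first.
    rewrite mem_iota => /= /andP[ji _]; rewrite ltnNge (ltnW ji) /= gtn_eqF //.
  by rewrite -/(iter _ _ _) -Monoid.iteropE.
apply: (plimM limP).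
  by move=> e; rewrite !coefXn; apply: lim_nat.
rewrite !big_seq; apply: (plim_prod limP) => i; rewrite mem_iota add0n => /= iN.
rewrite rescaleXsubC /y /l; case: (ltngtP i j) => ij.
- rewrite scalerBr scalerA mulVf ?z0 // scale1r -mul_polyC -polyCM mulrC.
  rewrite -[X in plim _ X]subr0 => e; rewrite !coefB; apply: (limB limP); first exact: (plimX limP).
  by rewrite -(polyC0 k); apply: (plimC limP); apply: zlim_lt.
- rewrite scalerBr scalerA -[_ *: _%:P]mul_polyC -polyCM !mulNr mulVf ?z0 // polyCN opprK.
  rewrite -[X in plim _ X]add0r; apply: (plimD limP); last exact: (plim1 limP).
  have := plimZ limP (limN limP (zlim_lt ij iN)) (plimX limP).
  by rewrite oppr0 scale0r mulrC.
- rewrite ij scalerBr scalerA mulVf ?z0 // scale1r -mul_polyC -polyCM mulVf ?z0 //.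
  by move=> e; rewrite !coefB; apply: (limB limP); [exact: (plimX limP)| exact: (plim1 limP)].
Qed.

Definition top_exponent b := (size (rts b.+1) - size (rts b) + b)%N.

Definition strictly_increasing (q : nat -> nat) :=
  forall a b, (a < b)%N -> (b < n)%N -> (q a < q b)%N.

Lemma strictly_increasing_step q : (forall b, (b.+1 < n)%N -> (q b < q b.+1)%N) ->
  strictly_increasing q.
Proof.
move=> h a b; elim: b => // b IH; rewrite ltnS leq_eqVlt => /orP[/eqP ->|ab] bn; first exact: h.
by apply: ltn_trans (h _ bn); apply: IH => //; apply: ltnW.
Qed.

Definition degree_bound s (q : nat -> nat) := forall b g gg, (b < n)%N ->
  pspan phi b.+1 g -> plim (rescale s g) gg -> (size gg <= (q b).+1)%N.

Lemma pspan_rescale s m g : pspan phi m g -> pspan (rescale s \o phi) m (rescale s g).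
Proof.
move=> [c ->]; exists c; rewrite /rescale [LHS]linear_sum /=.
by apply: eq_bigr => i _; rewrite linearZ.
Qed.

Lemma pspan_unrescale s m g : s != 0 -> pspan (rescale s \o phi) m g ->
  exists2 g', pspan phi m g' & g = rescale s g'.
Proof.
move=> s0 [c ->]; exists (\sum_(j < m) c j *: phi j); first by exists c.
rewrite /rescale [RHS]linear_sum /=.
by apply: eq_bigr => i _; rewrite linearZ.
Qed.

(** The orders at the scale of z_j bound the degrees at the scale of z_j' with
    j = j' + 1: there an element of the space is a rescaling by the
    infinitesimal z_j' / z_j, so that coefficients above the lowest order become
    negligible. *)
Lemma tower_step j q : (j < N)%N -> strictly_increasing q ->
  (\sum_(b < n) q b)%N = (j.+1 + 'C(n, 2))%N -> degree_bound (z j) q ->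
  exists2 c, (c < n)%N &
  [/\ (0 < q c)%N, strictly_increasing (lower_at q c),
      forall m, (c < m <= n)%N -> exists2 x, x \in rts m &
        lim (x / z j) (box_ratio k n q c m) &
      forall j', j = j'.+1 -> degree_bound (z j') (lower_at q c)].
Proof.
move=> jN qinc qsum qdeg; have zj := z0 jN.
pose f := rescale (z j) \o phi.
have wf m : wron m f = rescale (z j) (wron m phi) by rewrite -wron_rescale.
have w0 m : (m <= n)%N -> wron m f != 0.
  move=> mn; rewrite wf rescale_eq0 // phiW // mulf_neq0 // monic_neq0 ?monicXn //.
  exact: monic_prod_XsubC.
have [x] := wron_top_limit jN; rewrite -wf => xlim.
have fdeg b g gg : (b < n)%N -> pspan f b.+1 g -> plim g gg -> (size gg <= (q b).+1)%N.
  by move=> bn /(pspan_unrescale zj)[g' fg' ->]; apply: qdeg.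
have [c cn [qc oinc hroot hord]] := scale_step limP k0 w0 qinc fdeg xlim qsum.
exists c => //; split=> //.
- move=> m cmn; have [y [a a0 [d]]] := hroot m cmn.
  rewrite wf phiW; last by case/andP: cmn.
  have -> : 'X^('C(m, 2)) * roots_poly (rts m) = roots_poly (nseq 'C(m, 2) 0 ++ rts m).
    rewrite /roots_poly big_cat /=; congr (_ * _).
    by rewrite big_nseq subr0 -Monoid.iteropE.
  set b := box_ratio k n q c m => lm.
  have b0 : b != 0.
    have cm : (c < m)%N by case/andP: cmn.
    rewrite /b /box_ratio prodf_seq_neq0; apply/allP => i; rewrite mem_index_iota => /andP[mi i_n].
    have lt : (q c < q i)%N by apply: qinc => //; apply: leq_trans mi.
    rewrite /= mulf_neq0 ?natr_inj_char0 // invr_eq0.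
    by rewrite -natrB ?(ltnW lt) // natr1 k0.
  have L0 : 'X^d * ('X - b%:P) != 0 :> {poly k}.
    by rewrite mulf_neq0 // ?polyXsubC_eq0 // monic_neq0 ?monicXn.
  have Lb : ('X^d * ('X - b%:P)).[b] = 0 by rewrite hornerM hornerXsubC subrr mulr0.
  have [w] := root_limit zj lm a0 L0 Lb.
  rewrite mem_cat => /orP[|wr wl]; last by exists w.
  rewrite mem_nseq => /andP[_ /eqP ->]; rewrite mul0r => /(lim_uniq limP (lim0 limP)) b0'.
  by rewrite -b0' eqxx in b0.
- move=> j' jE b g gg bn fg glim.
  have [g0|g0] := eqVneq g 0.
    have -> : gg = 0.
      apply: (plim_uniq limP glim); rewrite g0 /rescale comp_poly0.
      by rewrite -(polyC0 K) -(polyC0 k); apply: (plimC limP); apply: (lim0 limP).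
    by rewrite size_poly0.
  have j'N : (j' < N)%N by rewrite jE in jN; apply: ltnW.
  have rg0 : rescale (z j) g != 0 by rewrite rescale_eq0.
  have [y y0 [hh hlim [e eo he]]] := hord b (rescale (z j) g) bn (pspan_rescale _ fg) rg0.
  apply/leq_sizeP => e' oe'; have ee' : (e < e')%N by apply: leq_ltn_trans oe'.
  apply: (lim_uniq limP (glim e')).
  have hne := lim_neq0 limP (hlim e) he.
  have zj' := z0 j'N.
  have ge0 : g`_e != 0 by apply: contra_neq hne => ge; rewrite coefZ coef_rescale ge mul0r mulr0.
  have -> : (rescale (z j') g)`_e' =
     (rescale (z j') g)`_e * ((y *: rescale (z j) g)`_e' / (y *: rescale (z j) g)`_e * (z j' / z j) ^+ (e' - e)).
    rewrite !coefZ !coef_rescale expr_div_n.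
    have E (v : K) : v ^+ e' = v ^+ e * v ^+ (e' - e) by rewrite -exprD subnKC // ltnW.
    rewrite !E.
    have := expf_neq0 e zj; have := expf_neq0 (e' - e) zj.
    move: (z j ^+ e) (z j ^+ (e' - e)) (z j' ^+ e) (z j' ^+ (e' - e)) => a b' c' d' b0' a0'.
    by field; rewrite y0 ge0 a0' b0'.
  rewrite -(mulr0 (gg`_e)); apply: (limM limP); first exact: glim.
  rewrite -(mulr0 (hh`_e' / hh`_e)); apply: (limM limP).
    by apply: (limM limP (hlim _)); apply: limV.
  apply: (lim_exprV limP); last by rewrite subn_gt0.
  by rewrite jE; apply: zlim; rewrite -jE.
Qed.

(** Descending through the scales z_(N-1), ..., z_0, the exponents start at the
    degree bounds of phi and end at 0, 1, ..., n - 1; each scale lowers one of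
    them, of index c j, and they stay strictly increasing. This is a standard
    filling of the diagram read backwards. *)
Theorem tower_limits : exists (c : nat -> nat) (q : nat -> nat -> nat),
  [/\ forall b, (b < n)%N -> q N b = top_exponent b,
      forall b, (b < n)%N -> q 0%N b = b,
      forall m, (m <= N)%N -> strictly_increasing (q m),
      forall j, (j < N)%N -> [/\ (c j < n)%N, (0 < q j.+1 (c j))%N &
        forall b, q j b = lower_at (q j.+1) (c j) b] &
      forall j m, (j < N)%N -> (c j < m <= n)%N -> exists2 x, x \in rts m &
        lim (x / z j) (box_ratio k n (q j.+1) (c j) m)].
Proof.
have topinc : strictly_increasing top_exponent.
  apply: strictly_increasing_step => b bn.
  by rewrite /top_exponent addnS ltnS leq_add2r; apply: rts_conv.
have topsum : (\sum_(b < n) top_exponent b)%N = (N + 'C(n, 2))%N.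
  rewrite /top_exponent big_split /=; congr (_ + _)%N.
    transitivity (size (rts n)); last by rewrite rtsn size_mkseq.
    have : forall m, (m <= n)%N -> (\sum_(b < m) (size (rts b.+1) - size (rts b)))%N = size (rts m).
      elim=> [|m IH] mn; first by rewrite big_ord0 rts0.
      by rewrite big_ord_recr /= IH ?subnKC ?rts_mono // ltnW.
    exact.
  by rewrite -bin2_sum big_mkord.
have topdeg s : degree_bound s top_exponent.
  move=> b g gg bn [c ->] glim; apply/leq_sizeP => e be.
  apply: (lim_uniq limP (glim e)); rewrite coef_rescale coef_sum.
  rewrite big1 ?mul0r; first exact: (lim0 limP).
  move=> i _; rewrite coefZ nth_default ?mulr0 //.
  have i_n : (i < n)%N by apply: leq_trans bn.
  apply: leq_trans be; apply: (@leq_trans (top_exponent i).+1).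
    have := phis i_n; have := rts_mono i_n; rewrite /top_exponent.
    by move: (size (phi i)) (size (rts i)) (size (rts i.+1)); lia.
  rewrite ltnS; have := ltn_ord i; rewrite ltnS leq_eqVlt => /orP[/eqP -> //|ib].
  by apply/ltnW/topinc.
suff main : forall m, (m <= N)%N -> exists (c : nat -> nat) (q : nat -> nat -> nat),
  [/\ q N =1 top_exponent,
      (\sum_(b < n) q (N - m) b)%N = (N - m + 'C(n, 2))%N,
      forall j, (N - m <= j <= N)%N -> strictly_increasing (q j),
      (forall j, (N - m <= j < N)%N -> [/\ (c j < n)%N, (0 < q j.+1 (c j))%N,
        forall b, q j b = lower_at (q j.+1) (c j) b &
        forall m, (c j < m <= n)%N -> exists2 x, x \in rts m &
        lim (x / z j) (box_ratio k n (q j.+1) (c j) m)]) &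
      forall j, (N - m)%N = j.+1 -> degree_bound (z j) (q (N - m)%N)].
  have [c [q [h1 h2 h3 h4 _]]] := main N (leqnn N).
  rewrite subnn in h2 h3 h4; exists c, q; split=> //.
  - move=> b bn.
    have le i : (i < n)%N -> (i <= q 0%N i)%N.
      elim: i => // i IH i_n; apply: leq_ltn_trans (IH (ltnW i_n)) _.
      by apply: (h3 0%N) => //; rewrite leqnn.
    have S : (\sum_(i < n) q 0%N i = \sum_(i < n) i)%N.
      by rewrite h2 add0n -bin2_sum big_mkord.
    move: S; rewrite (bigD1 (Ordinal bn)) //= [in RHS](bigD1 (Ordinal bn)) //=.
    have : (\sum_(i < n | i != Ordinal bn) i <= \sum_(i < n | i != Ordinal bn) q 0%N i)%N.
      by apply: leq_sum => i _; apply: le.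
    have := le b bn.
    by move: (\sum_(i < n | i != Ordinal bn) i)%N (\sum_(i < n | i != Ordinal bn) q 0%N i)%N; lia.
  - by move=> j jN; have [] := h4 j jN.
  - by move=> j m jN; have [_ _ _] := h4 j jN; apply.
elim=> [|m IH] mN.
  rewrite subn0; exists (fun=> 0%N), (fun=> top_exponent); split=> //.
    by move=> j; rewrite leqNgt; case: ltnP.
have [c [q [h1 h2 h3 h4 h5]]] := IH (ltnW mN).
pose j := (N - m.+1)%N; have jE : (N - m = j.+1)%N by rewrite /j; lia.
have jN : (j < N)%N by rewrite /j; lia.
rewrite -/j; rewrite jE in h2 h3 h4 h5.
have qinc : strictly_increasing (q j.+1) by apply: (h3 j.+1); rewrite leqnn jN.
have [c0 c0n [qc0 oinc hroot hdeg]] := tower_step jN qinc h2 (h5 j erefl).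
exists (fun i => if i == j then c0 else c i).
exists (fun i => if i == j then lower_at (q j.+1) c0 else q i).
rewrite eqxx; split.
- by rewrite gtn_eqF.
- move: h2; rewrite (bigD1 (Ordinal c0n)) //= [X in _ -> X = _](bigD1 (Ordinal c0n)) //=.
  have -> : lower_at (q j.+1) c0 c0 = (q j.+1 c0).-1 by rewrite /lower_at eqxx subn1.
  rewrite [X in _ -> (_ + X)%N = _](eq_bigr (fun i : 'I_n => q j.+1 i)).
    by move: qc0; move: (\sum_(i < n | i != Ordinal c0n) q j.+1 i)%N; lia.
  by move=> i; rewrite -val_eqE /= /lower_at => /negbTE ->; rewrite subn0.
- move=> i; case: eqP => [-> //|/eqP ij] ji; apply: (h3 i); move: ij ji; lia.
- move=> i; case: (eqVneq i j) => [-> _|ij /andP[ji iN]].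
    by rewrite gtn_eqF.
  have ji' : (j < i)%N by rewrite ltn_neqAle eq_sym ij.
  have -> : (i.+1 == j) = false by apply/negbTE; rewrite neq_ltn (leqW ji') orbT.
  by apply: (h4 i); rewrite ji' iN.
- by move=> j'; apply: hdeg.
Qed.

End Tower.
End Scales.

(** * Standard tableaux as lattice words *)
Section Words.
Local Open Scope nat_scope.
Variable rho : nat -> nat.

Definition cnt (m r : nat) : nat := \sum_(j < m) (rho j == r).

Lemma cnt0 r : cnt 0 r = 0.
Proof. by rewrite /cnt big_ord0. Qed.

Lemma cntS m r : cnt m.+1 r = (cnt m r + (rho m == r))%N.
Proof. by rewrite /cnt big_ord_recr. Qed.

Lemma cnt_mono m m' r : m <= m' -> cnt m r <= cnt m' r.
Proof.
elim: m' => [|m' IH]; first by rewrite leqn0 => /eqP ->.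
rewrite leq_eqVlt ltnS => /orP[/eqP -> //|/IH h].
by rewrite cntS; apply: leq_trans h (leq_addr _ _).
Qed.

Lemma cnt_reach m r y : y < cnt m r -> exists2 j, j < m & rho j = r /\ cnt j r = y.
Proof.
elim: m => [|m IH]; first by rewrite cnt0.
rewrite cntS; have [/IH [j jm h] _|ge] := ltnP y (cnt m r); first by exists j => //; apply: ltnW.
case: eqP => [rm|_]; last by rewrite addn0 ltnNge ge.
by move=> lt; exists m => //; split=> //; move: lt ge; rewrite addn1 ltnS; lia.
Qed.

(** For r < rho j this is the difference of the shifted row lengths
    cnt j r - r and cnt j (rho j) - rho j, minus one. It is positive on lattice
    words, so the truncated subtraction loses nothing there. *)
Definition gap (j r : nat) : nat := (cnt j r + rho j - r - (cnt j (rho j)).+1)%N.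

(** The words of the standard tableaux of shape lam, rho j being the row of the
    entry j. The second condition says that the first m letters fill a diagram. *)
Record lattice_word (N : nat) (lam : seq nat) : Prop := LatticeWord {
  word_shape : forall r, cnt N r = nth 0 lam r;
  word_lattice : forall m r, m <= N -> cnt m r.+1 <= cnt m r
}.

Variables (N : nat) (lam : seq nat).
Hypothesis W : lattice_word N lam.

Lemma word_lattice_le m r r' : m <= N -> r <= r' -> cnt m r' <= cnt m r.
Proof.
move=> mN; elim: r' => [|r' IH]; first by rewrite leqn0 => /eqP ->.
rewrite leq_eqVlt => /orP[/eqP -> //|]; rewrite ltnS => /IH.
by apply: leq_trans; apply: (word_lattice W).
Qed.

Lemma word_above j r : j < N -> r < rho j -> cnt j (rho j) < cnt j r.
Proof.
move=> jN rj; have := word_lattice_le jN (ltnW rj).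
by rewrite !cntS eqxx (gtn_eqF rj) addn0 addn1.
Qed.

Lemma gap_gt0 j r : j < N -> r < rho j -> 0 < gap j r.
Proof. by move=> jN rj; have := word_above jN rj; rewrite /gap; lia. Qed.

Lemma word_row_lt j : j < N -> rho j < size lam.
Proof.
move=> jN; rewrite ltnNge; apply/negP => s.
have := cnt_mono (rho j) jN; rewrite (word_shape W) nth_default //.
by rewrite cntS eqxx addn1.
Qed.

Lemma cnt_below i : \sum_(j < N) (i <= rho j) = below lam i.
Proof.
have E : forall s, sumn s = \sum_(r < size s) nth 0 s r.
  by elim=> [|x s IH]; rewrite ?big_ord0 // big_ord_recl /= IH.
rewrite /below E size_drop.
transitivity (\sum_(r < size lam - i) cnt N (i + r)); last first.
  by apply: eq_bigr => r _; rewrite nth_drop (word_shape W).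
rewrite /cnt exchange_big /=; apply: eq_bigr => j _.
have := word_row_lt (ltn_ord j); case: (leqP i (rho j)) => [ij|ji] lt.
  have lt' : rho j - i < size lam - i by rewrite ltn_sub2r // (leq_ltn_trans ij).
  rewrite (bigD1 (Ordinal lt')) //= subnKC // eqxx big1 //= => r.
  by rewrite -val_eqE /= => ne; apply/eqP; rewrite eqb0; apply: contra ne => /eqP ->; rewrite addKn.
by rewrite big1 // => r _; apply/eqP; rewrite eqb0 neq_ltn (leq_trans ji) ?leq_addr.
Qed.

End Words.

Section TableauWord.
Local Open Scope nat_scope.
Variables (N : nat) (lam : seq nat).

Definition row0 (T : std_tableau N lam) (j : 'I_N) : nat := (val (box_of T j)).1.

Definition word_of (T : std_tableau N lam) (j : nat) : nat :=
  if insub j is Some i then row0 T i else 0.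

Lemma word_ofE (T : std_tableau N lam) (j : 'I_N) : word_of T j = row0 T j.
Proof. by rewrite /word_of valK. Qed.

Lemma row_ofE (T : std_tableau N lam) (j : 'I_N) : row_of T j = (word_of T j).+1.
Proof. by rewrite word_ofE. Qed.

Hypothesis hlam : is_partition_of N lam.

Lemma part_geq r r' : r <= r' -> nth 0 lam r' <= nth 0 lam r.
Proof.
case: hlam => so _ _ rr'.
have [r's|sr'] := ltnP r' (size lam); last by rewrite nth_default.
by apply: (sorted_leq_nth _ _ _ so) => //; rewrite ?inE ?(leq_ltn_trans rr') //;
  [move=> a b c /= ba cb; apply: leq_trans ba | move=> a /=].
Qed.

Lemma sum_boxes (T : std_tableau N lam) r y : y <= nth 0 lam r ->
  \sum_(i < N) \sum_(y' < y) ((val (box_of T i)).1 == r) && ((val (box_of T i)).2 == y') = y.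
Proof.
move=> yl; rewrite exchange_big /= -[RHS]card_ord -sum1_card.
apply: eq_bigr => y' _.
have y'l : y' < nth 0 lam r by apply: leq_trans yl.
pose b : box lam := exist _ (r, val y') y'l.
rewrite (bigD1 (entry T b)) //= entryK /= !eqxx /= big1 // => i ib.
apply/eqP; rewrite eqb0; apply: contra ib => /andP[/eqP e1 /eqP e2].
by apply/eqP; rewrite -(box_ofK T i); congr (entry T _); apply: val_inj; rewrite /= -e1 -e2; case: (sval _).
Qed.

Lemma cnt_word_of (T : std_tableau N lam) m r : m <= N ->
  cnt (word_of T) m r = \sum_(i < N) (i < m) && ((val (box_of T i)).1 == r).
Proof.
move=> mN; rewrite /cnt (big_ord_widen N (fun j => nat_of_bool (word_of T j == r))) //.
rewrite big_mkcond; apply: eq_bigr => i _.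
by rewrite word_ofE /row0; case: (i < m).
Qed.

Lemma tableau_row_lt (T : std_tableau N lam) i j :
  (val (box_of T i)).1 = (val (box_of T j)).1 ->
  (i < j) = ((val (box_of T i)).2 < (val (box_of T j)).2).
Proof.
move=> e; have key a b : (val (box_of T a)).1 = (val (box_of T b)).1 ->
    (val (box_of T a)).2 < (val (box_of T b)).2 -> a < b.
  by move=> e'; rewrite -{2}(box_ofK T a) -{2}(box_ofK T b); apply: entry_row.
case: ltngtP => [ij|ji|/val_inj ->]; last by rewrite ltnn.
  case: ltngtP => // [ji'|eq2]; first by have := key _ _ (esym e) ji'; rewrite ltnNge (ltnW ij).
  have ab : box_of T i = box_of T j.
    by apply: val_inj; rewrite [LHS]surjective_pairing [RHS]surjective_pairing e eq2.
  by move: ij; rewrite -(box_ofK T i) ab box_ofK ltnn.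
by apply/esym/negP => /(key _ _ e); rewrite ltnNge (ltnW ji).
Qed.

Lemma cnt_col (T : std_tableau N lam) (j : 'I_N) :
  cnt (word_of T) j (word_of T j) = (val (box_of T j)).2.
Proof.
rewrite cnt_word_of; last exact: ltnW.
rewrite word_ofE /row0; have bl := valP (box_of T j).
rewrite -[RHS](@sum_boxes T (val (box_of T j)).1); last exact: ltnW.
apply: eq_bigr => i _; case: (eqVneq (val (box_of T i)).1 (val (box_of T j)).1) => [e|_]; last first.
  by rewrite andbF big1.
rewrite andbT (tableau_row_lt e); case: ltnP => lt.
  rewrite (bigD1 (Ordinal lt)) //= eqxx big1 //= => y'; rewrite -val_eqE /= eq_sym.
  by move=> /negbTE ->.
by rewrite big1 // => y' _ /=; rewrite gtn_eqF // (leq_trans _ lt).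
Qed.

(** The entry of row r in the column of j, and those to its left, precede j. *)
Lemma cnt_above (T : std_tableau N lam) (j : 'I_N) r : r < word_of T j ->
  cnt (word_of T) j (word_of T j) < cnt (word_of T) j r.
Proof.
rewrite cnt_col word_ofE /row0 => rj; have bl := valP (box_of T j).
set r' := _.1 in rj bl; set y := _.2 in bl *.
have yl : y < nth 0 lam r by apply: leq_trans (part_geq (ltnW rj)).
rewrite cnt_word_of; last exact: ltnW.
rewrite -{1}(sum_boxes T yl).
apply: leq_sum => i _; case: (eqVneq (val (box_of T i)).1 r) => [e|_]; last first.
  by rewrite big1.
have [lt|ge] := ltnP (val (box_of T i)).2 y.+1; last first.
  by rewrite big1 // => y' _ /=; rewrite gtn_eqF // (leq_trans _ ge).
have -> : i < j.
  pose b : box lam := exist _ (r, y) yl.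
  have bj : entry T b < j by rewrite -(box_ofK T j); apply: entry_col.
  apply: leq_ltn_trans bj; move: lt; rewrite ltnS leq_eqVlt => /orP[/eqP e2|lt2].
    rewrite -(box_ofK T i) (_ : box_of T i = b) //; apply: val_inj.
    by rewrite [LHS]surjective_pairing e e2.
  by apply: ltnW; rewrite -{1}(box_ofK T i); apply: entry_row.
rewrite (bigD1 (Ordinal lt)) //= eqxx big1 //= => y'; rewrite -val_eqE /= eq_sym.
by move=> /negbTE ->.
Qed.

Lemma word_of_lattice (T : std_tableau N lam) : lattice_word (word_of T) N lam.
Proof.
split=> [r|m r].
  rewrite cnt_word_of // -[RHS](sum_boxes T (leqnn (nth 0 lam r))).
  apply: eq_bigr => i _; rewrite ltn_ord /=.
  case: (eqVneq (val (box_of T i)).1 r) => [e|_]; last by rewrite big1.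
  have bl := valP (box_of T i); rewrite /= e in bl.
  rewrite (bigD1 (Ordinal bl)) //= eqxx big1 //= => y'; rewrite -val_eqE /= eq_sym.
  by move=> /negbTE ->.
elim: m => [|m IH] mN; first by rewrite !cnt0.
rewrite !cntS; have := IH (ltnW mN).
case: (eqVneq (word_of T m) r.+1) => [e _|_ le]; last by rewrite addn0 (leq_trans le) ?leq_addr.
have := @cnt_above T (Ordinal mN) r; rewrite /= e => /(_ (ltnSn r)).
by rewrite (gtn_eqF (ltnSn r)) /= addn0 addn1.
Qed.

Lemma tableau_of_word (rho : nat -> nat) : lattice_word rho N lam ->
  exists T : std_tableau N lam, forall j : 'I_N, word_of T j = rho j.
Proof.
move=> W.
have bP (j : 'I_N) : cnt rho j (rho j) < nth 0 lam (rho j).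
  rewrite -(word_shape W); apply: leq_trans (cnt_mono rho (rho j) (ltn_ord j)).
  by rewrite cntS eqxx addn1.
pose bx (j : 'I_N) : box lam := exist _ (rho j, cnt rho j (rho j)) (bP j).
have eP (b : box lam) : exists j : 'I_N, (rho j == (val b).1) && (cnt rho j (rho j) == (val b).2).
  have := valP b; rewrite /= -(word_shape W) => /cnt_reach [j jN [e1 e2]].
  by exists (Ordinal jN); rewrite /= e1 e2 !eqxx.
pose en b := xchoose (eP b).
have enP b : rho (en b) = (val b).1 /\ cnt rho (en b) (rho (en b)) = (val b).2.
  by have /andP[/eqP -> /eqP] := xchooseP (eP b).
have enK : cancel en bx.
  move=> b; apply: val_inj; have [e1 e2] := enP b.
  by rewrite [RHS]surjective_pairing -e1 -e2.
have inj (i j : 'I_N) : rho i = rho j -> cnt rho i (rho i) = cnt rho j (rho j) -> i = j.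
  move=> e1 e2; rewrite e1 in e2; apply: val_inj => /=.
  case: (ltngtP i j) => // lt.
    by have := cnt_mono rho (rho j) lt; rewrite cntS e1 eqxx addn1 e2 ltnn.
  by have := cnt_mono rho (rho j) lt; rewrite cntS eqxx addn1 e2 ltnn.
have bxK : cancel bx en by move=> j; have [e1 e2] := enP (bx j); apply: inj.
have enr b c : (val b).1 = (val c).1 -> (val b).2 < (val c).2 -> en b < en c.
  have [b1 b2] := enP b; have [c1 c2] := enP c => e lt.
  rewrite ltnNge; apply: contraL lt => cb; rewrite -leqNgt -b2 -c2 b1 c1 -e.
  exact: cnt_mono.
have enc b c : (val b).2 = (val c).2 -> (val b).1 < (val c).1 -> en b < en c.
  have [b1 b2] := enP b; have [c1 c2] := enP c => e lt.
  rewrite ltnNge leq_eqVlt; apply/negP => /orP[/eqP/val_inj ebc|cb].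
    by move: lt; rewrite -b1 -c1 ebc ltnn.
  have h1 : cnt rho (en c).+1 (val c).1 = (val c).2.+1 by rewrite cntS c1 eqxx addn1 -c2 c1.
  have h2 := word_lattice_le W (ltn_ord (en c)) (ltnW lt).
  have h3 := cnt_mono rho (val b).1 cb.
  have := leq_trans h2 h3; rewrite h1 -b1 b2 e ltnn //.
by exists (StdTableau enK bxK enr enc) => j; rewrite word_ofE.
Qed.

End TableauWord.

(** * Critical points over a field with a place *)
(** The coefficient of t_i^(j), for the tableau with word rho. *)
Definition beta_of (F : fieldType) (rho : nat -> nat) (i j : nat) : F :=
  \prod_(r < i) ((gap rho j r)%:R / ((gap rho j r)%:R + 1)).

Section LogDerivative.
Variable K : fieldType.

Lemma roots_poly_logder (rs : seq K) x : x \notin rs ->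
  (roots_poly rs)^`().[x] = (roots_poly rs).[x] * \sum_(w <- rs) (x - w)^-1.
Proof.
elim: rs => [|w rs IH]; first by rewrite /roots_poly !big_nil derivC !hornerE ?mulr0.
rewrite inE negb_or => /andP[xw xr]; rewrite /roots_poly !big_cons -/(roots_poly rs).
rewrite derivM derivXsubC mul1r !hornerE IH //.
by field; rewrite subr_eq0.
Qed.

(** The equations in the form of second derivatives, through the logarithmic
    derivative of the product over the other roots of rs. *)
Lemma bethe_sum_poly (rs ps : seq K) x : uniq rs -> x \in rs -> x \notin ps ->
  \sum_(w <- rem x rs) 2 / (x - w) = \sum_(w <- ps) (x - w)^-1 ->
  (roots_poly ps)^`().[x] * (roots_poly rs)^`().[x] =
  (roots_poly ps).[x] * (roots_poly rs)^`()^`().[x].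
Proof.
move=> u xr xp E; rewrite roots_poly_logder // -E.
have -> : roots_poly rs = ('X - x%:P) * roots_poly (rem x rs).
  by rewrite /roots_poly (perm_big _ (perm_to_rem xr)) big_cons.
have xrem : x \notin rem x rs by rewrite mem_rem_uniqF.
rewrite derivM derivXsubC mul1r derivD derivM derivXsubC mul1r.
rewrite !hornerD !hornerM hornerXsubC subrr !mul0r !addr0 roots_poly_logder //.
by rewrite -mulr_sumr; ring.
Qed.
End LogDerivative.

Section PlaceTableau.
Variables (K k : fieldType) (lim : K -> k -> Prop).
Hypothesis limP : place lim.
Hypothesis k0 : forall m : nat, m.+1%:R != 0 :> k.
Variables (N : nat) (lam : seq nat) (t : forall i, 'I_(below lam i) -> K) (z : 'I_N -> K).
Hypothesis hlam : is_partition_of N lam.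

Definition level (i : nat) : seq K :=
  if i is 0 then [seq z j | j : 'I_N] else [seq t a | a : 'I_(below lam i)].

Hypothesis z0 : forall j, z j != 0.
Hypothesis z_inj : injective z.
Hypothesis zlim : forall i j : 'I_N, j = i.+1 :> nat -> lim (z i / z j) 0.
Hypothesis t_inj : forall i, (0 < i)%N -> injective (@t i).
Hypothesis level_disj : forall i x, x \in level i -> x \notin level i.+1.
Hypothesis bethe : forall i (a : 'I_(below lam i)), (0 < i)%N ->
  \sum_(b < below lam i | b != a) 2 / (t a - t b) =
  \sum_(w <- level i.-1) (t a - w)^-1 + \sum_(w <- level i.+1) (t a - w)^-1.

Lemma K0 m : m.+1%:R != 0 :> K.
Proof. exact: (lim_neq0 limP (lim_nat limP m.+1) (k0 m)). Qed.

Lemma below0 : below lam 0 = N.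
Proof. by case: hlam => _ _; rewrite /below drop0. Qed.

Lemma belowS i : below lam i = (nth 0%N lam i + below lam i.+1)%N.
Proof.
rewrite /below; have [lt|ge] := ltnP i (size lam); first by rewrite (drop_nth 0%N).
by rewrite nth_default // !drop_oversize // ltnW.
Qed.

Lemma below_size i : (size lam <= i)%N -> below lam i = 0%N.
Proof. by move=> ge; rewrite /below drop_oversize. Qed.

Lemma size_level i : size (level i) = below lam i.
Proof. by case: i => [|i]; rewrite size_map size_enum_ord // below0. Qed.

Lemma uniq_level i : uniq (level i).
Proof.
case: i => [|i] /=; rewrite map_inj_uniq ?enum_uniq //.
exact: t_inj.
Qed.

Lemma bethe_level i x : (0 < i)%N -> x \in level i ->
  (roots_poly (level i.-1) * roots_poly (level i.+1))^`().[x] * (roots_poly (level i))^`().[x] =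
  (roots_poly (level i.-1) * roots_poly (level i.+1)).[x] * (roots_poly (level i))^`()^`().[x].
Proof.
move=> i0 xi.
have -> : roots_poly (level i.-1) * roots_poly (level i.+1) =
    roots_poly (level i.-1 ++ level i.+1) by rewrite /roots_poly big_cat.
apply: bethe_sum_poly => //; first exact: uniq_level.
  rewrite mem_cat negb_or level_disj // andbT.
  by apply/negP => /level_disj; rewrite prednK // xi.
have lE : level i = [seq t a | a : 'I_(below lam i)] by case: (i) i0.
move: (xi); rewrite lE => /mapP[a _ xE].
rewrite big_cat /= xE -bethe // -lE.
apply: (addrI (2 / (t a - t a))).
transitivity (\sum_(w <- level i) 2 / (t a - w)).
  by rewrite [RHS](big_rem (t a)) // -xE.
by rewrite lE big_image /= (bigD1 a).
Qed.

(** The critical equations over a field with a place. Level i is read as the roots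
    of the Wronskian of the first n - i polynomials, so that rows are counted from
    the bottom: the exponent lowered at the scale of z_j is the one of index
    n - 1 - rho j. The lattice condition is the strict increase of the exponents,
    and box_ratio becomes beta_of because the differences of exponents are gaps. *)
Theorem place_tableau : exists2 rho : nat -> nat, lattice_word rho N lam &
  forall (j : 'I_N) i, (0 < i <= rho j)%N -> exists a : 'I_(below lam i),
    lim (t a / z j) (beta_of k rho i j).
Proof.
pose n := size lam; pose rts m := level (n - m).
have lastE : level n = [::] -> rts 0%N = [::] by rewrite /rts subn0.
have rts0 : rts 0%N = [::].
  by apply: lastE; apply/eqP; rewrite -size_eq0 size_level below_size.
pose z' (i : nat) := if insub i is Some j then z j else 0.
have z'E (j : 'I_N) : z' j = z j by rewrite /z' valK.
have rtsn : rts n = mkseq z' N.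
  rewrite /rts subnn /level /mkseq -val_enum_ord -map_comp.
  by apply: eq_map => j /=; rewrite z'E.
have sub_pred m : (m < n)%N -> (n - m = (n - m.+1).+1)%N by move=> mn; rewrite subnS prednK ?subn_gt0.
have rts_uniq m : (m <= n)%N -> uniq (rts m) by move=> _; apply: uniq_level.
have rts_disj m x : (m < n)%N -> x \in rts m -> x \notin rts m.+1.
  move=> mn; rewrite /rts sub_pred // => h; apply/negP => /level_disj.
  by rewrite h.
have rts_bethe m x : (m.+1 < n)%N -> x \in rts m.+1 ->
  (roots_poly (rts m) * roots_poly (rts m.+2))^`().[x] * (roots_poly (rts m.+1))^`().[x] =
  (roots_poly (rts m) * roots_poly (rts m.+2)).[x] * (roots_poly (rts m.+1))^`()^`().[x].
  move=> mn xr; rewrite mulrC /rts (sub_pred m (ltnW mn)) (sub_pred m.+1 mn).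
  have := @bethe_level (n - m.+1)%N x; rewrite subn_gt0 mn => /(_ isT xr).
  by rewrite -subnS mulrC (sub_pred m.+1 mn) /= [_ * roots_poly (level (n - m.+2))]mulrC.
have [phi [phiW phis]] := bethe_polys K0 rts0 rts_uniq rts_disj rts_bethe.
have srts m : size (rts m) = below lam (n - m) by rewrite size_level.
have diff m : (m < n)%N -> (size (rts m.+1) - size (rts m) = nth 0%N lam (n - m.+1))%N.
  by move=> mn; rewrite !srts (sub_pred m mn) [below lam (n - m.+1)]belowS addnK.
have rts_mono b : (b < n)%N -> (size (rts b) <= size (rts b.+1))%N.
  by move=> bn; rewrite !srts (sub_pred b bn) [below lam (n - b.+1)]belowS leq_addl.
have rts_conv b : (b.+1 < n)%N ->
  (size (rts b.+1) - size (rts b) <= size (rts b.+2) - size (rts b.+1))%N.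
  move=> bn; rewrite !diff ?(ltnW bn) //; apply: (part_geq hlam).
  by rewrite leq_sub2l.
have z'0 j : (j < N)%N -> z' j != 0.
  by move=> jN; rewrite -[j]/(val (Ordinal jN)) z'E.
have z'lim j : (j.+1 < N)%N -> lim (z' j / z' j.+1) 0.
  move=> jN; rewrite -[j]/(val (Ordinal (ltnW jN))) z'E -[_.+1]/(val (Ordinal jN)) z'E.
  exact: zlim.
have [c [q [qN q_0 qinc qstep qroot]]] :=
  tower_limits limP k0 z'0 z'lim rtsn rts_mono rts0 rts_conv phiW phis.
have cn j : (j < N)%N -> (c j < n)%N by move=> /qstep[].
have qE m b : (m <= N)%N -> (b < n)%N -> q m b = (b + \sum_(j < m) (c j == b))%N.
  elim: m => [|m IH] mN bn; first by rewrite big_ord0 addn0 q_0.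
  rewrite big_ord_recr /= addnA -IH // ?(ltnW mN) //.
  have [_ pos ->] := qstep m mN; rewrite /lower_at eq_sym.
  by case: (eqVneq (c m) b) => [<-|_]; rewrite ?subn0 ?addn0 // subn1 addn1 prednK.
pose rho j := (n - (c j).+1)%N.
have rho_eq j b : (j < N)%N -> (b < n)%N -> (rho j == (n - b.+1)%N) = (c j == b).
  by move=> jN bn; have := cn j jN; rewrite /rho => cj; apply/idP/idP => /eqP e; apply/eqP; lia.
have cntE m b : (m <= N)%N -> (b < n)%N -> cnt rho m (n - b.+1) = (\sum_(j < m) (c j == b))%N.
  move=> mN bn; apply: eq_bigr => j _; rewrite rho_eq //.
  exact: leq_trans mN.
have rho_lt j : (j < N)%N -> (rho j < n)%N by move=> /cn; rewrite /rho; lia.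
have cnt_out m r : (m <= N)%N -> (n <= r)%N -> cnt rho m r = 0%N.
  move=> mN nr; rewrite /cnt big1 // => j _.
  by rewrite ltn_eqF // (leq_trans (rho_lt _ _)) // (leq_trans (ltn_ord j)).
have W : lattice_word rho N lam.
  split=> [r|m r mN].
    have [rn|nr] := ltnP r n; last by rewrite cnt_out // nth_default.
    have bn : (n - r.+1 < n)%N by lia.
    have rE : r = (n - (n - r.+1).+1)%N by lia.
    rewrite {1}rE cntE //.
    have := qE N _ (leqnn N) bn; rewrite qN // /top_exponent diff // -rE addnC.
    by move/addnI.
  have [rn|nr] := ltnP r.+1 n; last by rewrite cnt_out.
  pose b := (n - r.+2)%N; have bn : (b.+1 < n)%N by rewrite /b; lia.
  have -> : r.+1 = (n - b.+1)%N by rewrite /b; lia.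
  have {1}-> : r = (n - b.+2)%N by rewrite /b; lia.
  rewrite !cntE ?(ltnW bn) //.
  have := qinc m mN b b.+1 (ltnSn b) bn.
  by rewrite !qE // ?(ltnW bn) // addSn ltnS leq_add2l.
exists rho => // j i /andP[i0 irho].
have jN := ltn_ord j; have cj := cn j jN.
have i_n : (i < n)%N by apply: leq_ltn_trans irho (rho_lt j jN).
have cm : (c j < n - i <= n)%N by rewrite leq_subr andbT; move: irho cj; rewrite /rho; lia.
have [x] := qroot j (n - i)%N jN cm.
rewrite z'E /rts subKn ?(ltnW i_n) // => xl.
have -> : box_ratio k n (q j.+1) (c j) (n - i) = beta_of k rho i j.
  rewrite /box_ratio /beta_of big_nat_rev /= -{1}(add0n (n - i)%N) big_addn.
  rewrite subKn ?(ltnW i_n) // big_mkord; apply: eq_bigr => r _.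
  have ri := ltn_ord r.
  set b := (_ - _.+1)%N; have bE : b = (n - r.+1)%N by rewrite /b; lia.
  have bn : (b < n)%N by rewrite bE; lia.
  have rE : nat_of_ord r = (n - b.+1)%N by rewrite bE; lia.
  have rr : (r < rho j)%N by apply: leq_trans irho.
  suff -> : (q j.+1 b)%:R - (q j.+1 (c j))%:R = (gap rho j r)%:R :> k by [].
  rewrite !qE //.
  rewrite -!cntE //.
  have lt : (cnt rho j (rho j) < cnt rho j r)%N by apply: (word_above W).
  have rcE : (n - (c j).+1)%N = rho j by [].
  rewrite rcE !cntS eqxx -rE (gtn_eqF rr) addn0.
  rewrite -natrB; last by rewrite bE; move: rr lt cj; rewrite /rho; lia.
  by congr (_%:R); rewrite /gap bE; move: rr lt cj; rewrite /rho; lia.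
move: xl; case: (i) i0 => // i' _ /mapP[a _ ->] h.
by exists a.
Qed.

End PlaceTableau.

Local Open Scope classical_set_scope.

(** * Complex limits along an ultrafilter *)
Section ComplexNorm.
Variable R : realType.
Notation C := (Cplx R).

Lemma Re_le_norm (x : R[i]) : (`|complex.Re x|)%:C%C <= `|x|.
Proof.
rewrite normc_def lecR -sqrtr_sqr ler_sqrt ?addr_ge0 ?sqr_ge0 //.
by rewrite lerDl sqr_ge0.
Qed.

Lemma Im_le_norm (x : R[i]) : (`|complex.Im x|)%:C%C <= `|x|.
Proof.
rewrite normc_def lecR -sqrtr_sqr ler_sqrt ?addr_ge0 ?sqr_ge0 //.
by rewrite lerDr sqr_ge0.
Qed.

Lemma norm_le_ReIm (x : R[i]) : `|x| <= (`|complex.Re x| + `|complex.Im x|)%:C%C.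
Proof.
rewrite normc_def lecR -[leRHS]ger0_norm ?addr_ge0 // -sqrtr_sqr.
rewrite ler_sqrt ?sqr_ge0 // sqrrD !real_normK ?num_real // -addrA lerD2l.
by rewrite lerDr mulrn_wge0 // mulr_ge0.
Qed.

Lemma pos_cplxP (e : R[i]) : 0 < e -> exists2 r : R, 0 < r & e = r%:C%C.
Proof.
case: e => a b; rewrite ltcE /= => /andP[/eqP -> a0]; by exists a.
Qed.

Lemma cvg_cplx T (F : set_system T) (FF : Filter F) (f : T -> C) (a b : R) :
  (fun x => complex.Re (f x)) @ F --> a -> (fun x => complex.Im (f x)) @ F --> b ->
  f @ F --> ((a +i* b)%C : C).
Proof.
move=> /cvgrPdist_lt ha /cvgrPdist_lt hb; apply/cvgrPdist_lt => e /pos_cplxP[r r0 ->].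
have r20 : 0 < r / 2 by rewrite divr_gt0.
near=> x.
have h1 : `|a - complex.Re (f x)| < r / 2 by near: x; apply: ha.
have h2 : `|b - complex.Im (f x)| < r / 2 by near: x; apply: hb.
have -> : (a +i* b)%C - f x = ((a - complex.Re (f x)) +i* (b - complex.Im (f x)))%C by case: (f x).
apply: le_lt_trans (norm_le_ReIm _) _; rewrite ltcR /=; lra.
Unshelve. all: by end_near. Qed.

Lemma ultra_bounded_cvgR T (U : set_system T) (UU : UltraFilter U) (f : T -> R) (M : R) :
  (\forall x \near U, `|f x| <= M) -> exists a : R, f @ U --> a.
Proof.
move=> fM.
have : (f @ U) `[- M, M].
  by apply: filterS fM => x; rewrite /= in_itv /= ler_norml.
move=> /(segment_compact _)[a [_ ca]]; exists a => B aB.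
have [//|h] := in_ultra_setVsetC (f @^-1` B) UU.
have h' : (f @ U) (~` B) by exact: h.
by have [y [nB By]] := ca _ _ h' aB.
Qed.

(** Compactness of intervals, for the real and the imaginary parts. *)
Lemma ultra_bounded_cvg T (U : set_system T) (UU : UltraFilter U) (f : T -> C) (M : R) :
  (\forall x \near U, `|f x| <= M%:C%C) -> exists a : C, f @ U --> a.
Proof.
move=> fM.
have [|a ha] := @ultra_bounded_cvgR _ _ UU (fun x => complex.Re (f x)) M.
  by apply: filterS fM => x h; rewrite -lecR; apply: le_trans (Re_le_norm _) h.
have [|b hb] := @ultra_bounded_cvgR _ _ UU (fun x => complex.Im (f x)) M.
  by apply: filterS fM => x h; rewrite -lecR; apply: le_trans (Im_le_norm _) h.
by exists (a +i* b)%C; apply: cvg_cplx.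
Qed.

End ComplexNorm.

(** * The ultrapower of a field and its place *)
Section Ultrapower.
Variables (C : fieldType) (T : pointedType) (U : set_system T) (UU : UltraFilter U).

Definition ueq (f g : T -> C) : bool := `[< U [set x | f x = g x] >].

Lemma ueqP f g : reflect (\forall x \near U, f x = g x) (ueq f g).
Proof. exact: asboolP. Qed.

Lemma ueq_refl : reflexive ueq.
Proof. by move=> f; apply/ueqP; apply: nearW. Qed.

Lemma ueq_sym : symmetric ueq.
Proof.
by move=> f g; apply/ueqP/ueqP; apply: filterS => x ->.
Qed.

Lemma ueq_trans : transitive ueq.
Proof.
move=> g f h /ueqP fg /ueqP gh; apply/ueqP.
by apply: filterS2 fg gh => x -> ->.
Qed.

Canonical ueq_equiv := EquivRel ueq ueq_refl ueq_sym ueq_trans.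
Local Open Scope quotient_scope.
Definition upower := {eq_quot ueq}.
HB.instance Definition _ := Choice.on upower.
HB.instance Definition _ := EqQuotient.on upower.

Definition ucl (f : T -> C) : upower := \pi_upower f.

Lemma ucl_eq f g : ucl f = ucl g <-> \forall x \near U, f x = g x.
Proof.
split=> [/eqquotP /ueqP //|h]; apply/eqquotP; exact/ueqP.
Qed.

Lemma urepr f : \forall x \near U, repr (ucl f) x = f x.
Proof. by apply/ucl_eq; rewrite /ucl reprK. Qed.

Lemma uclE (a : upower) : ucl (repr a) = a.
Proof. exact: reprK. Qed.

Definition uadd (a b : upower) := ucl (fun x => repr a x + repr b x).
Definition uopp (a : upower) := ucl (fun x => - repr a x).
Definition umul (a b : upower) := ucl (fun x => repr a x * repr b x).
Definition uinv (a : upower) := ucl (fun x => (repr a x)^-1).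

Lemma uaddE f g : uadd (ucl f) (ucl g) = ucl (fun x => f x + g x).
Proof. by apply/ucl_eq; apply: filterS2 (urepr f) (urepr g) => x -> ->. Qed.
Lemma uoppE f : uopp (ucl f) = ucl (fun x => - f x).
Proof. by apply/ucl_eq; apply: filterS (urepr f) => x ->. Qed.
Lemma umulE f g : umul (ucl f) (ucl g) = ucl (fun x => f x * g x).
Proof. by apply/ucl_eq; apply: filterS2 (urepr f) (urepr g) => x -> ->. Qed.
Lemma uinvE f : uinv (ucl f) = ucl (fun x => (f x)^-1).
Proof. by apply/ucl_eq; apply: filterS (urepr f) => x ->. Qed.

Let ext (f g : T -> C) : f =1 g -> ucl f = ucl g.
Proof. by move=> fg; apply/ucl_eq; apply: nearW. Qed.

Fact uaddA : associative uadd.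
Proof. by move=> a b c; rewrite -[a]uclE -[b]uclE -[c]uclE !uaddE; apply: ext => x; rewrite addrA. Qed.
Fact uaddC : commutative uadd.
Proof. by move=> a b; rewrite -[a]uclE -[b]uclE !uaddE; apply: ext => x; rewrite addrC. Qed.
Fact uadd0 : left_id (ucl (fun=> 0)) uadd.
Proof. by move=> a; rewrite -[a]uclE !uaddE; apply: ext => x; rewrite add0r. Qed.
Fact uaddN : left_inverse (ucl (fun=> 0)) uopp uadd.
Proof. by move=> a; rewrite -[a]uclE uoppE !uaddE; apply: ext => x; rewrite addNr. Qed.
Fact umulA : associative umul.
Proof. by move=> a b c; rewrite -[a]uclE -[b]uclE -[c]uclE !umulE; apply: ext => x; rewrite mulrA. Qed.
Fact umulC : commutative umul.
Proof. by move=> a b; rewrite -[a]uclE -[b]uclE !umulE; apply: ext => x; rewrite mulrC. Qed.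
Fact umul1 : left_id (ucl (fun=> 1)) umul.
Proof. by move=> a; rewrite -[a]uclE !umulE; apply: ext => x; rewrite mul1r. Qed.
Fact umulD : left_distributive umul uadd.
Proof. by move=> a b c; rewrite -[a]uclE -[b]uclE -[c]uclE !(umulE, uaddE); apply: ext => x; rewrite mulrDl. Qed.

HB.instance Definition _ := GRing.isZmodule.Build upower uaddA uaddC uadd0 uaddN.

Fact u1_neq0 : ucl (fun=> 1) != 0 :> upower.
Proof.
apply/eqP => /ucl_eq h; have [x] := @filter_ex _ U _ _ h.
by move/eqP; rewrite oner_eq0.
Qed.

HB.instance Definition _ := GRing.Zmodule_isComNzRing.Build upower umulA umulC umul1 umulD u1_neq0.

Fact umulV (a : upower) : a != 0 -> umul (uinv a) a = ucl (fun=> 1).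
Proof.
rewrite -[a]uclE uinvE umulE => a0; apply/ucl_eq.
have [h|h] := in_ultra_setVsetC [set x | repr a x = 0] UU.
  by case/eqP: a0; apply/ucl_eq.
by apply: filterS h => x /= /eqP; apply: mulVf.
Qed.

Fact uinv0 : uinv 0 = 0.
Proof. by rewrite -[0]/(ucl (fun=> 0)) uinvE; apply: ext => x; rewrite invr0. Qed.

HB.instance Definition _ := GRing.ComNzRing_isField.Build upower umulV uinv0.

Lemma uclD f g : ucl (fun x => f x + g x) = ucl f + ucl g.
Proof. by rewrite -uaddE. Qed.
Lemma uclN f : ucl (fun x => - f x) = - ucl f.
Proof. by rewrite -uoppE. Qed.
Lemma uclM f g : ucl (fun x => f x * g x) = ucl f * ucl g.
Proof. by rewrite -umulE. Qed.
Lemma uclV f : ucl (fun x => (f x)^-1) = (ucl f)^-1.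
Proof. by rewrite -uinvE. Qed.
Lemma ucl0 : ucl (fun=> 0) = 0. Proof. by []. Qed.
Lemma ucl1 : ucl (fun=> 1) = 1. Proof. by []. Qed.

Lemma ucl_nat m : ucl (fun=> m%:R) = m%:R.
Proof. by elim: m => [|m IH]; rewrite ?ucl0 // -[in RHS]natr1 -IH -ucl1 -uclD; apply: ext => x; rewrite natr1. Qed.

Lemma ucl_sum I (r : seq I) (P : pred I) (F : I -> T -> C) :
  ucl (fun x => \sum_(i <- r | P i) F i x) = \sum_(i <- r | P i) ucl (F i).
Proof.
elim: r => [|i r IH]; first by rewrite big_nil -ucl0; apply: ext => x; rewrite big_nil.
rewrite big_cons; case: ifP => Pi; rewrite -IH -?uclD; apply: ext => x;
  by rewrite big_cons Pi.
Qed.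

End Ultrapower.

Section UltraPlace.
Variables (R : realType) (T : pointedType) (U : set_system T) (UU : UltraFilter U).
Notation C := (Cplx R).
Notation K := (upower C UU).

Definition ulim (a : K) (c : C) : Prop := repr a @ U --> c.

Lemma ulimE (f : T -> C) c : ulim (ucl UU f) c <-> f @ U --> c.
Proof.
split; apply: cvg_trans; apply: near_eq_cvg.
  by apply: filterS (urepr UU f) => x ->.
by apply: filterS (urepr UU f) => x ->.
Qed.

(** On a set of the ultrafilter a function is either bounded, hence convergent, or
    larger than any constant. *)
Lemma ulim_place : place ulim.
Proof.
split.
- move=> a c d; apply: (@cvg_unique _ (@norm_hausdorff _ _)).
- by apply: (ulimE _ _).2; exact: cvg_cst.
- move=> a b c d ha hb.
  have -> : a + b = ucl UU (fun x => repr a x + repr b x) by rewrite uclD !uclE.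
  apply: (ulimE _ _).2.
  rewrite /ulim in ha hb.
  move: (repr a) (repr b) ha hb => f g ha hb.
  exact: cvgD ha hb.
- move=> a c ha.
  have -> : - a = ucl UU (fun x => - repr a x) by rewrite uclN uclE.
  apply: (ulimE _ _).2; rewrite /ulim in ha.
  by move: (repr a) ha => f ha; exact: cvgN ha.
- move=> a b c d ha hb.
  have -> : a * b = ucl UU (fun x => repr a x * repr b x) by rewrite uclM !uclE.
  apply: (ulimE _ _).2; rewrite /ulim in ha hb.
  by move: (repr a) (repr b) ha hb => f g ha hb; exact: cvgM ha hb.
move=> a.
have -> : a^-1 = ucl UU (fun x => (repr a x)^-1) by rewrite uclV uclE.
have [[M hM]|h] := pselect (exists M : R, \forall x \near U, `|repr a x| <= M%:C%C).
  by left; rewrite /ulim; move: (repr a) hM => f hM; apply: (ultra_bounded_cvg UU hM).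
right; apply: (ulimE _ _).2; move: (repr a) h => f h; apply/cvgrPdist_lt => e /pos_cplxP[r r0 ->].
have [h1|h1] := in_ultra_setVsetC [set x | `|f x| <= (r^-1)%:C%C] UU.
  by case: h; exists r^-1.
apply: filterS h1 => x /= /negP.
rewrite -real_ltNge ?normr_real //; last by rewrite complex_real.
have ri : 0 < (r^-1)%:C%C :> C by rewrite ltcR invr_gt0.
move=> lt; rewrite sub0r normrN normfV.
have -> : r%:C%C = ((r^-1)%:C%C)^-1 :> C by rewrite -fmorphV invrK.
by rewrite ltf_pV2 ?posrE // (lt_trans ri).
Qed.

End UltraPlace.

(** * Partial derivatives of the master function *)
Section LogDer.
Variables (C : numFieldType) (V : normedModType C) (x v : V).

(** The logarithmic derivative of f at x along v is c; additive in f, it turns the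
    products in the master function into sums. *)
Definition logder (f : V -> C) (c : C) : Prop :=
  f x != 0 /\ is_derive x v f (c * f x).

Lemma logderM f g c d : logder f c -> logder g d ->
  logder (fun y => f y * g y) (c + d).
Proof.
move=> [f0 fd] [g0 gd]; split; first by rewrite mulf_neq0.
have h := is_deriveM fd gd.
apply: is_derive_eq h _; rewrite /GRing.scale /=; ring.
Qed.

Lemma logderV f c : logder f c -> logder (fun y => (f y)^-1) (- c).
Proof.
move=> [f0 [fd fv]]; split; first by rewrite invr_eq0.
split; first exact: derivableV.
by rewrite deriveV // fv /GRing.scale /=; field.
Qed.

Lemma logder1 : logder (fun=> 1) 0.
Proof. by split; [exact: oner_neq0 | rewrite mul0r; exact: is_derive_cst]. Qed.

Lemma logder_prod I (r : seq I) (P : pred I) (F : I -> V -> C) (c : I -> C) :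
  (forall i, P i -> logder (F i) (c i)) ->
  logder (fun y => \prod_(i <- r | P i) F i y) (\sum_(i <- r | P i) c i).
Proof.
move=> h; elim: r => [|i r IH].
  rewrite big_nil (_ : (fun y => _) = fun=> 1); first exact: logder1.
  by apply/funext => y; rewrite big_nil.
rewrite big_cons; case: ifP => Pi.
  rewrite (_ : (fun y => _) = fun y => F i y * \prod_(i <- r | P i) F i y).
    by apply: logderM => //; apply: h.
  by apply/funext => y; rewrite big_cons Pi.
rewrite (_ : (fun y => _) = fun y => \prod_(i <- r | P i) F i y) //.
by apply/funext => y; rewrite big_cons Pi.
Qed.

Lemma logder_prod_nat m n (F : nat -> V -> C) (c : nat -> C) :
  (forall i, (m <= i < n)%N -> logder (F i) (c i)) ->
  logder (fun y => \prod_(m <= i < n) F i y) (\sum_(m <= i < n) c i).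
Proof.
move=> h; rewrite big_nat.
rewrite (_ : (fun y => _) = fun y => \prod_(m <= i < n | (m <= i < n)%N) F i y).
  exact: logder_prod.
by apply/funext => y; rewrite big_nat.
Qed.

Lemma logder_sub (u w : V -> C) (du dw : C) : is_derive x v u du -> is_derive x v w dw ->
  u x != w x -> logder (fun y => u y - w y) ((du - dw) / (u x - w x)).
Proof.
move=> hu hw uw; split; first by rewrite subr_eq0.
apply: is_derive_eq (is_deriveB hu hw) _.
by rewrite divfK // subr_eq0.
Qed.

Lemma logderX2 f c : logder f c -> logder (fun y => f y ^+ 2) (2 * c).
Proof.
move=> h; rewrite (_ : (fun y => _) = fun y => f y * f y); last by apply/funext.
by rewrite mulr2n mulrDl mul1r; apply: logderM.
Qed.

Lemma logder_val f c : logder f c -> 'D_v f x / f x = c.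
Proof. by move=> [f0 [_ ->]]; rewrite mulfK. Qed.

End LogDer.

Section MasterDerivatives.
Variables (R : realType) (N : nat) (lam : seq nat).
Notation C := (Cplx R).

(** All variables may move at once; the partial derivatives in t and in z are the
    cases in which a single one does. *)
Lemma logder_master (V : normedModType C) (x v : V)
    (tf : V -> tvars R lam) (zf : V -> 'rV[C]_N)
    (dt : forall i, 'I_(below lam i) -> C) (dz : 'I_N -> C) :
  (forall i a, is_derive x v (fun y => tf y i a) (dt i a)) ->
  (forall k, is_derive x v (fun y => zf y 0 k) (dz k)) ->
  nondegenerate (tf x) (zf x) ->
  logder x v (fun y => exp_master (tf y) (zf y))
  (\sum_(k < N) \sum_(l < N | (k < l)%N) (dz k - dz l) / (zf x 0 k - zf x 0 l)
  - \sum_(k < N) \sum_(a < below lam 1) (dz k - dt 1%N a) / (zf x 0 k - tf x 1%N a)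
  + \sum_(1 <= i < size lam) \sum_(a < below lam i) \sum_(b < below lam i | (a < b)%N)
     2 * ((dt i a - dt i b) / (tf x i a - tf x i b))
  - \sum_(1 <= i < size lam) \sum_(a < below lam i) \sum_(b < below lam i.+1)
     (dt i a - dt i.+1 b) / (tf x i a - tf x i.+1 b)).
Proof.
move=> ht hz [n1 n2 n3 n4].
apply: logderM; first apply: logderM; first apply: logderM.
- apply: logder_prod => k _; apply: logder_prod => l kl; apply: logder_sub => //.
  by apply: n1; rewrite -val_eqE ltn_eqF.
- rewrite -sumrN; apply: logder_prod => k _; rewrite -sumrN; apply: logder_prod => a _.
  by apply/logderV/logder_sub.
- apply: logder_prod_nat => i /andP[i0 _]; apply: logder_prod => a _; apply: logder_prod => b ab.
  by apply/logderX2/logder_sub => //; apply: n3 => //; rewrite -val_eqE ltn_eqF.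
rewrite -sumrN; apply: logder_prod_nat => i /andP[i0 _]; rewrite -sumrN; apply: logder_prod => a _.
rewrite -sumrN; apply: logder_prod => b _.
by apply/logderV/logder_sub => //; apply: n4.
Qed.

Lemma is_derive_coord n (z v : 'rV[C]_n) (k : 'I_n) :
  is_derive z v (fun y : 'rV[C]_n => y 0 k) (v 0 k).
Proof.
have E : \forall h \near (0 : C)^', h^-1 *: (((fun y : 'rV[C]_n => y 0 k) \o shift z) (h *: v) - z 0 k) = v 0 k.
  near=> h; have h0 : h != 0 by near: h; apply: nbhs_dnbhs_neq.
  by rewrite /= !mxE addrK /GRing.scale /= mulrA mulVf // mul1r.
by split; [exact: is_cvg_near_cst E | exact: lim_near_cst E].
Unshelve. all: by end_near. Qed.

(** Only the pairs that contain a contribute, each once, with the sign of the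
    position of a cancelling that of the difference. *)
Lemma pair_sum n (y : 'I_n -> C) (a : 'I_n) :
  \sum_(i < n) \sum_(j < n | (i < j)%N) ((i == a)%:R - (j == a)%:R) / (y i - y j)
  = \sum_(j < n | j != a) (y a - y j)^-1.
Proof.
under eq_bigr do under eq_bigr do rewrite mulrBl.
under eq_bigr do rewrite big_split /=.
rewrite big_split /= [X in X + _](bigD1 a) //= [X in _ + X + _]big1 ?addr0; last first.
  by move=> i ia; rewrite big1 // => j _; rewrite (negbTE ia) mul0r.
rewrite [X in _ + X](exchange_big_dep xpredT) //= [X in _ + X](bigD1 a) //=.
rewrite [X in _ + (_ + X)]big1 ?addr0; last first.
  by move=> j ja; rewrite big1 // => i _; rewrite (negbTE ja) mul0r oppr0.
rewrite [RHS](bigID (fun j : 'I_n => (a < j)%N)) /=; congr (_ + _).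
  apply: eq_big => j; last by rewrite eqxx mul1r.
  by rewrite -val_eqE /=; case: ltngtP.
apply: eq_big => j; first by rewrite -val_eqE /=; case: ltngtP.
by rewrite eqxx mul1r -invrN opprB.
Qed.

Lemma lower_level_sum (t : tvars R lam) (z : 'rV[C]_N) i (a : 'I_(below lam i)) :
  (0 < i)%N -> (i < size lam)%N ->
  let dt i' (b : 'I_(below lam i')) : C := ((i' == i) && (b == a :> nat))%:R in
  \sum_(k < N) \sum_(b < below lam 1) (0 - dt 1%N b) / (z 0 k - t 1%N b) +
  \sum_(1 <= i' < size lam | i'.+1 == i) \sum_(a' < below lam i') \sum_(b < below lam i'.+1)
     - dt i'.+1 b / (t i' a' - t i'.+1 b) =
  \sum_(w <- level t (fun j => z 0 j) i.-1) (t i a - w)^-1.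
Proof.
case: i a => [//|[|i]] a _ ilt dt /=.
  rewrite [X in _ + X]big1_seq ?addr0; last first.
    by move=> i'; rewrite mem_index_iota => /andP[/eqP[->]].
  rewrite big_image /=; apply: eq_bigr => k _.
  rewrite (bigD1 a) //= big1 ?addr0.
    by rewrite /dt !eqxx sub0r mulN1r -invrN opprB.
  by move=> b ne; rewrite /dt eqxx /= (negbTE (ne : nat_of_ord b != a)) subrr mul0r.
rewrite big1 ?add0r; last first.
  by move=> k _; rewrite big1 // => b _; rewrite /dt /= subrr mul0r.
rewrite big_mkcond (bigD1_seq i.+1) ?mem_index_iota ?iota_uniq //=; last exact: ltnW.
rewrite eqxx [X in _ + X]big1 ?addr0; last first.
  by move=> i' ne; rewrite eqSS (negbTE ne).
rewrite big_image /=; apply: eq_bigr => a' _.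
rewrite (bigD1 a) //= big1 ?addr0.
  by rewrite /dt !eqxx mulN1r -invrN opprB.
by move=> b ne; rewrite /dt eqxx /= (negbTE (ne : nat_of_ord b != a)) oppr0 mul0r.
Qed.

Lemma dmaster_dtE (t : tvars R lam) (z : 'rV[C]_N) i (a : 'I_(below lam i)) :
  (0 < i)%N -> nondegenerate t z ->
  dmaster_dt t z a = \sum_(b < below lam i | b != a) 2 / (t i a - t i b)
   - \sum_(w <- level t (fun j => z 0 j) i.-1) (t i a - w)^-1
   - \sum_(w <- level t (fun j => z 0 j) i.+1) (t i a - w)^-1.
Proof.
move=> i0 nd; rewrite /dmaster_dt derive1E.
pose dt i' (b : 'I_(below lam i')) : C := ((i' == i) && (b == a :> nat))%:R.
have tE : tupdate t a (t i a) = t.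
  apply: functional_extensionality_dep => i'; apply/funext => b; rewrite /tupdate.
  case: eqP => //= e; subst i'; case: eqP => //= e.
  by congr (t _ _); apply: val_inj.
have ht i' b : is_derive (t i a) (1 : C) (fun s => tupdate t a s b) (dt i' b).
  rewrite /tupdate /dt; case: (_ && _); first exact: is_derive_id.
  exact: is_derive_cst.
have hz k : is_derive (t i a) (1 : C) (fun _ => z 0 k) (0 : C) by exact: is_derive_cst.
have := logder_master (tf := fun s => tupdate t a s) (zf := fun=> z) ht hz.
rewrite tE => /(_ nd) /logder_val /=.
rewrite tE => ->.
have ilt : (i < size lam)%N.
  by rewrite ltnNge; apply/negP => /below_size e; have := ltn_ord a; rewrite [X in (_ < X)%N]e.
have S1 : \sum_(k < N) \sum_(l < N | (k < l)%N) ((0 : C) - 0) / (z 0 k - z 0 l) = 0.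
  by rewrite big1 // => k _; rewrite big1 // => l _; rewrite subrr mul0r.
rewrite [X in X - _ + _ - _]S1 add0r.
have S3 : \sum_(1 <= i' < size lam) \sum_(a' < below lam i') \sum_(b < below lam i' | (a' < b)%N)
     2 * ((dt i' a' - dt i' b) / (t i' a' - t i' b)) = \sum_(b < below lam i | b != a) 2 / (t i a - t i b).
  rewrite (bigD1_seq i) ?mem_index_iota ?i0 ?iota_uniq //= [X in _ + X]big1 ?addr0.
    rewrite -mulr_sumr -pair_sum mulr_sumr; apply: eq_bigr => a' _.
    by rewrite mulr_sumr; apply: eq_bigr => b _; rewrite /dt eqxx.
  move=> i' ne; rewrite big1 // => a' _; rewrite big1 // => b _.
  by rewrite /dt (negbTE ne) subrr mul0r mulr0.
rewrite S3.
have S4 : \sum_(1 <= i' < size lam) \sum_(a' < below lam i') \sum_(b < below lam i'.+1)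
     (dt i' a' - dt i'.+1 b) / (t i' a' - t i'.+1 b) =
   \sum_(w <- level t (fun j => z 0 j) i.+1) (t i a - w)^-1 +
   \sum_(1 <= i' < size lam | i'.+1 == i) \sum_(a' < below lam i') \sum_(b < below lam i'.+1)
     - dt i'.+1 b / (t i' a' - t i'.+1 b).
  under eq_bigr do under eq_bigr do under eq_bigr do rewrite mulrBl.
  under eq_bigr do under eq_bigr do rewrite big_split.
  under eq_bigr do rewrite big_split.
  rewrite big_split /=; congr (_ + _).
    rewrite (bigD1_seq i) ?mem_index_iota ?i0 ?iota_uniq //= [X in _ + X]big1 ?addr0.
      rewrite (bigD1 a) //= [X in _ + X]big1 ?addr0.
        rewrite /level /= big_image /=; apply: eq_bigr => b _.
        by rewrite /dt !eqxx mul1r.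
      by move=> a' ne; rewrite big1 // => b _; rewrite /dt eqxx /= (negbTE (ne : nat_of_ord a' != a)) mul0r.
    by move=> i' ne; rewrite big1 // => a' _; rewrite big1 // => b _; rewrite /dt (negbTE ne) mul0r.
  rewrite [LHS](bigID (fun i' => i'.+1 == i)) /= [X in _ + X]big1 ?addr0.
    by apply: eq_bigr => i' _; apply: eq_bigr => a' _; apply: eq_bigr => b _; rewrite mulNr.
  move=> i' ne; rewrite big1 // => a' _; rewrite big1 // => b _.
  by rewrite /dt (negbTE ne) mul0r oppr0.
rewrite S4 -(lower_level_sum t z a i0 ilt) /dt; ring.
Qed.

Lemma dmaster_dzE (t : tvars R lam) (z : 'rV[C]_N) (j : 'I_N) :
  nondegenerate t z ->
  dmaster_dz t z j = \sum_(l < N | l != j) (z 0 j - z 0 l)^-1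
   - \sum_(a < below lam 1) (z 0 j - t 1%N a)^-1.
Proof.
move=> nd; rewrite /dmaster_dz.
have ht i a : is_derive z (delta_mx 0 j : 'rV[C]_N) (fun _ => t i a) (0 : C) by exact: is_derive_cst.
have hz k : is_derive z (delta_mx 0 j : 'rV[C]_N) (fun y => y 0 k) ((k == j)%:R : C).
  have := is_derive_coord z (delta_mx 0 j) k.
  by rewrite mxE eqxx.
have := logder_master (tf := fun=> t) (zf := id) ht hz nd => /logder_val /= ->.
rewrite pair_sum.
have Z2 : \sum_(k < N) \sum_(a < below lam 1) ((k == j)%:R - (0 : C)) / (z 0 k - t 1%N a) =
    \sum_(a < below lam 1) (z 0 j - t 1%N a)^-1.
  rewrite (bigD1 j) //= [X in _ + X]big1 ?addr0.
    by apply: eq_bigr => a _; rewrite eqxx subr0 mul1r.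
  by move=> k ne; rewrite big1 // => a _; rewrite (negbTE ne) subrr mul0r.
have Z3 : \sum_(1 <= i < size lam) \sum_(a < below lam i) \sum_(b < below lam i | (a < b)%N)
     2 * (((0 : C) - 0) / (t i a - t i b)) = 0.
  by rewrite big1 // => i _; rewrite big1 // => a _; rewrite big1 // => b _; rewrite subrr mul0r mulr0.
have Z4 : \sum_(1 <= i < size lam) \sum_(a < below lam i) \sum_(b < below lam i.+1)
     ((0 : C) - 0) / (t i a - t i.+1 b) = 0.
  by rewrite big1 // => i _; rewrite big1 // => a _; rewrite big1 // => b _; rewrite subrr mul0r.
by rewrite [X in _ - X + _ - _]Z2 [X in _ - _ + X - _]Z3 [X in _ - X]Z4 addr0 subr0.
Qed.

End MasterDerivatives.

(** * The asymptotic zone *)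
Section ZoneTools.
Variables (R : realType) (N : nat).
Notation C := (Cplx R).
Notation AZ := (@asymptotic_zone R N).

Lemma zone_ratio (M : C) (z : 'rV[C]_N) (i j : 'I_N) : 1 <= M -> zone M z ->
  (i < j)%N -> M < `|z 0 j / z 0 i|.
Proof.
move=> M1 [z0 zM]; have M0 : 0 < M by apply: lt_le_trans M1.
case: j => j jN /=; elim: j jN => // j IH jN; rewrite ltnS leq_eqVlt => /orP[/eqP e|ij].
  by apply: zM; rewrite /= e.
have jN' := ltnW jN.
have h1 := IH jN' ij; have h2 := zM (Ordinal jN') (Ordinal jN) erefl.
have -> : z 0 (Ordinal jN) / z 0 i = (z 0 (Ordinal jN) / z 0 (Ordinal jN')) * (z 0 (Ordinal jN') / z 0 i).
  by rewrite mulrA divfK.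
rewrite normrM; apply: le_lt_trans (ltr_pM (ltW M0) (ltW M0) h2 h1).
by rewrite ler_peMl // ltW.
Qed.

Lemma near_zone (M : C) : 0 < M -> \forall z \near AZ, zone M z.
Proof. by move=> M0; exists M. Qed.

Lemma zone_le (M M' : C) (z : 'rV[C]_N) : M <= M' -> zone M' z -> zone M z.
Proof. by move=> MM' [z0 zM]; split=> // i j ij; apply: le_lt_trans MM' (zM _ _ ij). Qed.

Lemma zone_nonempty (M : C) : 0 < M -> exists z : 'rV[C]_N, zone M z.
Proof.
move=> M0; have M1 : 0 < M + 1 by rewrite addr_gt0.
exists (\row_j (M + 1) ^+ j); split=> [j|i j ij]; first by rewrite mxE expf_neq0 // gt_eqF.
rewrite !mxE ij exprS mulfK ?expf_neq0 ?gt_eqF // ger0_norm ?ltW //.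
by rewrite ltrDl.
Qed.

Global Instance asymptotic_zone_proper : ProperFilter AZ.
Proof.
apply: Build_ProperFilter_ex.
by move=> A [M /= /zone_nonempty[z zM] MA]; exists z; apply: MA.
Qed.

Lemma zone_ratio_cvg (i j : 'I_N) : (i < j)%N ->
  (fun z : 'rV[C]_N => z 0 i / z 0 j) @ AZ --> (0 : C).
Proof.
move=> ij; apply/cvgrPdist_lt => e e0; near=> z.
rewrite sub0r normrN -invf_div normfV -(invrK e).
have h : zone (e^-1 + 1) z by near: z; apply: near_zone; rewrite addr_gt0 ?invr_gt0.
have ei : 0 < e^-1 by rewrite invr_gt0.
have lt : e^-1 < `|z 0 j / z 0 i|.
  by apply: lt_trans (zone_ratio _ h ij); rewrite ?ltrDl // lerDr ltW.
by rewrite ltf_pV2 ?posrE // (lt_trans ei).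
Unshelve. all: by end_near. Qed.

Lemma near_coord_neq0 (j : 'I_N) : \forall z \near AZ, (z : 'rV[C]_N) 0 j != 0.
Proof. by exists 1 => //= z [z0 _]. Qed.

(** A set that is not in F meets every set of F in its complement, so some
    ultrafilter finer than F contains that complement. *)
Lemma ultra_near (T : Type) (F : set_system T) (E : set T) : Filter F ->
  (forall U, UltraFilter U -> F `<=` U -> U E) -> F E.
Proof.
move=> FF H; apply: contrapT => nFE.
pose G := within (~` E) F.
have GF : Filter G by apply: within_filter.
have GP : ProperFilter G.
  apply: Build_ProperFilter_ex => P GP; apply: contrapT => nP; apply: nFE.
  rewrite /G /within /= in GP; apply: filterS GP => x h.
  by apply: contrapT => nE; apply: nP; exists x; apply: h.
have [U [UU GU]] := ultraFilterLemma GP.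
have FU : F `<=` U.
  by move=> A FA; apply: GU; rewrite /G /within /=; apply: filterS FA => x Ax _.
have h1 := H U UU FU.
have h2 : U (~` E) by apply: GU; rewrite /G /within /=; apply: nearW.
by have [x [? ?]] := @filter_ex _ U _ _ (filterI h1 h2).
Qed.

Lemma ultra_cvg (T : Type) (V : topologicalType) (F : set_system T) (f : T -> V) (l : V) :
  Filter F ->
  (forall U, UltraFilter U -> F `<=` U -> f @ U --> l) -> f @ F --> l.
Proof.
move=> FF H B lB; apply: (@ultra_near _ F (f @^-1` B)) => U UU FU.
exact: (H U UU FU).
Qed.

(** The supremum of the initial part on which P holds belongs to it and cannot be
    smaller than 1. *)
Lemma locally_constant_segment (P : R -> Prop) :
  (forall s, 0 <= s <= 1 -> exists2 d, 0 < d &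
     forall s', 0 <= s' <= 1 -> `|s' - s| < d -> (P s <-> P s')) ->
  P 0 -> P 1.
Proof.
move=> loc P0; pose E := [set s : R | 0 <= s <= 1 /\ forall s', 0 <= s' <= s -> P s'].
have E0 : E 0.
  split; first by rewrite lexx ler01.
  by move=> s' /andP[h1 h2]; have -> : s' = 0 by apply/eqP; rewrite eq_le h1 h2.
have ubE : ubound E 1 by move=> s [/andP[]].
have hsE : has_sup E by split; [exists 0 | exists 1].
set m := sup E.
have m0 : 0 <= m by apply: ub_le_sup E0; exists 1.
have m1 : m <= 1 by apply: ge_sup => //; exists 0.
have m01 : 0 <= m <= 1 by rewrite m0 m1.
have [d d0 hd] := loc m m01.
have below_m s' : 0 <= s' < m -> P s'.
  move=> /andP[s'0 s'm]; have [s [sE1 sE2] ss'] := sup_gt (ex_intro _ 0 E0) s'm.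
  by apply: sE2; rewrite s'0 ltW.
have Pm : P m.
  have [s [/andP[s0 s1] sE2] ms] := sup_adherent d0 hsE.
  apply/(hd s); first by rewrite s0 s1.
    have sm : s <= m by apply: ub_le_sup; [exists 1 | split=> //; rewrite s0 s1].
    by rewrite -/m in ms; rewrite ler0_norm ?subr_le0 //; lra.
  by apply: sE2; rewrite s0 lexx.
have [m1E|mlt] : m = 1 \/ m < 1 by move: m1; rewrite le_eqVlt => /orP[/eqP|]; [left|right].
  by rewrite m1E in Pm.
pose s1 := Num.min (m + d / 2) 1.
have s1m : m < s1 by rewrite lt_min mlt andbT ltrDl divr_gt0.
have s1d : s1 <= m + d / 2 by rewrite ge_min lexx.
have s11 : s1 <= 1 by rewrite ge_min lexx orbT.
have E1 : E s1.
  split; first by rewrite s11 (le_trans m0 (ltW s1m)).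
  move=> s' /andP[s'0 s's1]; have [lt|ge] := ltP s' m; first by apply: below_m; rewrite s'0 lt.
  apply/(hd s') => //; first by rewrite s'0 (le_trans s's1).
  by rewrite ger0_norm ?subr_ge0 //; lra.
have : s1 <= m by apply: ub_le_sup E1; exists 1.
by rewrite leNgt s1m.
Qed.

Definition on_segment (z z' : 'rV[C]_N) (s : R) : 'rV[C]_N :=
  z + (s%:C%C : C) *: (z' - z).

Lemma norm_lt_cplx (x : C) : exists r : R, `|x| <= (r%:C%C : C).
Proof. by rewrite normc_def; eexists. Qed.

Lemma on_segment_near (z z' : 'rV[C]_N) s (W : set 'rV[C]_N) :
  nbhs (on_segment z z' s) W ->
  exists2 d, 0 < d & forall s', `|s' - s| < d -> W (on_segment z z' s').
Proof.
move=> /nbhs_ballP[e /= /pos_cplxP[r r0 ->] eW].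
have [k hk] := norm_lt_cplx `|z' - z|.
have k0 : 0 <= k.
  by have := le_trans (normr_ge0 _) hk; rewrite ler0c.
exists (r / (k + 1)); first by rewrite divr_gt0 // ltr_wpDl.
move=> s' hs; apply: eW; rewrite -ball_normE /=.
have -> : on_segment z z' s - on_segment z z' s' = (((s - s')%:C)%C : C) *: (z' - z).
  by rewrite /on_segment rmorphB scalerBl opprD addrACA subrr add0r.
rewrite normrZ.
have -> : `|((s - s')%:C)%C : C| = (`|s - s'|%:C)%C by rewrite normc_def /= expr0n addr0 sqrtr_sqr.
rewrite normr_id in hk.
apply: le_lt_trans (ler_wpM2l _ hk) _; first by rewrite lecR.
rewrite -rmorphM /= ltcR distrC.
apply: le_lt_trans (_ : `|s' - s| * (k + 1) < r).
  by rewrite ler_wpM2l // lerDl.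
by rewrite -ltr_pdivlMr // ltr_wpDl.
Qed.

End ZoneTools.

(** * Connectedness of the zone *)
Section ZoneConnected.
Variables (R : realType) (N : nat).
Notation C := (Cplx R).
Notation AZ := (@asymptotic_zone R N).
Implicit Types z w : 'rV[C]_N.

Definition scale_from (j : nat) (c : C) z : 'rV[C]_N :=
  \row_l (if (j <= l)%N then c * z 0 l else z 0 l).

(** Multiplying the coordinates from the j-th on changes only the ratio of the
    coordinates j and j - 1. *)
Lemma scale_zone (M : C) (j : nat) (c : C) z : zone M z -> c != 0 ->
  (forall i l : 'I_N, j = i.+1 -> l = j :> nat -> M < `|c * (z 0 l / z 0 i)|) ->
  zone M (scale_from j c z).
Proof.
move=> [z0 zM] c0 H; split=> [l|i l li].
  by rewrite mxE; case: ifP => _ //; rewrite mulf_neq0.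
rewrite !mxE li; have [ji|ij] := leqP j i.
  rewrite (leqW ji); have -> : c * z 0 l / (c * z 0 i) = z 0 l / z 0 i by field; rewrite c0 z0.
  exact: zM.
have [ji|ij'] := leqP j i.+1; last exact: zM.
rewrite -mulrA; apply: H; last by rewrite li; apply/eqP; rewrite eqn_leq ij ji.
by apply/eqP; rewrite eqn_leq ij ji.
Qed.

(** In the closed half plane Re q >= 0 the segment from 1 to q keeps away from 0;
    the factor 1/2 is the cost in the bound of the zone. *)
Lemma segment_norm (q : R[i]) (s : R) : 0 <= complex.Re q -> 0 <= s <= 1 ->
  2^-1 <= `|(1 - s)%:C%C + s%:C%C * q| \/ `|q| / 2 <= `|(1 - s)%:C%C + s%:C%C * q|.
Proof.
case: q => a b /= a0 /andP[s0 s1].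
have -> : ((1 - s)%:C%C + s%:C%C * (a +i* b)%C) = ((1 - s + s * a) +i* (s * b))%C.
  by rewrite /=; apply/eqP; rewrite eq_complex /=; apply/andP; split; apply/eqP; ring.
rewrite !normc_def /=.
have h2 : (2^-1 : R[i]) = (2^-1 : R)%:C%C by rewrite fmorphV rmorph_nat.
have [q1|q1] := leP 1 (a ^+ 2 + b ^+ 2); [left | right].
  rewrite h2 lecR -[leLHS]ger0_norm ?invr_ge0 // -sqrtr_sqr ler_sqrt ?addr_ge0 ?sqr_ge0 //.
  have k1 : 0 <= s * a * (1 - s) by rewrite !mulr_ge0 // subr_ge0.
  have k2 : 0 <= s ^+ 2 * (a ^+ 2 + b ^+ 2 - 1) by rewrite mulr_ge0 ?sqr_ge0 ?subr_ge0.
  have k3 : 0 <= (2 * s - 1) ^+ 2 by apply: sqr_ge0.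
  lra.
rewrite h2 -rmorphM lecR -[leLHS]ger0_norm ?mulr_ge0 ?sqrtr_ge0 ?invr_ge0 // -sqrtr_sqr.
rewrite ler_sqrt ?addr_ge0 ?sqr_ge0 // exprMn sqr_sqrtr ?addr_ge0 ?sqr_ge0 //.
set m := a ^+ 2 + b ^+ 2 in q1 *.
have m0 : 0 <= m by rewrite addr_ge0 ?sqr_ge0.
have k1 : 0 <= s * a * (1 - s) by rewrite !mulr_ge0 // subr_ge0.
have k2 : 0 <= (1 - s) ^+ 2 * (1 - m) by rewrite mulr_ge0 ?sqr_ge0 ?subr_ge0 ?ltW.
have k3 : 0 <= m * (2 * s - 1) ^+ 2 by rewrite mulr_ge0 ?sqr_ge0.
have -> : (1 - s + s * a) ^+ 2 + (s * b) ^+ 2 = (1 - s) ^+ 2 + 2 * (s * a * (1 - s)) + s ^+ 2 * m.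
  by rewrite /m; ring.
lra.
Qed.

Variables (M : C) (A : set 'rV[C]_N).
Hypothesis M0 : 0 < M.
Hypothesis Aseg : forall z z', (forall s, 0 <= s <= 1 -> zone M (on_segment z z' s)) ->
  A z -> A z'.

Let M2 : M <= 2 * M. Proof. by apply: ler_peMl; [exact: ltW | rewrite ler1n]. Qed.

Lemma scale_half (j : nat) (q : C) z : zone (2 * M) z -> q != 0 -> 0 <= complex.Re (q : R[i]) ->
  (forall i l : 'I_N, j = i.+1 -> l = j :> nat -> 2 * M < `|q * (z 0 l / z 0 i)|) ->
  A z -> A (scale_from j q z).
Proof.
move=> zM q0 Rq H; apply: Aseg => s s01.
pose c : C := (1 - s)%:C%C + s%:C%C * q.
have -> : on_segment z (scale_from j q z) s = scale_from j c z.
  apply/rowP=> l; rewrite !mxE /c; case: ifP => _; last by rewrite subrr mulr0 addr0.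
  by rewrite rmorphB rmorph1; ring.
have cb := segment_norm Rq s01; rewrite -/c in cb.
have c0 : c != 0.
  rewrite -normr_gt0; case: cb => cb; apply: lt_le_trans cb; first by rewrite invr_gt0 ltr0n.
  by rewrite divr_gt0 ?ltr0n // normr_gt0.
apply: scale_zone c0 _; first exact: zone_le zM.
move=> i l ji lj; have h1 := H i l ji lj.
have h2 : 2 * M < `|z 0 l / z 0 i| by apply: (zM.2); rewrite lj ji.
have r0 : 0 <= `|z 0 l / z 0 i| by apply: normr_ge0.
rewrite normrM; case: cb => cb; apply: lt_le_trans (ler_wpM2r r0 cb).
  by rewrite mulrC ltr_pdivlMr ?ltr0n // mulrC.
by rewrite mulrAC -normrM ltr_pdivlMr ?ltr0n // mulrC.
Qed.

Lemma scale_comp j (c d : C) z : scale_from j c (scale_from j d z) = scale_from j (c * d) z.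
Proof. by apply/rowP=> l; rewrite !mxE; case: (j <= l)%N; rewrite ?mulrA. Qed.

(** A factor q with Re q < 0 is reached along 1, - q, i (- q), q, each of which is in
    the closed right half plane relative to the one before. *)
Lemma scale_step_zone (j : nat) (q : C) z : zone (2 * M) z -> q != 0 ->
  (forall i l : 'I_N, j = i.+1 -> l = j :> nat -> 2 * M < `|q * (z 0 l / z 0 i)|) ->
  A z -> A (scale_from j q z).
Proof.
move=> zM q0 H Az.
have [Rq|Rq] := leP 0 (complex.Re (q : R[i])); first exact: scale_half.
pose I : C := (0 +i* 1)%C.
have I0 : I != 0 by rewrite eq_complex /= oner_eq0 andbF.
have nI : `|I| = 1 by rewrite normc_def /= expr0n add0r expr1n sqrtr1.
have II : I * I = -1 by apply/eqP; rewrite eq_complex /= !mulr0 !mul0r mulr1 sub0r addr0 oppr0 !eqxx.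
have -> : scale_from j q z = scale_from j I (scale_from j I (scale_from j (- q) z)).
  by rewrite !scale_comp II mulrN mulN1r opprK.
have ratio c w (i l : 'I_N) : c != 0 -> j = i.+1 -> l = j :> nat ->
   scale_from j c w 0 l / scale_from j c w 0 i = c * (w 0 l / w 0 i).
  by move=> c0 ji lj; rewrite !mxE lj leqnn ji ltnn mulrA.
have zone_q : zone (2 * M) (scale_from j (- q) z).
  by apply: scale_zone => //; [rewrite oppr_eq0 | move=> i l ji lj; rewrite mulNr normrN; apply: H].
have HI w c : c != 0 -> `|c| = `|q| -> forall i l : 'I_N, j = i.+1 -> l = j :> nat ->
    2 * M < `|I * (scale_from j c z 0 l / scale_from j c z 0 i)|.
  by move=> c0 cq i l ji lj; rewrite ratio // normrM nI mul1r normrM cq -normrM; apply: H.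
have nq0 : - q != 0 by rewrite oppr_eq0.
have zone_iq : zone (2 * M) (scale_from j I (scale_from j (- q) z)).
  by apply: scale_zone => //; apply: HI => //; rewrite normrN.
apply: scale_half => //.
  by rewrite scale_comp; apply: HI; rewrite ?mulf_neq0 // normrM nI mul1r normrN.
apply: scale_half => //; first by apply: HI => //; rewrite normrN.
apply: scale_half => //.
  by case: (q) Rq => a b /=; lra.
by move=> i l ji lj; rewrite mulNr normrN; apply: H.
Qed.

(** The coordinates are brought to their final values one after the other, from
    the smallest on; each move multiplies all later coordinates by the same
    factor, so only one ratio changes. *)
Lemma zone_connected z z' : zone (2 * M) z -> zone (2 * M) z' -> A z -> A z'.
Proof.
move=> zM zM' Az.
have : forall j, (j <= N)%N -> exists w, [/\ zone (2 * M) w, A w &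
    forall l : 'I_N, (l < j)%N -> w 0 l = z' 0 l].
  elim=> [|j IH] jN; first by exists z.
  have [w [wM Aw wE]] := IH (ltnW jN).
  pose jo := Ordinal jN; pose q := z' 0 jo / w 0 jo.
  have [w0 _] := wM; have [z'0 zM'2] := zM'.
  have q0 : q != 0 by rewrite mulf_neq0 ?invr_eq0.
  have H (i l : 'I_N) : j = i.+1 -> l = j :> nat -> 2 * M < `|q * (w 0 l / w 0 i)|.
    move=> ji lj; have -> : l = jo by apply: val_inj.
    by rewrite mulrA divfK // wE; [apply: zM'2 | rewrite ji].
  exists (scale_from j q w); split; [exact: scale_zone | exact: scale_step_zone |].
  move=> l; rewrite ltnS leq_eqVlt mxE => /orP[/eqP lj|lj].
    by rewrite lj leqnn (_ : l = jo) ?divfK //; apply: val_inj.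
  by rewrite leqNgt lj wE.
move=> /(_ N (leqnn N)) [w [_ Aw wE]].
by rewrite (_ : z' = w) //; apply/rowP=> l; rewrite wE.
Qed.

End ZoneConnected.

Section ConstantIndex.
Variables (R : realType) (N : nat).
Notation C := (Cplx R).
Notation AZ := (@asymptotic_zone R N).

Lemma zone_class_unique (b M x : C) (z : 'rV[C]_N) (i j : 'I_N) : 0 < b -> 1 <= M -> 2 / b <= M ->
  zone M z -> b < `|x / z 0 i| < 2 -> b < `|x / z 0 j| < 2 -> i = j.
Proof.
move=> b0 M1 Mb zM.
have key (k l : 'I_N) : (k < l)%N -> `|x / z 0 k| < 2 -> b < `|x / z 0 l| -> False.
  move=> kl h1 h2; have := zone_ratio M1 zM kl.
  have [z0 _] := zM; have x0 : x != 0.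
    by apply/eqP => x0; have := lt_trans b0 h2; rewrite x0 mul0r normr0 ltxx.
  have -> : z 0 l / z 0 k = (x / z 0 k) / (x / z 0 l) by field; rewrite x0 !z0.
  rewrite normrM normfV => lt.
  have : M < 2 / b.
    apply: lt_trans lt _; apply: ltr_pM => //.
    by rewrite ltf_pV2 // posrE // (lt_trans b0).
  by move=> lt'; have := lt_le_trans lt' Mb; rewrite ltxx.
move=> /andP[hi1 hi2] /andP[hj1 hj2]; apply: val_inj => /=.
by case: (ltngtP i j) => // lt; [case: (key _ _ lt hi2 hj1) | case: (key _ _ lt hj2 hi1)].
Qed.

Lemma cvg_norm_between (T : Type) (F : set_system T) (FF : Filter F) (f : T -> C) (b c a : C) :
  f @ F --> a -> b < `|a| < c -> F [set z | b < `|f z| < c].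
Proof.
move=> fa /andP[h1 h2]; near=> x; apply/andP; split; near: x.
  exact: cvgr_norm_gt fa _ h1.
exact: cvgr_norm_lt fa _ h2.
Unshelve. all: by end_near. Qed.

Lemma class_open (f : 'rV[C]_N -> C) (b : C) (w : 'rV[C]_N) l :
  {for w, continuous f} -> w 0 l != 0 -> b < `|f w / w 0 l| < 2 ->
  nbhs w [set v : 'rV[C]_N | b < `|f v / v 0 l| < 2].
Proof.
move=> fw wl0 hb.
have hc : (fun v : 'rV[C]_N => (v 0 l)^-1) @ w --> (w 0 l)^-1.
  have hw : (fun v : 'rV[C]_N => v 0 l) @ w --> w 0 l by exact: (@coord_continuous C 1 N 0 l).
  exact: (cvgV wl0 hw).
have hq : (fun v : 'rV[C]_N => f v / v 0 l) @ w --> f w / w 0 l by exact: cvgM fw hc.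
exact: (cvg_norm_between (nbhs_filter w) hq hb).
Qed.

(** The regions b < |f / z_j| < 2 with different j are disjoint in a zone with
    large ratios, and they are open; the zone being connected, a continuous f that
    is everywhere in one of them stays in the same one. *)
Lemma constant_index (f : 'rV[C]_N -> C) (b : C) : 0 < b ->
  (\forall z \near AZ, {for z, continuous f}) ->
  (\forall z \near AZ, exists j : 'I_N, b < `|f z / (z : 'rV[C]_N) 0 j| < 2) ->
  exists j : 'I_N, \forall z \near AZ, b < `|f z / (z : 'rV[C]_N) 0 j| < 2.
Proof.
move=> b0 fc fj; have [M1 /= M10 HM1] := filterI fc fj.
(* M exceeds the bound M1 from the hypotheses and the ratio 2 / b of the radii, which
   makes the regions disjoint. *)
have [M [M0 M1M M_1 Mb]] : exists M : C, [/\ 0 < M, M1 <= M, 1 <= M & 2 / b <= M].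
  have b20 : 0 < 2 / b :> C by rewrite divr_gt0 ?ltr0n.
  exists (M1 + 1 + 2 / b); split; first by rewrite !addr_gt0.
  - by rewrite -addrA lerDl addr_ge0 ?ltW.
  - by rewrite -addrA addrCA lerDl addr_ge0 ?ltW.
  - by rewrite lerDr addr_ge0 ?ltW.
have M20 : 0 < 2 * M by rewrite mulr_gt0 ?ltr0n.
have M2 : M <= 2 * M by apply: ler_peMl; [exact: ltW | rewrite ler1n].
have HM z : zone M z -> {for z, continuous f} /\ exists j : 'I_N, b < `|f z / z 0 j| < 2.
  by move=> /(zone_le M1M) /HM1.
have [z0 z0M] := @zone_nonempty R N _ M20.
have [_ [j hj]] := HM _ (zone_le M2 z0M).
exists j; exists (2 * M) => // z zM.
pose A := [set w : 'rV[C]_N | b < `|f w / w 0 j| < 2].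
apply: (@zone_connected R N M A M0 _ z0 z) => // z1 z2 seg.
rewrite /A /= => A1.
have e0 : on_segment z1 z2 0 = z1 by rewrite /on_segment scale0r addr0.
have e1 : on_segment z1 z2 1 = z2.
  by rewrite /on_segment (_ : (1%:C)%C = 1 :> C) // scale1r addrC subrK.
rewrite -e1; rewrite -e0 in A1.
apply: (@locally_constant_segment R (fun s => A (on_segment z1 z2 s))) A1 => s s01.
have wM : zone M (on_segment z1 z2 s) by apply: seg.
have [fw [i hi]] := HM _ wM.
have [d d0 Hd] := on_segment_near (class_open fw (wM.1 i) hi).
exists d; first exact: d0.
move=> s' s'01 dist_s.
have hs' := Hd s' dist_s; rewrite /= in hs'.
have w'M : zone M (on_segment z1 z2 s') := seg s' s'01.
move: (on_segment z1 z2 s) (on_segment z1 z2 s') wM hi hs' w'M => w w' wM hi hs' w'M.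
split=> hA.
  by rewrite /A /= (zone_class_unique b0 M_1 Mb wM hA hi).
by rewrite /A /= (zone_class_unique b0 M_1 Mb w'M hA hs').
Qed.

End ConstantIndex.

(** * Every critical family belongs to a tableau *)
Section BetaBounds.
Variables (F : numFieldType) (rho : nat -> nat) (N : nat) (lam : seq nat).
Hypothesis W : lattice_word rho N lam.

Lemma half_le_ratio (m : nat) : (0 < m)%N -> (2^-1 : F) <= m%:R / (m%:R + 1) < (1 : F).
Proof.
move=> m0; have p : 0 < m%:R + 1 :> F by rewrite natr1 ltr0n.
rewrite ler_pdivlMr // ltr_pdivrMr // mul1r ltrDl ltr01 andbT.
rewrite ler_pdivrMl ?ltr0n // natr1 -natrM ler_nat; lia.
Qed.

Lemma beta_lower (i j : nat) : (j < N)%N -> (i <= rho j)%N -> (2^-1 : F) ^+ i <= beta_of F rho i j.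
Proof.
move=> jN ij; have -> : (2^-1 : F) ^+ i = \prod_(r < i) 2^-1 by rewrite prodr_const card_ord.
apply: ler_prod => r _.
have rj : (r < rho j)%N by apply: leq_trans ij.
by have /andP[-> _] := half_le_ratio (gap_gt0 W jN rj); rewrite invr_ge0 ler0n.
Qed.

Lemma beta_gt0 (i j : nat) : (j < N)%N -> (i <= rho j)%N -> 0 < beta_of F rho i j.
Proof. by move=> jN ij; apply: lt_le_trans (beta_lower jN ij); rewrite exprn_gt0 // invr_gt0 ltr0n. Qed.

Lemma beta_upper (i j : nat) : (j < N)%N -> (0 < i <= rho j)%N -> beta_of F rho i j < 1.
Proof.
move=> jN /andP[]; case: i => // i _ ij; rewrite /beta_of big_ord_recr /=.
have /andP[_ lt] := half_le_ratio (gap_gt0 W jN ij).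
have r0 (m : nat) : 0 <= m%:R / (m%:R + 1) :> F by rewrite divr_ge0 ?addr_ge0 ?ler0n.
apply: le_lt_trans lt; apply: ler_piMl; first exact: r0.
apply: prodr_ile1 => r _; have rj : (r < rho j)%N by apply: ltn_trans (ltn_ord r) ij.
have /andP[_ lt] := half_le_ratio (gap_gt0 W jN rj).
by rewrite (ltW lt) r0.
Qed.

Lemma ratr_beta i j : ratr (beta_of rat rho i j) = beta_of F rho i j.
Proof.
rewrite /beta_of rmorph_prod; apply: eq_bigr => r _.
by rewrite fmorph_div rmorphD rmorph1 rmorph_nat.
Qed.

End BetaBounds.

Lemma beta_of_ext (F : fieldType) (rho rho' : nat -> nat) N i j : (j < N)%N ->
  (forall l, (l < N)%N -> rho l = rho' l) -> beta_of F rho i j = beta_of F rho' i j.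
Proof.
move=> jN e; have cE r : cnt rho j r = cnt rho' j r.
  by apply: eq_bigr => l _; rewrite e // (ltn_trans (ltn_ord l)).
by apply: eq_bigr => r _; rewrite /gap !e // !cE.
Qed.

(** An injective choice between sets of the same cardinality is a bijection. *)
Lemma finite_inverse (A J : finType) (P : pred J) (rel : J -> A -> Prop) :
  (forall j, P j -> exists a, rel j a) ->
  (forall j j' a, P j -> P j' -> rel j a -> rel j' a -> j = j') ->
  #|P| = #|A| ->
  exists g : A -> J, [/\ injective g, forall j, (exists a, g a = j) <-> P j & forall a, rel (g a) a].
Proof.
move=> ex uq card.
have /fin_all_exists[f fP] : forall j : {j | P j}, exists a, rel (val j) a.
  by move=> [j Pj]; apply: ex.
have finj : injective f.
  move=> [j Pj] [j' Pj'] e; apply: val_inj => /=.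
  by apply: uq (fP (exist _ j Pj)) _ => //; rewrite e; apply: (fP (exist _ j' Pj')).
have [h hf fh] : bijective f by apply: inj_card_bij => //; rewrite card_sig -card.
exists (val \o h); split.
- by move=> a b /= /val_inj e; rewrite -(fh a) e fh.
- move=> j; split=> [[a <-]|Pj]; first exact: valP.
  by exists (f (exist _ j Pj)); rewrite /= hf.
by move=> a; have := fP (h a); rewrite fh.
Qed.

Section Asymptotics.
Variables (R : realType) (N : nat) (lam : seq nat).
Hypothesis hlam : is_partition_of N lam.
Notation C := (Cplx R).
Notation AZ := (@asymptotic_zone R N).
Implicit Types (t : 'rV[C]_N -> tvars R lam).

Lemma littleo_of_cvg (f g : 'rV[C]_N -> C) (c : C) :
  (fun z => f z / g z) @ AZ --> c -> (\forall z \near AZ, g z != 0) ->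
  (fun z => f z - c * g z) =o_AZ g.
Proof.
move=> /cvgrPdist_lt h g0; apply/eqoP => e e0; near=> z.
have gz : g z != 0 by near: z.
have -> : f z - c * g z = (f z / g z - c) * g z by rewrite mulrBl divfK.
rewrite normrM ler_pM2r ?normr_gt0 // distrC ltW //.
by near: z; apply: h.
Unshelve. all: by end_near. Qed.

(** The classes of the t_i^(a) modulo an ultrafilter solve the critical equations in
    the ultrapower, where place_tableau applies. *)
Lemma ultra_word t (U : set_system 'rV[C]_N) : UltraFilter U -> AZ `<=` U ->
  critical_family t ->
  exists2 rho : nat -> nat, lattice_word rho N lam &
  forall (j : 'I_N) i, (0 < i <= rho j)%N -> exists a : 'I_(below lam i),
    (fun z => t z i a / z 0 j) @ U --> beta_of C rho i j.
Proof.
move=> UU AZU crit.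
pose tK i (a : 'I_(below lam i)) : upower C UU := ucl UU (fun z => t z i a).
pose zK (j : 'I_N) : upower C UU := ucl UU (fun z => z 0 j).
have nd : U [set z | critical_point (t z) z] by apply: AZU; apply: filterS crit => z [].
have ne (f g : 'rV[C]_N -> C) : U [set z | f z != g z] -> ucl UU f != ucl UU g.
  move=> h; apply/eqP => /ucl_eq h'.
  by have [z [/= /eqP h1 h2]] := @filter_ex _ U _ _ (filterI h h').
have levelP i x : x \in level tK zK i -> exists f : 'rV[C]_N -> C, x = ucl UU f /\
    ((i = 0%N /\ exists k : 'I_N, f = fun z => z 0 k) \/
     ((0 < i)%N /\ exists a : 'I_(below lam i), f = fun z => t z i a)).
  case: i => [|i] /mapP[a _ ->]; eexists; split; try reflexivity; [left | right].
    by split=> //; exists a.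
  by split=> //; exists a.
have [|||||||rho W hrho] := @place_tableau _ _ _ (ulim_place R UU) _ N lam tK zK hlam.
- by move=> m; rewrite pnatr_eq0.
- move=> j; rewrite -ucl0; apply: ne; apply: AZU; exact: near_coord_neq0.
- move=> i j; apply: contra_eq => ij; apply: ne; apply: filterS nd => z [[h _ _ _] _].
  exact: h.
- move=> i j ij.
  have -> : zK i / zK j = ucl UU (fun z => z 0 i / z 0 j) by rewrite uclM uclV.
  apply/ulimE.
  apply: cvg_trans (zone_ratio_cvg (i := i) (j := j) _); last by rewrite ij.
  by apply: cvg_app; exact: AZU.
- move=> i i0 a b; apply: contra_eq => ab; apply: ne; apply: filterS nd => z [[_ _ h _] _].
  exact: h.
- move=> i x /levelP[f [-> H1]]; apply/negP => /levelP[g [/eqP + H2]].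
  apply/negP; apply: ne; apply: filterS nd => z [[_ n2 _ n4] _].
  case: H2 => [[//]|[_ [b ->]]].
  case: H1 => [[i0 [k ->]]|[i0 [a ->]]]; last exact: n4.
  by move: b; rewrite i0 => b; apply: n2.
- move=> i a i0.
  have sumE l : \sum_(w <- level tK zK l) (tK i a - w)^-1 =
      ucl UU (fun z => \sum_(w <- level (t z) (fun j => z 0 j) l) (t z i a - w)^-1).
    case: l => [|l]; rewrite big_image /=.
      rewrite (_ : (fun z => _) = fun z => \sum_(k < N) (t z i a - z 0 k)^-1).
        by rewrite ucl_sum; apply: eq_bigr => k _; rewrite uclV uclD uclN.
      by apply/funext => z; rewrite big_image.
    rewrite (_ : (fun z => _) = fun z => \sum_(k < below lam l.+1) (t z i a - t z l.+1 k)^-1).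
      by rewrite ucl_sum; apply: eq_bigr => k _; rewrite uclV uclD uclN.
    by apply/funext => z; rewrite big_image.
  rewrite !sumE // -uclD.
  have -> : \sum_(b < below lam i | b != a) 2 / (tK i a - tK i b) =
     ucl UU (fun z => \sum_(b < below lam i | b != a) 2 / (t z i a - t z i b)).
    rewrite ucl_sum; apply: eq_bigr => b _.
    by rewrite uclM ucl_nat uclV uclD uclN.
  apply/ucl_eq; apply: filterS nd => z [nz /(_ i a i0)].
  rewrite dmaster_dtE // => /eqP; rewrite subr_eq0 subr_eq => /eqP ->.
  by rewrite addrC.
exists rho => // j i ij; have [a] := hrho j i ij.
have -> : tK i a / zK j = ucl UU (fun z => t z i a / z 0 j) by rewrite uclM uclV.
by move=> /ulimE h; exists a.
Qed.

(** Two different scales cannot carry the same variable, so the variables found for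
    the various j are distinct, and there are as many j as variables. *)
Lemma ultra_indexing t (U : set_system 'rV[C]_N) : UltraFilter U -> AZ `<=` U ->
  critical_family t ->
  exists2 rho : nat -> nat, lattice_word rho N lam &
  exists idx : forall i : nat, 'I_(below lam i) -> 'I_N, forall i, (0 < i)%N ->
    [/\ injective (idx i), forall j, (exists a, idx i a = j) <-> (i <= rho j)%N &
        forall a, (fun z => t z i a / z 0 (idx i a)) @ U --> beta_of C rho i (idx i a)].
Proof.
move=> UU AZU crit; have [rho W hrho] := ultra_word UU AZU crit; exists rho => //.
suff /(_ _)/cid h : forall i, exists g : 'I_(below lam i) -> 'I_N, (0 < i)%N ->
    [/\ injective g, forall j, (exists a, g a = j) <-> (i <= rho j)%N &
        forall a, (fun z => t z i a / z 0 (g a)) @ U --> beta_of C rho i (g a)].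
  by exists (fun i => sval (h i)) => i i0; have := svalP (h i) i0.
case=> [|i].
  by exists (fun a => cast_ord (below0 hlam) a).
pose P := [pred j : 'I_N | (i.+1 <= rho j)%N].
have [|||g [g1 g2 g3]] := @finite_inverse 'I_(below lam i.+1) 'I_N P
  (fun j a => (fun z => t z i.+1 a / z 0 j) @ U --> beta_of C rho i.+1 j).
- by move=> j Pj; apply: hrho.
- move=> j j' a Pj Pj' h h'.
  wlog lt : j j' Pj Pj' h h' / (j < j')%N => [wl|].
    by case: (ltngtP j j') => [lt|lt|/val_inj //]; [apply: wl | apply/esym; apply: wl].
  have b0 := gt_eqF (beta_gt0 C W (ltn_ord j) Pj).
  have b0' := gt_eqF (beta_gt0 C W (ltn_ord j') Pj').
  have h3 : (fun z : 'rV[C]_N => z 0 j / z 0 j') @ U --> (0 : C).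
    by apply: cvg_trans (zone_ratio_cvg lt); apply: cvg_app; exact: AZU.
  have h4 : (fun z : 'rV[C]_N => (t z i.+1 a / z 0 j) * (z 0 j / z 0 j')) @ U --> beta_of C rho i.+1 j * 0.
    exact: (cvgM h h3).
  have h5 : (fun z : 'rV[C]_N => (t z i.+1 a / z 0 j) * (z 0 j / z 0 j')) @ U --> beta_of C rho i.+1 j'.
    apply: cvg_trans h'; apply: near_eq_cvg; apply: AZU.
    apply: filterS (near_coord_neq0 R j) => z z0.
    by rewrite mulrA divfK.
  have e : beta_of C rho i.+1 j * 0 = beta_of C rho i.+1 j'.
    exact: (cvg_unique (@norm_hausdorff _ C) h4 h5).
  by rewrite -e mulr0 eqxx in b0'.
- rewrite card_ord -(cnt_below W i.+1) -sum1_card big_mkcond.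
  by apply: eq_bigr => j _; rewrite inE; case: (i < rho j)%N.
by exists g => _; split.
Qed.

(** The scale of each variable is the same in the whole zone, by connectedness;
    hence the indexing and the word are the same for all ultrafilters finer than
    the zone, and limits along all of them are limits along the zone. The bound b is
    smaller than every coefficient beta. *)
Theorem completeness t : critical_family t ->
  exists2 rho : nat -> nat, lattice_word rho N lam &
  exists idx : forall i : nat, 'I_(below lam i) -> 'I_N, forall i, (0 < i)%N ->
    [/\ injective (idx i), forall j, (exists a, idx i a = j) <-> (i <= rho j)%N &
        forall a, (fun z => t z i a / z 0 (idx i a)) @ AZ --> beta_of C rho i (idx i a)].
Proof.
move=> crit; pose b : C := (2^-1) ^+ (size lam).+1.
have b0 : 0 < b by rewrite exprn_gt0 // invr_gt0 ltr0n.
have near_class (U : set_system 'rV[C]_N) (UU : UltraFilter U) (AZU : AZ `<=` U) rho i (j : 'I_N) (f : 'rV[C]_N -> C) :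
    lattice_word rho N lam -> (0 < i <= rho j)%N ->
    (fun z => f z / z 0 j) @ U --> beta_of C rho i j ->
    U [set z | b < `|f z / z 0 j| < 2].
  move=> W ij h; have /andP[i0 irho] := ij.
  have hb : b < beta_of C rho i j.
    apply: lt_le_trans (beta_lower C W (ltn_ord j) irho).
    rewrite /b ltr_iXn2l ?invr_gt0 ?ltr0n // ?invf_lt1 ?ltr0n ?ltr1n //.
    by apply: leq_trans (word_row_lt W (ltn_ord j)); apply: leq_trans irho _.
  have hb2 : beta_of C rho i j < 2 by apply: lt_trans (beta_upper C W (ltn_ord j) ij) _; rewrite ltr1n.
  apply: cvg_norm_between h _.
  by rewrite (ger0_norm (ltW (lt_trans b0 hb))) hb hb2.
have cls i (a : 'I_(below lam i)) : (0 < i)%N -> exists j : 'I_N,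
    \forall z \near AZ, b < `|t z i a / (z : 'rV[C]_N) 0 j| < 2.
  move=> i0; apply: constant_index => //.
    by apply: filterS crit => z [_ /(_ i a i0)]; apply: differentiable_continuous.
  apply: ultra_near => U UU AZU.
  have [rho W [idx /(_ i i0)[_ h1 h2]]] := ultra_indexing UU AZU crit.
  have h : (0 < i <= rho (idx i a))%N by rewrite i0; apply/h1; exists a.
  by apply: filterS (near_class U UU AZU rho i (idx i a) _ W h (h2 a)) => z hz; exists (idx i a).
have [idx hidx] : exists idx : forall i : nat, 'I_(below lam i) -> 'I_N, forall i a, (0 < i)%N ->
    \forall z \near AZ, b < `|t z i a / (z : 'rV[C]_N) 0 (idx i a)| < 2.
  suff /(_ _)/cid h : forall i, exists g : 'I_(below lam i) -> 'I_N, forall a, (0 < i)%N ->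
      \forall z \near AZ, b < `|t z i a / (z : 'rV[C]_N) 0 (g a)| < 2.
    by exists (fun i => sval (h i)) => i a i0; apply: (svalP (h i)).
  case=> [|i]; first by exists (fun a => cast_ord (below0 hlam) a).
  have /fin_all_exists[g hg] : forall a : 'I_(below lam i.+1), exists j : 'I_N,
      \forall z \near AZ, b < `|t z i.+1 a / (z : 'rV[C]_N) 0 j| < 2.
    by move=> a; apply: cls.
  by exists g => a _; apply: hg.
have ultra_idx (U : set_system 'rV[C]_N) : UltraFilter U -> AZ `<=` U ->
  exists2 rho : nat -> nat, lattice_word rho N lam & forall i, (0 < i)%N ->
    [/\ injective (idx i), forall j, (exists a, idx i a = j) <-> (i <= rho j)%N &
        forall a, (fun z => t z i a / z 0 (idx i a)) @ U --> beta_of C rho i (idx i a)].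
  move=> UU AZU; have [rho W [idx' hidx']] := ultra_indexing UU AZU crit.
  exists rho; first exact: W.
  move=> i i0; have [h1 h2 h3] := hidx' i i0.
  have eq_idx : idx i = idx' i.
    apply/funext => a.
    have ha : (0 < i <= rho (idx' i a))%N by rewrite i0; apply/h2; exists a.
    have H1 := near_class U UU AZU rho i (idx' i a) _ W ha (h3 a).
    have H2 : U [set z | b < `|t z i a / z 0 (idx i a)| < 2] by apply: AZU; apply: hidx.
    have M0 : 0 < 1 + 2 / b by rewrite addr_gt0 // divr_gt0 ?ltr0n.
    have H3 : U [set z | zone (1 + 2 / b) z] by apply: AZU; apply: near_zone.
    have [z [[/= z1 z2] z3]] := @filter_ex _ U _ _ (filterI (filterI H1 H2) H3).
    apply: (@zone_class_unique R N b (1 + 2 / b) _ z _ _ b0 _ _ z3 z2 z1).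
      by rewrite lerDl ltW // divr_gt0 ?ltr0n.
    by rewrite lerDr ltW.
  by rewrite eq_idx; split; [exact: h1 | exact: h2 | exact: h3].
have [U0 [UU0 AZU0]] := ultraFilterLemma (@asymptotic_zone_proper R N).
have [rho W hrho] := ultra_idx U0 UU0 AZU0.
exists rho; first exact: W.
exists idx => i i0; have [h1 h2 _] := hrho i i0; split; [exact: h1 | exact: h2 |] => a.
apply: ultra_cvg => U UU AZU.
have [rho' W' hrho'] := ultra_idx U UU AZU.
have e l : (l < N)%N -> rho' l = rho l.
  move=> lN; apply/eqP; rewrite eqn_leq; apply/andP; split.
    case E : (rho' l) => [//|m]; have [_ k2 _] := hrho m.+1 (ltn0Sn m).
    have [_ k2' _] := hrho' m.+1 (ltn0Sn m).
    by apply/(k2 (Ordinal lN))/k2'; rewrite /= E.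
  case E : (rho l) => [//|m]; have [_ k2 _] := hrho m.+1 (ltn0Sn m).
  have [_ k2' _] := hrho' m.+1 (ltn0Sn m).
  by apply/(k2' (Ordinal lN))/k2; rewrite /= E.
have [_ _ h3] := hrho' i i0.
rewrite -(beta_of_ext C i (ltn_ord (idx i a)) e); exact: h3.
Qed.

End Asymptotics.

(** * The derivatives in z *)
Lemma sum_indexing (F : nmodType) (A J : finType) (g : A -> J) (P : pred J) (phi : J -> F) :
  injective g -> (forall j, (exists a, g a = j) <-> P j) ->
  \sum_a phi (g a) = \sum_(j | P j) phi j.
Proof.
move=> gi gP; rewrite -[LHS]big_image /=.
rewrite -[RHS]big_filter; apply: perm_big; apply: uniq_perm.
- by rewrite map_inj_uniq ?enum_uniq.
- by rewrite filter_uniq ?index_enum_uniq.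
move=> j; rewrite mem_filter mem_index_enum andbT; apply/mapP/idP => [[a _ ->]|/gP[a <-]].
  by apply/gP; exists a.
by exists a; rewrite ?mem_enum.
Qed.

Section DzAsymptotics.
Variables (R : realType) (N : nat) (lam : seq nat).
Notation C := (Cplx R).
Notation AZ := (@asymptotic_zone R N).

Lemma cvg_sum_fin (T : Type) (F : set_system T) (FF : Filter F) I (r : seq I) (P : pred I)
    (f : I -> T -> C) (c : I -> C) :
  (forall i, P i -> f i @ F --> c i) ->
  (fun z => \sum_(i <- r | P i) f i z) @ F --> \sum_(i <- r | P i) c i.
Proof.
by move=> h; apply: cvg_big => //; exact: add_continuous.
Qed.

(** z_j / (z_j - u) compares u with z_j, and so depends only on which of the scales of
    z_j and u is larger, unless u is itself of the scale of z_j. *)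
Lemma pole_limit (j l : 'I_N) (u : 'rV[C]_N -> C) (b : C) :
  (fun z : 'rV[C]_N => u z / z 0 l) @ AZ --> b -> b != 0 -> (l = j -> b != 1) ->
  (fun z : 'rV[C]_N => z 0 j / (z 0 j - u z)) @ AZ -->
    (if (l < j)%N then 1 else if l == j then (1 - b)^-1 else 0).
Proof.
move=> ub b0 b1.
have near0 i : \forall z \near AZ, (z : 'rV[C]_N) 0 i != 0 by exact: near_coord_neq0.
have [lt|lt|/val_inj e] := ltngtP l j.
- have h : (fun z : 'rV[C]_N => (1 - (u z / z 0 l) * (z 0 l / z 0 j))^-1) @ AZ --> ((1 - b * 0)^-1 : C).
    apply: cvgV; first by rewrite mulr0 subr0 oner_eq0.
    apply: cvgB; first exact: cvg_cst.
    exact: cvgM ub (zone_ratio_cvg lt).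
  rewrite mulr0 subr0 invr1 in h; apply: cvg_trans h; apply: near_eq_cvg.
  near=> z.
  have zj : z 0 j != 0 by near: z; apply: near0.
  have zl : z 0 l != 0 by near: z; apply: near0.
  rewrite mulrA divfK // -[1](divff zj) -mulrBl invf_div //.
- rewrite (_ : (l == j) = false); last by rewrite -val_eqE /= gtn_eqF.
  have h : (fun z : 'rV[C]_N => (z 0 j / z 0 l) / (z 0 j / z 0 l - u z / z 0 l)) @ AZ --> (0 / (0 - b) : C).
    apply: cvgM; first exact: zone_ratio_cvg.
    apply: cvgV; first by rewrite sub0r oppr_eq0.
    exact: cvgB (zone_ratio_cvg lt) ub.
  rewrite mul0r in h; apply: cvg_trans h; apply: near_eq_cvg.
  near=> z.
  have zl : z 0 l != 0 by near: z; apply: near0.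
  by rewrite -mulrBl invf_div mulrA divfK.
- rewrite e eqxx; rewrite e in ub.
  have h : (fun z : 'rV[C]_N => (1 - u z / z 0 j)^-1) @ AZ --> ((1 - b)^-1 : C).
    apply: cvgV; first by rewrite subr_eq0 eq_sym b1.
    exact: (cvgB (cvg_cst _) ub).
  apply: cvg_trans h; apply: near_eq_cvg.
  near=> z.
  have zj : z 0 j != 0 by near: z; apply: near0.
  by rewrite -{1}[1](divff zj) -mulrBl invf_div.
Unshelve. all: by end_near. Qed.

Variables (t : 'rV[C]_N -> tvars R lam) (rho : nat -> nat).
Arguments t : clear implicits.
Hypothesis W : lattice_word rho N lam.
Variable idx : forall i : nat, 'I_(below lam i) -> 'I_N.
Hypothesis idx_inj : forall i, (0 < i)%N -> injective (@idx i).
Hypothesis idx_image : forall i, (0 < i)%N -> forall j, (exists a, @idx i a = j) <-> (i <= rho j)%N.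
Hypothesis t_lim : forall i a, (0 < i)%N ->
  (fun z => t z i a / z 0 (@idx i a)) @ AZ --> beta_of C rho i (@idx i a).
Hypothesis t_nondeg : \forall z \near AZ, nondegenerate (t z) z.

Lemma sum_idx (phi : 'I_N -> C) :
  \sum_(a < below lam 1) phi (@idx 1%N a) = \sum_(l < N) (0 < rho l)%N%:R * phi l.
Proof.
rewrite (sum_indexing phi (@idx_inj 1%N (ltnSn 0)) (@idx_image 1%N (ltnSn 0))) big_mkcond.
by apply: eq_bigr => l _; case: (0 < rho l)%N; rewrite ?mul1r ?mul0r.
Qed.

(** The entries before j in the first row contribute 1 each, the others before j
    cancel against their t_1; the entry j contributes - 1 / (1 - beta_1) =
    - (gap + 1) unless it is in the first row, and the sum is the difference of
    column and row. *)
Lemma dz_limit (j : 'I_N) :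
  (fun z : 'rV[C]_N => dmaster_dz (t z) z j / (z 0 j)^-1) @ AZ -->
  ((cnt rho j (rho j))%:R - (rho j)%:R : C).
Proof.
pose b := beta_of C rho 1 j.
pose phi (l : 'I_N) : C := if (l < j)%N then 1 else if l == j then (1 - b)^-1 else 0.
have h1 : (fun z : 'rV[C]_N => \sum_(l < N | l != j) z 0 j / (z 0 j - z 0 l)) @ AZ -->
    \sum_(l < N | l != j) ((l < j)%N%:R : C).
  apply: cvg_sum_fin => l lj.
  have := @pole_limit j l (fun z : 'rV[C]_N => z 0 l) 1.
  rewrite (negbTE lj) (_ : (if (l < j)%N then 1 else 0) = (l < j)%N%:R :> C); last by case: ifP.
  apply; first 1 last.
  - exact: oner_neq0.
  - by move=> e; rewrite e eqxx in lj.
  apply: cvg_near_cst; apply: filterS (near_coord_neq0 R l) => z zl.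
  by rewrite divff.
have h2 : (fun z : 'rV[C]_N => \sum_(a < below lam 1) z 0 j / (z 0 j - t z 1%N a)) @ AZ -->
    \sum_(a < below lam 1) phi (@idx 1%N a).
  apply: cvg_sum_fin => a _.
  have ra : (0 < 1 <= rho (@idx 1%N a))%N by apply/(idx_image (ltnSn 0)); exists a.
  have E : phi (@idx 1%N a) = if (@idx 1%N a < j)%N then 1 else
      if @idx 1%N a == j then (1 - beta_of C rho 1 (@idx 1%N a))^-1 else 0.
    by rewrite /phi; case: (eqVneq (@idx 1%N a) j) => [->|_]; reflexivity.
  rewrite E; apply: pole_limit; first exact: (@t_lim 1%N a (ltnSn 0)).
    by apply: negbT; apply: gt_eqF; apply: (beta_gt0 C W (ltn_ord _)).
  by move=> _; apply: negbT; apply: lt_eqF; apply: (beta_upper C W (ltn_ord _)).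
have h : (fun z : 'rV[C]_N => \sum_(l < N | l != j) z 0 j / (z 0 j - z 0 l)
     - \sum_(a < below lam 1) z 0 j / (z 0 j - t z 1%N a)) @ AZ -->
    (\sum_(l < N | l != j) (l < j)%N%:R - \sum_(a < below lam 1) phi (@idx 1%N a) : C).
  exact: cvgB h1 h2.
have -> : ((cnt rho j (rho j))%:R - (rho j)%:R : C) =
    \sum_(l < N | l != j) (l < j)%N%:R - \sum_(a < below lam 1) phi (@idx 1%N a).
  rewrite sum_idx [X in _ = _ - X](bigD1 j) //= opprD addrCA -sumrB.
  have -> : \sum_(l < N | l != j) ((l < j)%N%:R - (0 < rho l)%N%:R * phi l) = (cnt rho j 0)%:R :> C.
    rewrite /cnt natr_sum (big_ord_widen N (fun l => (rho l == 0%N)%:R : C)) ?(ltnW (ltn_ord j)) //.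
    rewrite [in RHS]big_mkcond [LHS]big_mkcond; apply: eq_bigr => l _; rewrite /phi.
    case: (eqVneq l j) => [->|ne] /=; first by rewrite ltnn.
    by case: (ltnP l j) => _; case: (rho l) => [|m] /=; rewrite ?mulr1 ?mulr0 ?mul0r ?subr0 ?subrr.
  rewrite /phi ltnn eqxx.
  case E : (rho j) => [|m].   by rewrite mul0r oppr0 add0r addr0.
  have gj : (0 < gap rho j 0)%N by apply: (gap_gt0 W) => //; rewrite E.
  rewrite mul1r /b /beta_of big_ord1.
  have g1 : (gap rho j 0)%:R + 1 != 0 :> C by rewrite natr1 pnatr_eq0.
  have -> : 1 - (gap rho j 0)%:R / ((gap rho j 0)%:R + 1) = ((gap rho j 0)%:R + 1)^-1 :> C by field.
  rewrite invrK.
  have e : (cnt rho j m.+1 + (gap rho j 0 + 1) = cnt rho j 0 + m.+1)%N.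
    by move: gj; rewrite /gap E; lia.
  move/(congr1 (fun n => n%:R : C)): e; rewrite !natrD => e.
  rewrite (_ : (cnt rho j m.+1)%:R = (cnt rho j 0)%:R + m.+1%:R - ((gap rho j 0)%:R + 1)); last first.
    by rewrite -e addrK.
  ring.
apply: cvg_trans h; apply: near_eq_cvg.
near=> z.
have nz : nondegenerate (t z) z by near: z; exact: t_nondeg.
rewrite dmaster_dzE // invrK mulrBl !mulr_suml; congr (_ - _).
  by apply: eq_bigr => l _; rewrite mulrC.
by apply: eq_bigr => a _; rewrite mulrC.
Unshelve. all: by end_near. Qed.

End DzAsymptotics.

Section TableauAsymptotics.
Variables (R : realType) (N : nat) (lam : seq nat).
Hypothesis hlam : is_partition_of N lam.
Notation C := (Cplx R).
Notation AZ := (@asymptotic_zone R N).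

Definition tableau_beta (T : std_tableau N lam) (i : nat) (j : 'I_N) : rat :=
  beta_of rat (word_of T) i j.

(** The asymptotics of the variables alone determine those of the derivatives
    in z, so this serves both halves of the theorem. *)
Theorem tableau_asymptotics (t : 'rV[C]_N -> tvars R lam) (T : std_tableau N lam)
    (rho : nat -> nat) (idx : forall i : nat, 'I_(below lam i) -> 'I_N) :
  lattice_word rho N lam -> (forall j : 'I_N, word_of T j = rho j) ->
  (\forall z \near AZ, nondegenerate (t z) z) ->
  (forall i, (0 < i)%N ->
    [/\ injective (idx i), forall j, (exists a, idx i a = j) <-> (i <= rho j)%N &
        forall a, (fun z => t z i a / z 0 (idx i a)) @ AZ --> beta_of C rho i (idx i a)]) ->
  has_tableau_asymptotics T (tableau_beta T) t.
Proof.
move=> W TW nd h; have rhoE l : (l < N)%N -> rho l = word_of T l.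
  by move=> lN; rewrite (TW (Ordinal lN)).
split; last first.
  move=> j; apply: littleo_of_cvg; last first.
    by apply: filterS (near_coord_neq0 R j) => z; rewrite invr_eq0.
  have -> : ((col_of T j)%:R - (row_of T j)%:R : C) = (cnt rho j (rho j))%:R - (rho j)%:R.
    have -> : col_of T j = (cnt rho j (rho j)).+1.
      rewrite /col_of -cnt_col // rhoE //; congr (_.+1).
      by apply: eq_bigr => l _; rewrite rhoE // (ltn_trans (ltn_ord l)).
    rewrite row_ofE -rhoE // -!natr1; ring.
  apply: (@dz_limit R N lam t rho W idx) => //.
  - by move=> i /h[].
  - by move=> i /h[].
  - by move=> i a /h[].
exists idx; split=> [i i0|i a i0].
  have [h1 h2 _] := h i i0; split=> // j.
  by rewrite row_ofE TW ltnS; apply: h2.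
apply: littleo_of_cvg; last exact: near_coord_neq0.
have [_ _ h3] := h i i0.
rewrite ratr_beta -(beta_of_ext C i (ltn_ord (idx i a)) rhoE); exact: h3.
Qed.

Theorem critical_family_tableau (t : 'rV[C]_N -> tvars R lam) : critical_family t ->
  exists T : std_tableau N lam, has_tableau_asymptotics T (tableau_beta T) t.
Proof.
move=> crit; have [rho W [idx h]] := completeness hlam crit.
have [T TW] := tableau_of_word W.
exists T; apply: tableau_asymptotics W TW _ h.
by apply: filterS crit => z [[]].
Qed.

End TableauAsymptotics.

(** * Functions with continuous slopes *)
Section Caratheodory.
Variable R : realType.
Notation C := (Cplx R).

Lemma coord_le_norm n (x : 'rV[C]_n) k : `|x 0 k| <= `|x|.
Proof.
apply/ler_addgt0Pr => e e0; apply: ltW.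
have h : ball (0 : 'rV[C]_n) (`|x| + e) x.
  by rewrite -ball_normE /ball_ /= sub0r normrN ltrDl.
have [_ /(_ 0 k)] := h.
by rewrite -ball_normE /ball_ /= mxE sub0r normrN.
Qed.

Lemma box_nbhs n (x : 'rV[C]_n) (e : C) : 0 < e ->
  \forall y \near x, forall k, `|(y : 'rV[C]_n) 0 k - x 0 k| < e.
Proof.
move=> e0; apply/nbhs_ballP; exists e => //= y [_ h] k.
by have := h 0 k; rewrite -ball_normE /ball_ /= distrC.
Qed.

Lemma cvg_row T (F : set_system T) (FF : Filter F) n (f : T -> 'rV[C]_n) (l : 'rV[C]_n) :
  (forall k, (fun x => f x 0 k) @ F --> l 0 k) -> f @ F --> l.
Proof.
move=> h; apply/cvg_ballP => e e0.
have : \forall x \near F, forall k, `|f x 0 k - l 0 k| < e.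
  apply: filter_forall => k; have /cvgrPdist_lt /(_ e e0) := h k.
  by apply: filterS => x; rewrite distrC.
apply: filterS => x hx; split=> // i k.
by rewrite -ball_normE /ball_ /= ord1 distrC.
Qed.

(** Caratheodory's form of the derivative: f y - f x is a combination of the
    coordinates of y - x with coefficients continuous in y at x. *)
Lemma caratheodory_differentiable n (f : 'rV[C]_n -> C) (x : 'rV[C]_n) (s : 'I_n -> 'rV[C]_n -> C) :
  (forall k, {for x, continuous (s k)}) ->
  (\forall y \near x, f y - f x = \sum_(k < n) (y 0 k - x 0 k) * s k y) ->
  differentiable f x.
Proof.
move=> sc fs.
pose df0 (h : 'rV[C]_n) : C := \sum_(k < n) h 0 k * s k x.
have @df : {linear 'rV[C]_n -> C}.
  exists df0; do 2![eexists]; do ?[constructor]; rewrite /df0.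
  - by rewrite big1 // => k _; rewrite mxE mul0r.
  - by move=> a b; rewrite -big_split; apply: eq_bigr => k _; rewrite mxE mulrDl.
  - by move=> a b; rewrite /GRing.scale /= mulr_sumr; apply: eq_bigr => k _; rewrite mxE mulrA.
have dfc : continuous df.
  move=> h; have FF : Filter (nbhs h) by exact: nbhs_filter.
  apply: (@cvg_sum_fin R _ (nbhs h) FF _ _ xpredT (fun k (y : 'rV[C]_n) => y 0 k * s k x) (fun k => h 0 k * s k x)).
  move=> k _; apply: cvgM; last exact: cvg_cst.
  exact: (@coord_continuous C 1 n 0 k).
have E : f \o shift x = cst (f x) + df +o_ (0 : 'rV[C]_n) id.
  apply/eqaddoP => e e0.
  have e1 : 0 < e / (n.+1%:R : C) by rewrite divr_gt0 ?ltr0n.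
  have near_s : nbhs x [set y | forall k, `|s k y - s k x| < e / (n.+1%:R : C)].
    have h k : nbhs x [set y | `|s k y - s k x| < e / (n.+1%:R : C)].
      have /cvgrPdist_lt /(_ _ e1) := sc k.
      by under eq_near do rewrite distrC.
    have FF : Filter (nbhs x) by exact: nbhs_filter.
    exact: (@filter_forall _ _ _ (nbhs x) FF h).
  have cv : (fun h : 'rV[C]_n => h + x) @ nbhs (0 : 'rV[C]_n) --> x.
    rewrite -[X in _ --> X]add0r; apply: cvgD; [exact: cvg_id | exact: cvg_cst].
  near=> h.
  have [h1 h2] : f (h + x) - f x = \sum_(k < n) ((h + x) 0 k - x 0 k) * s k (h + x) /\
      forall k, `|s k (h + x) - s k x| < e / (n.+1%:R : C).
    by near: h; exact: cv _ (filterI fs near_s).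
  change (`|f (h + x) - (f x + df0 h)| <= e * `|h|).
  rewrite opprD addrA h1 /df0.
  rewrite -sumrB.
  apply: le_trans (ler_norm_sum _ _ _) _.
  apply: (@le_trans _ _ (\sum_(k < n) `|h| * (e / n.+1%:R))).
    apply: ler_sum => k _; rewrite mxE addrK -mulrBr normrM.
    by apply: ler_pM => //; [exact: coord_le_norm | exact: ltW].
  rewrite sumr_const card_ord -(mulr_natl _ n).
  have : 0 <= `|h| by exact: normr_ge0.
  move: `|h| => u u0.
  apply: (@le_trans _ _ ((e * u) * (n%:R / n.+1%:R))).
    by rewrite le_eqVlt; apply/orP; left; apply/eqP; ring.
  apply: ler_piMr; first by rewrite mulr_ge0 ?(ltW e0).
  by rewrite ler_pdivrMr ?ltr0n // mul1r ler_nat.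
by apply/diff_locallyP; rewrite (diff_unique dfc E).
Unshelve. all: by end_near. Qed.

End Caratheodory.

Section Slopes.
Variables (R : realType) (n : nat).
Notation C := (Cplx R).
Notation V := ('rV[C]_n).
Variable x0 : V.

Definition diag_nbhs : set_system (V * V) := nbhs ((x0, x0) : V * V).

Global Instance diag_nbhs_filter : ProperFilter diag_nbhs.
Proof. exact: nbhs_pfilter. Qed.

(** A name for continuity at a point of the product, so that the topology on pairs
    is inferred once and for all. *)
Definition cont_at (g : V * V -> C) (q : V * V) : Prop := {for q, continuous g}.

Definition near_cont (g : V * V -> C) : Prop := \forall q \near diag_nbhs, cont_at g q.

Lemma cont_atD f g q : cont_at f q -> cont_at g q -> cont_at (fun q => f q + g q) q.
Proof. exact: continuousD. Qed.

Lemma cont_atN f q : cont_at f q -> cont_at (fun q => - f q) q.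
Proof. exact: continuousN. Qed.

Lemma cont_atM f g q : cont_at f q -> cont_at g q -> cont_at (fun q => f q * g q) q.
Proof. exact: continuousM. Qed.

Lemma cont_atV f q : cont_at f q -> f q != 0 -> cont_at (fun q => (f q)^-1) q.
Proof. by move=> fq q0; exact: continuousV. Qed.

Lemma cont_at_cst c q : cont_at (fun=> c) q.
Proof. exact: (@cst_continuous (V * V)%type C c q). Qed.

Lemma near_cont_cst c : near_cont (fun=> c).
Proof. by apply: nearW => q; exact: cont_at_cst. Qed.

Lemma near_contD f g : near_cont f -> near_cont g -> near_cont (fun q => f q + g q).
Proof. by move=> hf hg; apply: filterS2 hf hg => q; exact: cont_atD. Qed.

Lemma near_contN f : near_cont f -> near_cont (fun q => - f q).
Proof. by move=> hf; apply: filterS hf => q; exact: cont_atN. Qed.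

Lemma near_contM f g : near_cont f -> near_cont g -> near_cont (fun q => f q * g q).
Proof. by move=> hf hg; apply: filterS2 hf hg => q; exact: cont_atM. Qed.

Lemma near_cont_neq0 f : near_cont f -> f (x0, x0) != 0 ->
  \forall q \near diag_nbhs, f q != 0.
Proof.
move=> /(@nbhs_singleton (V * V)%type) fc f0.
exact: (@cvgr_neq0 _ C _ diag_nbhs _ f _ fc f0).
Qed.

Lemma near_contV f : near_cont f -> f (x0, x0) != 0 -> near_cont (fun q => (f q)^-1).
Proof.
move=> fc f0; apply: filterS2 fc (near_cont_neq0 fc f0) => q.
exact: cont_atV.
Qed.

(** Functions of class C^1 near x0 in a form that needs no mean value inequality:
    f y - f x is a combination of the coordinates of y - x with coefficients
    continuous in the pair (x, y) near (x0, x0), and d is the differential at x0.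
    Rational functions are built up within this class. *)
Definition sloped (f : V -> C) (d : V -> C) : Prop :=
  exists s : 'I_n -> V * V -> C,
  [/\ near_cont (fun q => f q.1), near_cont (fun q => f q.2), forall k, near_cont (s k),
      \forall q \near diag_nbhs, f q.2 - f q.1 = \sum_(k < n) (q.2 0 k - q.1 0 k) * s k q
    & forall h, d h = \sum_(k < n) h 0 k * s k (x0, x0)].

Lemma sloped_eq f d d' : sloped f d -> d =1 d' -> sloped f d'.
Proof. by move=> [s [h1 h2 h3 h4 h5]] e; exists s; split=> // h; rewrite -e. Qed.

Lemma sloped_cst c : sloped (fun=> c) (fun=> 0).
Proof.
exists (fun _ _ => 0); split; try by [exact: near_cont_cst | move=> k; exact: near_cont_cst].
  by apply: nearW => q; rewrite subrr big1 // => k _; rewrite mulr0.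
by move=> h; rewrite big1 // => k _; rewrite mulr0.
Qed.

Lemma sloped_coord k : sloped (fun x => x 0 k) (fun h => h 0 k).
Proof.
exists (fun l _ => (l == k)%:R).
have sum1 (u : 'I_n -> C) : u k = \sum_(l < n) u l * (l == k)%:R.
  rewrite (bigD1 k) //= eqxx mulr1 big1 ?addr0 // => l /negbTE ->.
  by rewrite mulr0.
split.
- apply: nearW => q; apply: (@continuous_comp _ _ _ (@fst V V) (fun x : V => x 0 k)); first exact: cvg_fst.
  exact: (@coord_continuous C 1 n 0 k).
- apply: nearW => q; apply: (@continuous_comp _ _ _ (@snd V V) (fun x : V => x 0 k)); first exact: cvg_snd.
  exact: (@coord_continuous C 1 n 0 k).
- by move=> l; exact: near_cont_cst.
- by apply: nearW => q; rewrite -(sum1 (fun l => q.2 0 l - q.1 0 l)).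
by move=> h; rewrite -(sum1 (fun l => h 0 l)).
Qed.

Lemma slopedD f g df dg : sloped f df -> sloped g dg ->
  sloped (fun x => f x + g x) (fun h => df h + dg h).
Proof.
move=> [s [f1 f2 sc fs dfE]] [u [g1 g2 uc gu dgE]].
exists (fun k q => s k q + u k q); split.
- exact: near_contD f1 g1.
- exact: near_contD f2 g2.
- by move=> k; exact: near_contD (sc k) (uc k).
- apply: filterS2 fs gu => q e1 e2; rewrite opprD addrACA e1 e2 -big_split /=.
  by apply: eq_bigr => k _; rewrite mulrDr.
by move=> h; rewrite dfE dgE -big_split; apply: eq_bigr => k _; rewrite mulrDr.
Qed.

Lemma slopedM f g df dg : sloped f df -> sloped g dg ->
  sloped (fun x => f x * g x) (fun h => df h * g x0 + f x0 * dg h).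
Proof.
move=> [s [f1 f2 sc fs dfE]] [u [g1 g2 uc gu dgE]].
exists (fun k q => s k q * g q.1 + f q.2 * u k q); split.
- exact: near_contM f1 g1.
- exact: near_contM f2 g2.
- by move=> k; exact: near_contD (near_contM (sc k) g1) (near_contM f2 (uc k)).
- apply: filterS2 fs gu => q e1 e2.
  have -> : f q.2 * g q.2 - f q.1 * g q.1 = (f q.2 - f q.1) * g q.1 + f q.2 * (g q.2 - g q.1) by ring.
  rewrite e1 e2 mulr_suml mulr_sumr -big_split /=.
  by apply: eq_bigr => k _; ring.
move=> h; rewrite dfE dgE mulr_suml mulr_sumr -big_split /=.
by apply: eq_bigr => k _; ring.
Qed.

Lemma slopedV f df : sloped f df -> f x0 != 0 ->
  sloped (fun x => (f x)^-1) (fun h => - df h / f x0 ^+ 2).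
Proof.
move=> [s [f1 f2 sc fs dfE]] f0.
have n1 := near_cont_neq0 f1 f0; have n2 := near_cont_neq0 f2 f0.
have i1 := near_contV f1 f0; have i2 := near_contV f2 f0.
exists (fun k q => - (s k q * ((f q.1)^-1 * (f q.2)^-1))); split.
- exact: i1.
- exact: i2.
- by move=> k; exact: near_contN (near_contM (sc k) (near_contM i1 i2)).
- near=> q.
  have q1 : f q.1 != 0 by near: q; exact: n1.
  have q2 : f q.2 != 0 by near: q; exact: n2.
  have -> : (f q.2)^-1 - (f q.1)^-1 = - (f q.2 - f q.1) * ((f q.1)^-1 * (f q.2)^-1).
    by field; rewrite q1 q2.
  have -> : f q.2 - f q.1 = \sum_(k < n) (q.2 0 k - q.1 0 k) * s k q by near: q; exact: fs.
  rewrite mulNr mulr_suml -sumrN; apply: eq_bigr => k _; ring.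
move=> h; rewrite dfE mulNr mulr_suml -sumrN; apply: eq_bigr => k _ /=.
by field; rewrite f0.
Unshelve. all: by end_near. Qed.

Lemma slopedZ c f df : sloped f df -> sloped (fun x => c * f x) (fun h => c * df h).
Proof.
move=> fd; apply: sloped_eq (slopedM (sloped_cst c) fd) _ => h.
by rewrite mul0r add0r.
Qed.

Lemma slopedB f g df dg : sloped f df -> sloped g dg ->
  sloped (fun x => f x - g x) (fun h => df h - dg h).
Proof.
move=> fd gd; have := slopedD fd (slopedZ (-1) gd).
under [X in sloped X]eq_fun do rewrite mulN1r.
by under [X in sloped _ X]eq_fun do rewrite mulN1r.
Qed.

Lemma sloped_sum I (r : seq I) (P : pred I) (f d : I -> V -> C) :
  (forall i, P i -> sloped (f i) (d i)) ->
  sloped (fun x => \sum_(i <- r | P i) f i x) (fun h => \sum_(i <- r | P i) d i h).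
Proof.
move=> fd; elim: r => [|i r IH].
  under [X in sloped X]eq_fun do rewrite big_nil.
  under [X in sloped _ X]eq_fun do rewrite big_nil.
  exact: sloped_cst.
have [Pi|nPi] := boolP (P i).
  under [X in sloped X]eq_fun do rewrite big_cons Pi.
  under [X in sloped _ X]eq_fun do rewrite big_cons Pi.
  exact: slopedD (fd i Pi) IH.
under [X in sloped X]eq_fun do rewrite big_cons (negbTE nPi).
by under [X in sloped _ X]eq_fun do rewrite big_cons (negbTE nPi).
Qed.

End Slopes.

Section DetLimit.
Variables (R : realType) (T : Type) (F : set_system T) (FF : Filter F).
Notation C := (Cplx R).

Lemma cvg_prod_fin I (r : seq I) (P : pred I) (f : I -> T -> C) (c : I -> C) :
  (forall i, P i -> f i @ F --> c i) ->
  (fun z => \prod_(i <- r | P i) f i z) @ F --> \prod_(i <- r | P i) c i.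
Proof.
by move=> h; apply: cvg_big => //; exact: mul_continuous.
Qed.

Lemma cvg_det m (M : T -> 'M[C]_m) (L : 'M[C]_m) :
  (forall i j, (fun x => M x i j) @ F --> L i j) -> (fun x => \det (M x)) @ F --> \det L.
Proof.
move=> h; apply: cvg_sum_fin => s _; apply: cvgM; first exact: cvg_cst.
by apply: cvg_prod_fin => i _; exact: h.
Qed.

Lemma cvg_mulmx m p q (A : T -> 'M[C]_(m, p)) (B : T -> 'M[C]_(p, q)) (A0 : 'M[C]_(m, p)) (B0 : 'M[C]_(p, q)) :
  (forall i j, (fun x => A x i j) @ F --> A0 i j) ->
  (forall i j, (fun x => B x i j) @ F --> B0 i j) ->
  forall i j, (fun x => (A x *m B x) i j) @ F --> (A0 *m B0) i j.
Proof.
move=> hA hB i j; under eq_fun do rewrite mxE; rewrite mxE.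
by apply: cvg_sum_fin => k _; apply: cvgM; [exact: hA | exact: hB].
Qed.

Lemma cvg_invmx m (M : T -> 'M[C]_m) (L : 'M[C]_m) :
  (forall i j, (fun x => M x i j) @ F --> L i j) -> L \in unitmx ->
  forall i j, (fun x => ((\det (M x))^-1 *: \adj (M x)) i j) @ F --> invmx L i j.
Proof.
move=> h uL i j; rewrite /invmx uL.
under eq_fun do rewrite !mxE; rewrite !mxE.
apply: cvgM.
  apply: cvgV; first by rewrite -unitfE -unitmxE.
  exact: cvg_det h.
apply: cvgM; first exact: cvg_cst.
apply: cvg_det => a b; under eq_fun do rewrite !mxE; rewrite !mxE.
exact: h.
Qed.

End DetLimit.

(** * The implicit function theorem *)
Section LimitTools.
Variable R : realType.
Notation C := (Cplx R).

Lemma cvg_norm_le (T : Type) (F : set_system T) (FF : ProperFilter F) (f : T -> C) (a b M : C) :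
  f @ F --> a -> (\forall x \near F, `|f x - b| <= M) -> `|a - b| <= M.
Proof.
move=> /cvgrPdist_lt fa fb; apply/ler_addgt0Pr => e e0.
have [x [/= h1 h2]] := @filter_ex _ F _ _ (filterI (fa e e0) fb).
have -> : a - b = (f x - b) + (a - f x) by ring.
by apply: le_trans (ler_normD _ _) _; apply: lerD => //; apply: ltW.
Qed.

Lemma cvg_bounded_mul (T : Type) (F : set_system T) (FF : Filter F) (f g : T -> C) (M : C) :
  f @ F --> (0 : C) -> (\forall x \near F, `|g x| <= M) -> (fun x => f x * g x) @ F --> (0 : C).
Proof.
move=> /cvgrPdist_lt f0 gM; apply/cvgrPdist_lt => e e0.
have M1 : 0 < `|M| + 1 by rewrite ltr_wpDl.
have e1 : 0 < e / (`|M| + 1) by rewrite divr_gt0.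
near=> x; rewrite sub0r normrN normrM.
have h1 : `|f x| < e / (`|M| + 1).
  by rewrite -normrN -sub0r; near: x; exact: f0.
have h2 : `|g x| <= M by near: x; exact: gM.
have M0 : 0 <= M by apply: le_trans h2.
have {}h2 : `|g x| <= `|M| + 1 by apply: le_trans h2 _; rewrite (ger0_norm M0) lerDl.
apply: le_lt_trans (ler_wpM2l (normr_ge0 _) h2) _.
by rewrite -ltr_pdivlMr.
Unshelve. all: by end_near. Qed.

Lemma half_powers_cvg : (fun n : nat => (2^-1 : C) ^+ n) @ \oo --> (0 : C).
Proof.
have E n : (2^-1 : C) ^+ n = ((2^-1 : R) ^+ n)%:C%C.
  by rewrite rmorphXn fmorphV rmorph_nat.
rewrite (_ : (0 : C) = (0 +i* 0)%C) //; under eq_fun do rewrite E.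
apply: cvg_cplx => /=; last exact: cvg_cst.
by apply: cvg_expr; rewrite ger0_norm ?invr_ge0 // invf_lt1 // ltr1n.
Qed.

Lemma row_mul_le m p (v : 'rV[C]_m) (E : 'M[C]_(m, p)) (b c : C) j :
  (forall i, `|v 0 i| <= b) -> (forall i, `|E i j| <= c) -> `|(v *m E) 0 j| <= m%:R * (b * c).
Proof.
move=> vb Ec; rewrite mxE; apply: le_trans (ler_norm_sum _ _ _) _.
apply: (@le_trans _ _ (\sum_(i < m) b * c)).
  by apply: ler_sum => i _; rewrite normrM; apply: ler_pM.
by rewrite sumr_const card_ord mulr_natl.
Qed.

(** A contraction by 1/2 of the box of radius 2 c which moves the center by at most
    c. The iterates u converge along an ultrafilter, because they are bounded, and their increments tend to 0. *)
Lemma box_fixed_point m (w0 : 'rV[C]_m) (Phi : 'rV[C]_m -> 'rV[C]_m) (c : C) :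
  0 <= c ->
  (forall (w w' : 'rV[C]_m) (b : C), (forall i, `|w 0 i - w0 0 i| <= c + c) -> (forall i, `|w' 0 i - w0 0 i| <= c + c) ->
     (forall i, `|w' 0 i - w 0 i| <= b) -> forall i, `|Phi w' 0 i - Phi w 0 i| <= b / 2) ->
  (forall i, `|Phi w0 0 i - w0 0 i| <= c) ->
  exists (U : set_system nat) (u : nat -> 'rV[C]_m) (w : 'rV[C]_m),
  [/\ ProperFilter U, forall n i, `|u n 0 i - w0 0 i| <= c + c, forall i, `|w 0 i - w0 0 i| <= c + c,
     forall i, (fun n => u n 0 i) @ U --> w 0 i & forall i, (fun n => u n 0 i - Phi (u n) 0 i) @ U --> (0 : C)].
Proof.
move=> c0 contr start; pose u n := iter n Phi w0.
have two : (2 : C) != 0 by rewrite pnatr_eq0.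
have ub n i : `|u n 0 i - w0 0 i| <= c + c.
  elim: n i => [|n IH] i; first by rewrite subrr normr0 addr_ge0.
  have -> : u n.+1 0 i - w0 0 i = (Phi (u n) 0 i - Phi w0 0 i) + (Phi w0 0 i - w0 0 i).
    by rewrite /u /=; ring.
  apply: le_trans (ler_normD _ _) _; apply: lerD; last exact: start.
  have -> : c = (c + c) / 2 by field.
  by apply: contr => // k; rewrite subrr normr0 addr_ge0.
have us n i : `|u n.+1 0 i - u n 0 i| <= c * (2^-1) ^+ n.
  elim: n i => [|n IH] i; first by rewrite mulr1; exact: start.
  by rewrite exprSr mulrA; exact: (contr (u n) (u n.+1)).
have [U [UU AU]] := @ultraFilterLemma _ (\oo : set_system nat) _.
have /(_ _)/cid h : forall i, exists a : C, (fun n => u n 0 i) @ U --> a.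
  move=> i; have [M hM] := norm_lt_cplx (`|w0 0 i| + (c + c)).
  apply: (@ultra_bounded_cvg _ _ U _ _ M); apply: nearW => n.
  have nn : 0 <= `|w0 0 i| + (c + c) by rewrite !addr_ge0.
  rewrite (ger0_norm nn) in hM.
  have -> : u n 0 i = w0 0 i + (u n 0 i - w0 0 i) by ring.
  apply: le_trans (ler_normD _ _) _; apply: le_trans hM.
  exact: lerD (lexx _) (ub n i).
exists U, u, (\row_i sval (h i)); split.
- exact: ultra_proper.
- exact: ub.
- move=> i; rewrite mxE; apply: (@cvg_norm_le _ U _ _ _ _ _ (svalP (h i))).
  by apply: nearW => n; exact: ub.
- by move=> i; rewrite mxE; exact: (svalP (h i)).
move=> i; have H : (fun n => c * (2^-1) ^+ n) @ U --> (0 : C).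
  rewrite -(mulr0 c); apply: cvgM; first exact: cvg_cst.
  apply: cvg_trans half_powers_cvg; exact: cvg_app.
apply/cvgrPdist_lt => e e0; have /cvgrPdist_lt /(_ e e0) := H.
apply: filterS => n; rewrite !sub0r !normrN => lt.
rewrite distrC; apply: le_lt_trans (us n i) _; apply: le_lt_trans lt.
by rewrite real_ler_norm // ger0_real // mulr_ge0 ?exprn_ge0 ?invr_ge0.
Qed.

End LimitTools.

Section ImplicitFunction.
Variables (R : realType) (m p : nat).
Notation C := (Cplx R).
Notation V := ('rV[C]_(m + p)).
Variables (w0 : 'rV[C]_m) (r0 : 'rV[C]_p).
Notation x0 := (row_mx w0 r0 : V).

Definition in_box n (e : C) (x y : 'rV[C]_n) : Prop := forall k, `|y 0 k - x 0 k| < e.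

Lemma diag_box (P : set (V * V)) : diag_nbhs x0 P ->
  exists2 e : C, 0 < e & forall x y, in_box e x0 x -> in_box e x0 y -> P (x, y).
Proof.
move=> /nbhs_ballP[e /= e0 eP]; exists e; first exact: e0.
move=> x y hx hy; apply: eP.
by split; split=> // i k; rewrite -ball_normE /ball_ /= ord1 distrC.
Qed.

Variable s : 'I_m -> 'I_(m + p) -> V * V -> C.

(** For q = (x, y), with x = (w, r) and y = (w', r'), the increment of F is
    (w' - w) slope_w q + (r' - r) slope_r q; where F vanishes at both points, w' - w
    is (r' - r) slope_sol q. The adjugate expresses the inverse as a continuous
    function of q. *)
Definition slope_w (q : V * V) : 'M[C]_m := \matrix_(i, k) s k (lshift p i) q.
Definition slope_r (q : V * V) : 'M[C]_(p, m) := \matrix_(l, k) s k (rshift m l) q.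
Definition slope_sol (q : V * V) : 'M[C]_(p, m) :=
  - slope_r q *m ((\det (slope_w q))^-1 *: \adj (slope_w q)).

Lemma slope_sol_cvg q : (forall k l, cont_at (s k l) q) -> \det (slope_w q) != 0 ->
  forall l k, (fun q' => slope_sol q' l k) @ nbhs q --> slope_sol q l k.
Proof.
move=> sc det0 l k.
have FF : Filter (nbhs q) by exact: nbhs_filter.
have uA : slope_w q \in unitmx by rewrite unitmxE unitfE.
have E : slope_sol q l k = (- slope_r q *m invmx (slope_w q)) l k.
  by rewrite /slope_sol /invmx uA.
suff gen y : y = (- slope_r q *m invmx (slope_w q)) l k ->
  (fun q' => slope_sol q' l k) @ nbhs q --> y by exact: gen _ E.
move=> ->; apply: (cvg_mulmx FF) => [i j|].
  under eq_fun do rewrite !mxE; rewrite !mxE; apply: cvgN; exact: sc.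
apply: (cvg_invmx FF) => // i j.
under eq_fun do rewrite !mxE; rewrite !mxE; exact: sc.
Qed.

Lemma slope_solE (w w' : 'rV[C]_m) (r r' : 'rV[C]_p) :
  let q := (row_mx w r, row_mx w' r') in
  \det (slope_w q) != 0 ->
  (forall k, \sum_l (row_mx w' r' 0 l - row_mx w r 0 l) * s k l q = 0) ->
  w' - w = (r' - r) *m slope_sol q.
Proof.
move=> q det0 e.
have uA : slope_w q \in unitmx by rewrite unitmxE unitfE.
have E : (w' - w) *m slope_w q + (r' - r) *m slope_r q = 0.
  apply/rowP => k; rewrite !mxE -[RHS](e k) big_split_ord /=; congr (_ + _).
    by apply: eq_bigr => i _; rewrite !row_mxEl !mxE.
  by apply: eq_bigr => i _; rewrite !row_mxEr !mxE.
move/eqP: E; rewrite addr_eq0 => /eqP E.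
have := congr1 (mulmx^~ (invmx (slope_w q))) E => /=.
rewrite mulmxK // => ->; rewrite /slope_sol /invmx uA.
by rewrite mulNmx mulNmx mulmxN mulmxA.
Qed.

Variable F : 'I_m -> V -> C.
Hypothesis F_cont : forall k, near_cont x0 (fun q => F k q.2).
Hypothesis s_cont : forall k l, near_cont x0 (s k l).
Hypothesis F_slope : forall k, \forall q \near diag_nbhs x0,
  F k q.2 - F k q.1 = \sum_l (q.2 0 l - q.1 0 l) * s k l q.
Hypothesis F0 : forall k, F k x0 = 0.
Notation H := (slope_w (x0, x0)).
Hypothesis uH : H \in unitmx.

Lemma near_all (I : finType) (P : I -> set (V * V)) :
  (forall i, diag_nbhs x0 (P i)) -> diag_nbhs x0 [set q | forall i, P i q].
Proof. by move=> h; exact: (@filter_forall _ _ _ (diag_nbhs x0) (diag_nbhs_filter x0) h). Qed.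

(** All that is needed holds on a box: there slope_w is invertible and close to its
    value H at the center, and slope_sol is bounded. *)
Lemma regular_box : exists2 e : C, 0 < e &
  forall x y : V, in_box e x0 x -> in_box e x0 y ->
  [/\ forall k, F k y - F k x = \sum_l (y 0 l - x 0 l) * s k l (x, y),
      forall k l, cont_at (s k l) (x, y),
      forall k, cont_at (fun q => F k q.2) (x, y) &
      [/\ \det (slope_w (x, y)) != 0,
      forall i j, `|(1%:M - slope_w (x, y) *m invmx H) i j| <= (m.+1%:R * 2)^-1 &
      forall l k, `|slope_sol (x, y) l k| <= `|slope_sol (x0, x0) l k| + 1]].
Proof.
have FF : Filter (diag_nbhs x0) by exact: nbhs_filter.
have c0 k l : cont_at (s k l) (x0, x0) by exact: (nbhs_singleton (s_cont k l)).
have det0 : \det H != 0 by rewrite -unitfE -unitmxE.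
have cA i j : (fun q => slope_w q i j) @ diag_nbhs x0 --> H i j.
  by under eq_fun do rewrite !mxE; rewrite !mxE; exact: c0.
have N1 : diag_nbhs x0 [set q | \det (slope_w q) != 0].
  exact: (cvgr_neq0 (\det H) (cvg_det FF cA) det0).
have N2 : diag_nbhs x0 [set q | forall i j,
    `|(1%:M - slope_w q *m invmx H) i j| <= (m.+1%:R * 2)^-1].
  apply: near_all => i; apply: near_all => j.
  have e0 : 0 < (m.+1%:R * 2)^-1 :> C by rewrite invr_gt0 mulr_gt0 ?ltr0n.
  have cI a b : (fun _ : V * V => invmx H a b) @ diag_nbhs x0 --> invmx H a b by exact: cvg_cst.
  have /cvgrPdist_lt /(_ _ e0) :=
    @cvg_mulmx R _ _ FF m m m slope_w (fun=> invmx H) H (invmx H) cA cI i j.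
  rewrite mulmxV //; apply: filterS => q lt.
  rewrite /= in lt *; rewrite [(1%:M - _) i j]mxE [X in _ + X]mxE.
  exact: ltW.
have N3 : diag_nbhs x0 [set q | forall l k, `|slope_sol q l k| <= `|slope_sol (x0, x0) l k| + 1].
  apply: near_all => l; apply: near_all => k.
  have h : (fun q => slope_sol q l k) @ diag_nbhs x0 --> slope_sol (x0, x0) l k.
    by apply: slope_sol_cvg.
  have /cvgrPdist_lt /(_ _ (@ltr01 C)) := h.
  have tri (a b : C) : `|a - b| < 1 -> `|b| <= `|a| + 1.
    move=> lt; rewrite -[X in `|X| <= _](subKr a); apply: le_trans (ler_normD _ _) _.
    by rewrite normrN; apply: lerD => //; exact: ltW.
  by apply: filterS => q; exact: tri.
have N4 : diag_nbhs x0 [set q | forall k, F k q.2 - F k q.1 = \sum_l (q.2 0 l - q.1 0 l) * s k l q].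
  by apply: near_all => k; exact: F_slope.
have N5 : diag_nbhs x0 [set q | forall k l, cont_at (s k l) q].
  by apply: near_all => k; apply: near_all => l; exact: s_cont.
have N6 : diag_nbhs x0 [set q | forall k, cont_at (fun q => F k q.2) q].
  by apply: near_all => k; exact: F_cont.
have [e e0 eP] := diag_box (filterI (filterI N1 N2) (filterI (filterI N3 N4) (filterI N5 N6))).
exists e; first exact: e0.
move=> x y hx hy; have [[h1 h2] [[h3 h4] [h5 h6]]] := eP x y hx hy.
by split; [exact: h4 | exact: h5 | exact: h6 | split; [exact: h1 | exact: h2 | exact: h3]].
Qed.

Lemma in_box_row e (w : 'rV[C]_m) (r : 'rV[C]_p) :
  in_box e w0 w -> in_box e r0 r -> in_box e x0 (row_mx w r).
Proof.
move=> hw hr k; case: (split_ordP k) => [i ->|i ->]; first by rewrite !row_mxEl.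
by rewrite !row_mxEr.
Qed.

Lemma in_box_refl n e (x : 'rV[C]_n) : 0 < e -> in_box e x x.
Proof. by move=> e0 k; rewrite subrr normr0. Qed.

Lemma common_radius (a b : C) : 0 < a -> 0 < b -> exists2 d, 0 < d & d <= a /\ d <= b.
Proof.
move=> a0 b0; have ab : 0 < a + b by rewrite addr_gt0.
exists (a * b / (a + b)); first by rewrite divr_gt0 ?mulr_gt0.
rewrite !ler_pdivrMr //; split; first by rewrite ler_pM2l // lerDr ltW.
by rewrite mulrC ler_pM2l // lerDl ltW.
Qed.

Definition regular (e : C) : Prop := forall x y : V, in_box e x0 x -> in_box e x0 y ->
  [/\ forall k, F k y - F k x = \sum_l (y 0 l - x 0 l) * s k l (x, y),
      forall k l, cont_at (s k l) (x, y),
      forall k, cont_at (fun q => F k q.2) (x, y) &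
      [/\ \det (slope_w (x, y)) != 0,
      forall i j, `|(1%:M - slope_w (x, y) *m invmx H) i j| <= (m.+1%:R * 2)^-1 &
      forall l k, `|slope_sol (x, y) l k| <= `|slope_sol (x0, x0) l k| + 1]].

Lemma residual_small (c : C) : 0 < c -> exists2 e, 0 < e & forall r, in_box e r0 r ->
  forall i, `|(\row_k F k (row_mx w0 r) *m invmx H) 0 i| <= c.
Proof.
move=> c0; have FF : Filter (diag_nbhs x0) by exact: nbhs_filter.
have cF i j : (fun q => (\row_k F k q.2) i j) @ diag_nbhs x0 --> (0 : 'rV[C]_m) i j.
  under eq_fun do rewrite !mxE; rewrite mxE -(F0 j).
  exact: (nbhs_singleton (F_cont j)).
have cI a b : (fun _ : V * V => invmx H a b) @ diag_nbhs x0 --> invmx H a b by exact: cvg_cst.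
have N : diag_nbhs x0 [set q | forall i, `|(\row_k F k q.2 *m invmx H) 0 i| < c].
  apply: near_all => i.
  have h : (fun q => (\row_k F k q.2 *m invmx H) 0 i) @ diag_nbhs x0 --> (0 : C).
    have := @cvg_mulmx R _ _ FF 1 m m (fun q => \row_k F k q.2) (fun=> invmx H) 0 (invmx H) cF cI 0 i.
    by rewrite mul0mx mxE.
  have /cvgrPdist_lt /(_ _ c0) := h; apply: filterS => q.
  by rewrite sub0r normrN.
have [e e0 eP] := diag_box N; exists e; first exact: e0.
move=> r hr i; apply: ltW; apply: (eP x0 (row_mx w0 r)); first exact: in_box_refl.
by apply: in_box_row => //; exact: in_box_refl.
Qed.

(** Newton's map w - F(w, r) H^-1 with frozen slope is a contraction. *)
Lemma solution_exists (e : C) : 0 < e -> regular e ->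
  exists2 d, 0 < d & forall r, in_box d r0 r ->
  exists w, in_box e w0 w /\ forall k, F k (row_mx w r) = 0.
Proof.
(* The iterates of Newton's map stay within 2 c = e / 2 of w0. *)
move=> e0 reg; have c0 : 0 < e / 4 by rewrite divr_gt0 ?ltr0n.
move cE : (e / 4) c0 => c c0.
have ce : c + c < e.
  have -> : e = c + c + (c + c) by rewrite -cE; field.
  by rewrite ltrDl addr_gt0.
have [e1 e10 small] := residual_small c0.
have [d d0 [de de1]] := common_radius e0 e10.
exists d; first exact: d0.
move=> r hr; have hre : in_box e r0 r by move=> k; exact: lt_le_trans (hr k) de.
pose Fv (w : 'rV[C]_m) : 'rV[C]_m := \row_k F k (row_mx w r).
pose Phi (w : 'rV[C]_m) := w - Fv w *m invmx H.
have inb (w : 'rV[C]_m) : (forall i, `|w 0 i - w0 0 i| <= c + c) -> in_box e x0 (row_mx w r).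
  move=> hw; apply: in_box_row; last exact: hre.
  by move=> i; exact: le_lt_trans (hw i) ce.
have [||U [u [w [UP ub wb uw uPhi]]]] := @box_fixed_point R m w0 Phi c (ltW c0).
- move=> w w' b hw hw' hb i.
  have [sl _ _ [_ small' _]] := reg _ _ (inb _ hw) (inb _ hw').
  have E : Phi w' - Phi w = (w' - w) *m (1%:M - slope_w (row_mx w r, row_mx w' r) *m invmx H).
    rewrite mulmxBr mulmx1 mulmxA.
    have -> : (w' - w) *m slope_w (row_mx w r, row_mx w' r) = Fv w' - Fv w.
      apply/rowP => k; rewrite !mxE sl big_split_ord /= [X in _ = _ + X]big1 ?addr0.
        by apply: eq_bigr => l _; rewrite !row_mxEl !mxE.
      by move=> l _; rewrite !row_mxEr subrr mul0r.
    rewrite mulmxBl /Phi !opprB [LHS]addrACA [RHS]addrACA.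
    by congr (_ + _); rewrite addrC.
  have -> : Phi w' 0 i - Phi w 0 i = (Phi w' - Phi w) 0 i.
    by rewrite [RHS]mxE [X in _ = _ + X]mxE.
  rewrite E; apply: le_trans (@row_mul_le R m m _ _ b _ i _ (small' ^~ i)) _.
    by move=> l; rewrite mxE [X in _ + X]mxE; exact: hb.
  have b0 : 0 <= b by apply: le_trans (hb i).
  have -> : m%:R * (b * (m.+1%:R * 2)^-1) = (b / 2) * (m%:R / m.+1%:R) :> C.
    have : m.+1%:R != 0 :> C by rewrite pnatr_eq0.
    by move: (m.+1%:R : C) => y y0; field.
  apply: ler_piMr; first by rewrite divr_ge0.
  by rewrite ler_pdivrMr ?ltr0n // mul1r ler_nat.
- move=> i; rewrite /Phi mxE [X in _ + X - _]mxE addrAC subrr add0r normrN.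
  by apply: small => k; exact: lt_le_trans (hr k) de1.
exists w; split=> [i|k]; first exact: le_lt_trans (wb i) ce.
have FU : Filter U by exact: filter_filter.
have h1 : (fun n => F k (row_mx (u n) r)) @ U --> F k (row_mx w r).
  have [_ _ /(_ k) Fc _] := reg x0 (row_mx w r) (in_box_refl x0 e0) (inb w wb).
  have cv1 : (fun _ : nat => x0) @ U --> x0 by exact: cvg_cst.
  have cv2 : (fun n => row_mx (u n) r) @ U --> row_mx w r.
    apply: cvg_row => l; case: (split_ordP l) => [i ->|i ->].
      by under eq_fun do rewrite row_mxEl; rewrite row_mxEl; exact: uw.
    by under eq_fun do rewrite row_mxEr; rewrite row_mxEr; exact: cvg_cst.
  have cv := cvg_pair cv1 cv2.
  have {}cv : (fun n => (x0, row_mx (u n) r)) @ U --> nbhs ((x0, row_mx w r) : V * V) by exact: cv.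
  exact: (@cvg_comp _ _ _ (fun n => (x0, row_mx (u n) r)) (fun q : V * V => F k q.2) U
    (nbhs ((x0, row_mx w r) : V * V)) _ cv Fc).
have h2 : (fun n => F k (row_mx (u n) r)) @ U --> (0 : C).
  have E n : F k (row_mx (u n) r) = ((u n - Phi (u n)) *m H) 0 k.
    by rewrite /Phi opprD addrA subrr add0r opprK mulmxKV // mxE.
  under eq_fun do rewrite E.
  have hu i j : (fun n => (u n - Phi (u n)) i j) @ U --> (0 : 'rV[C]_m) i j.
    rewrite ord1 mxE; under eq_fun do rewrite mxE [X in _ + X]mxE; exact: uPhi.
  have hH i j : (fun _ : nat => H i j) @ U --> H i j by exact: cvg_cst.
  have := @cvg_mulmx R _ _ FU 1 m m (fun n => u n - Phi (u n)) (fun=> H) 0 H hu hH 0 k.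
  by rewrite mul0mx mxE.
exact: (cvg_unique (@norm_hausdorff _ C) h1 h2).
Qed.

Lemma solution_increment (e : C) (w w' : 'rV[C]_m) (r r' : 'rV[C]_p) : regular e ->
  in_box e x0 (row_mx w r) -> in_box e x0 (row_mx w' r') ->
  (forall k, F k (row_mx w r) = 0) -> (forall k, F k (row_mx w' r') = 0) ->
  w' - w = (r' - r) *m slope_sol (row_mx w r, row_mx w' r').
Proof.
move=> reg hx hy Fx Fy; have [sl _ _ [det0 _ _]] := reg _ _ hx hy.
by apply: slope_solE => // k; rewrite -sl Fx Fy subrr.
Qed.

(** The increment formula makes the solution Lipschitz, hence continuous; then its
    slopes are continuous, and it is differentiable. *)
Lemma regular_implicit_function : exists g : 'rV[C]_p -> 'rV[C]_m,
  [/\ forall k, (fun r => g r 0 k) @ nbhs r0 --> w0 0 k,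
      \forall r \near r0, forall k, F k (row_mx (g r) r) = 0 &
      \forall r \near r0, forall k, differentiable (fun r => g r 0 k) r].
Proof.
have [e e0 reg] := regular_box.
have [d1 d10 sol] := solution_exists e0 reg.
have [d d0 [dd1 de]] := common_radius d10 e0.
have /choice[g hg] : forall r, exists w, in_box d r0 r ->
    in_box e x0 (row_mx w r) /\ forall k, F k (row_mx w r) = 0.
  move=> r; have [hr|nr] := pselect (in_box d r0 r); last by exists w0.
  have [w [w1 w2]] := sol r (fun k => lt_le_trans (hr k) dd1).
  exists w => _; split=> //; apply: in_box_row => // k; exact: lt_le_trans (hr k) de.
pose q r r' := (row_mx (g r) r, row_mx (g r') r').
have inc r r' : in_box d r0 r -> in_box d r0 r' -> g r' - g r = (r' - r) *m slope_sol (q r r').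
  by move=> hr hr'; have [i1 z1] := hg r hr; have [i2 z2] := hg r' hr'; apply: solution_increment reg _ _ _ _.
have gr0 : g r0 = w0.
  have [i1 z1] := hg r0 (in_box_refl r0 d0).
  have := solution_increment reg (in_box_refl x0 e0) i1 F0 z1.
  by rewrite subrr mul0mx => /eqP; rewrite subr_eq0 => /eqP.
have nb : nbhs r0 [set r | in_box d r0 r] by exact: box_nbhs.
have nb' := nbhs_interior nb.
have incE r r' k : in_box d r0 r -> in_box d r0 r' ->
    g r' 0 k - g r 0 k = \sum_l (r' 0 l - r 0 l) * slope_sol (q r r') l k.
  move=> hr hr'; have -> : g r' 0 k - g r 0 k = (g r' - g r) 0 k.
    by rewrite [RHS]mxE [X in _ = _ + X]mxE.
  rewrite inc // mxE; apply: eq_bigr => l _; by rewrite mxE [X in _ + X]mxE.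
have gc r k : nbhs r [set r' | in_box d r0 r'] -> (fun r' => g r' 0 k) @ nbhs r --> g r 0 k.
  move=> nr; have hr : in_box d r0 r := nbhs_singleton nr.
  have FF : Filter (nbhs r) by exact: nbhs_filter.
  have h : (fun r' : 'rV[C]_p => g r 0 k + \sum_l (r' 0 l - r 0 l) * slope_sol (q r r') l k) @ nbhs r --> g r 0 k + \sum_(l < p) (0 : C).
    apply: cvgD; first exact: cvg_cst.
    apply: (@cvg_sum_fin R _ (nbhs r) FF _ _ xpredT
      (fun l (r' : 'rV[C]_p) => (r' 0 l - r 0 l) * slope_sol (q r r') l k) (fun=> 0)) => l _.
    apply: (@cvg_bounded_mul R _ _ FF _ _ (`|slope_sol (x0, x0) l k| + 1)).
      rewrite -(subrr (r 0 l)); apply: cvgB; last exact: cvg_cst.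
      exact: (@coord_continuous C 1 p 0 l).
    apply: filterS nr => r' hr'.
    have [i1 _] := hg r hr; have [i2 _] := hg r' hr'.
    by have [_ _ _ [_ _ /(_ l k)]] := reg _ _ i1 i2.
  rewrite big1 ?addr0 // in h; apply: cvg_trans h; apply: near_eq_cvg.
  apply: filterS nr => r' hr'.
  by rewrite -incE // addrC subrK.
exists g; split.
- by move=> k; rewrite -gr0; apply: gc.
- by apply: filterS nb => r /hg[].
apply: filterS nb' => r nr k; have hr : in_box d r0 r := nbhs_singleton nr.
have [i1 _] := hg r hr; have [_ sc _ [det0 _ _]] := reg _ _ i1 i1.
apply: (@caratheodory_differentiable R p (fun r => g r 0 k) r (fun l r' => slope_sol (q r r') l k)).
  move=> l; have FF : Filter (nbhs r) by exact: nbhs_filter.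
  have cv1 : (fun _ : 'rV[C]_p => row_mx (g r) r) @ nbhs r --> row_mx (g r) r by exact: cvg_cst.
  have cv2 : (fun r' => row_mx (g r') r') @ nbhs r --> row_mx (g r) r.
    apply: cvg_row => a; case: (split_ordP a) => [i ->|i ->].
      by under eq_fun do rewrite row_mxEl; rewrite row_mxEl; exact: gc.
    by under eq_fun do rewrite row_mxEr; rewrite row_mxEr; exact: (@coord_continuous C 1 p 0 i).
  have cv := cvg_pair cv1 cv2.
  have {}cv : (fun r' => q r r') @ nbhs r --> nbhs (q r r) by exact: cv.
  have cs : (fun q : V * V => slope_sol q l k) @ nbhs (q r r) --> slope_sol (q r r) l k.
    exact: (slope_sol_cvg sc det0).
  have cc : (fun r' => slope_sol (q r r') l k) @ nbhs r --> slope_sol (q r r) l k.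
    exact: (@cvg_comp _ _ _ (fun r' => q r r') (fun q : V * V => slope_sol q l k) (nbhs r)
      (nbhs (q r r)) _ cv cs).
  exact: cc.
by apply: filterS nr => r' hr'; exact: incE.
Qed.

End ImplicitFunction.

Theorem implicit_function (R : realType) (m p : nat) (w0 : 'rV[Cplx R]_m) (r0 : 'rV[Cplx R]_p)
    (F d : 'I_m -> 'rV[Cplx R]_(m + p) -> Cplx R) :
  (forall k, sloped (row_mx w0 r0) (F k) (d k)) -> (forall k, F k (row_mx w0 r0) = 0) ->
  (forall h : 'rV[Cplx R]_m, (forall k, d k (row_mx h 0) = 0) -> h = 0) ->
  exists g : 'rV[Cplx R]_p -> 'rV[Cplx R]_m,
  [/\ forall k, (fun r => g r 0 k) @ nbhs r0 --> w0 0 k,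
      \forall r \near r0, forall k, F k (row_mx (g r) r) = 0 &
      \forall r \near r0, forall k, differentiable (fun r => g r 0 k) r].
Proof.
move=> /fin_all_exists[s hs] F0 inj.
apply: (@regular_implicit_function R m p w0 r0 s F) => //.
- by move=> k; have [] := hs k.
- by move=> k; have [] := hs k.
- by move=> k; have [] := hs k.
rewrite -row_free_unit -kermx_eq0 -submx0; apply/rV_subP => h /sub_kermxP hH.
rewrite submx0; apply/eqP; apply: inj => k; have [_ _ _ _ ->] := hs k.
rewrite big_split_ord /= [X in _ + X]big1 ?addr0.
  transitivity ((h *m slope_w s (row_mx w0 r0, row_mx w0 r0)) 0 k); last by rewrite hH mxE.
  by rewrite [RHS]mxE; apply: eq_bigr => i _; rewrite row_mxEl [in RHS]mxE.
by move=> i _; rewrite row_mxEr mxE mul0r.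
Qed.

(** * The rescaled critical equations *)
(** Going down from the top index, the equations give h i = th h (i - 1) with
    0 <= th <= 1, because the coefficients are nonnegative; as h 0 = 0, all vanish. *)
Lemma tridiagonal_injective (F : numFieldType) (rho : nat) (h a c e : nat -> F) :
  h 0%N = 0 ->
  (forall i, (0 < i <= rho)%N -> [/\ 0 <= a i, 0 < c i, 0 <= e i &
     a i * h i + c i * (h i - h i.-1) + (i < rho)%N%:R * (e i * (h i - h i.+1)) = 0]) ->
  forall i, (i <= rho)%N -> h i = 0.
Proof.
move=> h0 H.
have back k : forall i, (0 < i <= rho)%N -> (rho - i)%N = k ->
    exists2 th, 0 <= th <= 1 & h i = th * h i.-1.
  elim: k => [|k IH] i hi ik; have [a0 c0 e0 E] := H i hi.
    have ir : i = rho by lia.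
    rewrite ir ltnn mul0r addr0 -ir in E.
    have ac : 0 < a i + c i by rewrite ltr_wpDl.
    exists (c i / (a i + c i)).
      by rewrite divr_ge0 ?(ltW ac) ?(ltW c0) //= ler_pdivrMr // mul1r lerDr.
    have ac0 := lt0r_neq0 ac.
    apply: (mulfI ac0); rewrite mulrA [_ * (_ / _)]mulrC divfK //.
    by apply/eqP; rewrite -subr_eq0 -E; apply/eqP; ring.
  have ir : (i < rho)%N by lia.
  have hi1 : (0 < i.+1 <= rho)%N by [].
  have [|th /andP[t0 t1] E1] := IH i.+1 hi1; first lia.
  rewrite ir mul1r E1 /= in E.
  have f0 : 0 <= e i * (1 - th) by rewrite mulr_ge0 // subr_ge0.
  have af : 0 <= a i + e i * (1 - th) by rewrite addr_ge0.
  have ac : 0 < c i + (a i + e i * (1 - th)) by rewrite ltr_wpDr.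
  exists (c i / (c i + (a i + e i * (1 - th)))).
    by rewrite divr_ge0 ?(ltW ac) ?(ltW c0) //= ler_pdivrMr // mul1r lerDl.
  have ac0 := lt0r_neq0 ac.
  apply: (mulfI ac0); rewrite mulrA [_ * (_ / _)]mulrC divfK //.
  by apply/eqP; rewrite -subr_eq0 -E; apply/eqP; ring.
elim=> [//|i IH] ir; have [|th _ ->] := back (rho - i.+1)%N i.+1 _ erefl; first by rewrite ir.
by rewrite /= IH ?mulr0 // ltnW.
Qed.

Section BaseSolution.
Variables (F : numFieldType) (rho : nat -> nat) (N : nat) (lam : seq nat).
Hypothesis W : lattice_word rho N lam.
Notation beta := (beta_of F rho).

Lemma beta0 j : beta 0 j = 1.
Proof. by rewrite /beta_of big_ord0. Qed.

Lemma betaS i j : beta i.+1 j = beta i j * ((gap rho j i)%:R / ((gap rho j i)%:R + 1)).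
Proof. by rewrite /beta_of big_ord_recr. Qed.

Lemma beta_decr i j : (j < N)%N -> (i < rho j)%N -> beta i.+1 j < beta i j.
Proof.
move=> jN ij; rewrite betaS -subr_gt0.
have /andP[_ lt] := half_le_ratio F (gap_gt0 W jN ij).
rewrite -[X in X - _]mulr1 -mulrBr mulr_gt0 ?subr_gt0 //.
exact: (beta_gt0 F W jN (ltnW ij)).
Qed.

Definition reach_count (j i : nat) : nat := \sum_(l < j) (i <= rho l)%N.

Lemma reach_countS j i : reach_count j i = (reach_count j i.+1 + cnt rho j i)%N.
Proof.
rewrite /reach_count /cnt -big_split; apply: eq_bigr => l _ /=.
by rewrite eq_sym; case: ltngtP.
Qed.

Lemma curvature i j : (2 * (reach_count j i.+1)%:R - (reach_count j i)%:R - (reach_count j i.+2)%:R : F)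
  = (cnt rho j i.+1)%:R - (cnt rho j i)%:R.
Proof. rewrite (reach_countS j i) (reach_countS j i.+1) !natrD; ring. Qed.

(** beta_(i+1) - beta_i = - beta_(i+1) / g_i and beta_(i+1) - beta_(i+2) =
    beta_(i+1) / (g_(i+1) + 1) where g is gap, and the gaps telescope to the
    difference of counts. *)
Lemma base_equation i j : (j < N)%N -> (i < rho j)%N ->
  ((cnt rho j i.+1)%:R - (cnt rho j i)%:R) / beta i.+1 j
  - (beta i.+1 j - beta i j)^-1 - (i.+1 < rho j)%N%:R * (beta i.+1 j - beta i.+2 j)^-1 = 0.
Proof.
move=> jN ij; have g0 := gap_gt0 W jN ij.
have b0 : beta i j != 0 by rewrite gt_eqF // (beta_gt0 F W jN (ltnW ij)).
have D0 : (gap rho j i)%:R != 0 :> F by rewrite pnatr_eq0 -lt0n.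
have D1 : (gap rho j i)%:R + 1 != 0 :> F by rewrite natr1 pnatr_eq0.
have E1 : (beta i.+1 j - beta i j)^-1 = - (gap rho j i)%:R / beta i.+1 j.
  rewrite betaS; field; rewrite D1 D0 b0 /=.
  by rewrite mulNr -mulrBr opprD addNKr mulrN1 oppr_eq0.
have b1 : beta i.+1 j != 0 by rewrite gt_eqF // (beta_gt0 F W jN ij).
have [lt|ge] := ltnP i.+1 (rho j); rewrite E1.
  have g1 := gap_gt0 W jN lt.
  have D2 : (gap rho j i.+1)%:R + 1 != 0 :> F by rewrite natr1 pnatr_eq0.
  have -> : (beta i.+1 j - beta i.+2 j)^-1 = ((gap rho j i.+1)%:R + 1) / beta i.+1 j.
    rewrite (betaS i.+1); move: (beta i.+1 j) b1 => b b1; field.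
    by rewrite b1 D2.
  rewrite mul1r -!mulrBl.
  have e : (cnt rho j i.+1 + gap rho j i = cnt rho j i + (gap rho j i.+1 + 1))%N.
    by move: g0 g1; rewrite /gap; lia.
  move/(congr1 (fun n => n%:R : F)): e; rewrite !natrD => e.
  apply/eqP; rewrite mulf_eq0; apply/orP; left; apply/eqP.
  rewrite (_ : (cnt rho j i.+1)%:R = (cnt rho j i)%:R + ((gap rho j i.+1)%:R + 1) - (gap rho j i)%:R).
    by ring.
  by rewrite -e addrK.
rewrite mul0r subr0 -mulrBl; apply/eqP; rewrite mulf_eq0; apply/orP; left.
have ir : i.+1 = rho j by apply/eqP; rewrite eqn_leq ij ge.
have e : (cnt rho j i.+1 + gap rho j i = cnt rho j i)%N.
  by move: g0; rewrite /gap -ir; lia.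
move/(congr1 (fun n => n%:R : F)): e; rewrite natrD => e.
by rewrite -e; apply/eqP; ring.
Qed.

End BaseSolution.

Section BetheSystem.
Variables (R : realType) (N : nat) (lam : seq nat) (rho : nat -> nat).
Hypothesis W : lattice_word rho N lam.
Notation C := (Cplx R).
Notation n := (size lam).
Notation V := ('rV[C]_(n * N + N * N)).
Notation beta := (beta_of C rho).

(** A point x lists the unknowns w_i^(j) = t_i^(j) / z_j, then the ratios
    r_(jl) = z_j / z_l for j < l. Unknowns are kept for all i < n and all j, also
    where the tableau has no variable; there the equation is w = 1, which for i = 0
    makes level 0 consist of the z_j. *)
Definition uvar (x : V) (i : nat) (j : 'I_N) : C :=
  if insub i is Some i' then x 0 (lshift (N * N) (mxvec_index (i' : 'I_n) j)) else 0.

Definition rvar (x : V) (j l : 'I_N) : C := x 0 (rshift (n * N) (mxvec_index j l)).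

(** z_j / (w z_j - w' z_l), with w at level i and w' at level i', as a function of
    the unknowns and of the ratio of the smaller by the larger of z_j and z_l. *)
Definition kernel (x : V) i (j : 'I_N) i' (l : 'I_N) : C :=
  if (l < j)%N then (uvar x i j - uvar x i' l * rvar x l j)^-1
  else if (j < l)%N then rvar x j l * (rvar x j l * uvar x i j - uvar x i' l)^-1
  else (uvar x i j - uvar x i' l)^-1.

Definition bethe_eq (x : V) i (j : 'I_N) : C :=
  if (0 < i <= rho j)%N then
    \sum_(l < N | (l != j) && (i <= rho l)%N) 2 * kernel x i j i l
    - \sum_(l < N | (i.-1 <= rho l)%N) kernel x i j i.-1 l
    - \sum_(l < N | (i.+1 <= rho l)%N) kernel x i j i.+1 l
  else uvar x i j - 1.

Definition base_point : 'rV[C]_(n * N) :=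
  mxvec (\matrix_(i < n, j < N) if (i <= rho j)%N then beta i j else 1).

Notation x0 := (row_mx base_point 0 : V).

Lemma row_lt i (j : 'I_N) : (i <= rho j)%N -> (i < n)%N.
Proof. by move=> ij; apply: leq_ltn_trans ij (word_row_lt W (ltn_ord j)). Qed.

Lemma uvarE (x : V) (i : 'I_n) j : uvar x i j = x 0 (lshift (N * N) (mxvec_index i j)).
Proof. by rewrite /uvar valK. Qed.

Lemma uvar_row (w : 'rV[C]_(n * N)) r (i : 'I_n) j : uvar (row_mx w r) i j = w 0 (mxvec_index i j).
Proof. by rewrite uvarE row_mxEl. Qed.

Lemma uvar_base i (j : 'I_N) : (i <= rho j)%N -> uvar x0 i j = beta i j.
Proof.
move=> ij; have := uvar_row base_point 0 (Ordinal (row_lt ij)) j; rewrite /= => ->.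
by rewrite mxvecE mxE /= ij.
Qed.

Lemma rvar_row w r j l : rvar (row_mx w r) j l = r 0 (mxvec_index j l).
Proof. by rewrite /rvar row_mxEr. Qed.

Lemma sloped_uvar i j : sloped x0 (fun x => uvar x i j) (fun h => uvar h i j).
Proof.
by rewrite /uvar; case: insub => [i'|]; [exact: sloped_coord | exact: sloped_cst].
Qed.

Lemma beta_neq i i' (j : 'I_N) : (i <= rho j)%N -> (i' <= rho j)%N -> i != i' -> beta i j != beta i' j.
Proof.
have decr k k' : (k < k')%N -> (k' <= rho j)%N -> beta k' j < beta k j.
  elim: k' => // k' IH; rewrite ltnS leq_eqVlt => /orP[/eqP ->|lt] kr.
    exact: (beta_decr C W (ltn_ord j) kr).
  by apply: lt_trans (beta_decr C W (ltn_ord j) kr) (IH lt (ltnW kr)).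
move=> ij ij'; rewrite neq_ltn => /orP[lt|lt]; first by rewrite gt_eqF // decr.
by rewrite lt_eqF // decr.
Qed.

Lemma beta_neq0 i (j : 'I_N) : (i <= rho j)%N -> beta i j != 0.
Proof. by move=> ij; rewrite gt_eqF // (beta_gt0 C W (ltn_ord j) ij). Qed.

Lemma kernel_base i (j : 'I_N) i' (l : 'I_N) : (i <= rho j)%N -> (i' <= rho l)%N ->
  kernel x0 i j i' l = if (l < j)%N then (beta i j)^-1 else if (j < l)%N then 0
    else (beta i j - beta i' l)^-1.
Proof.
move=> ij il; rewrite /kernel !uvar_base // !rvar_row !mxE.
by rewrite mulr0 subr0 mul0r.
Qed.

(** At ratios 0 the differential in w sees l < j only through w_i^(j) and does not see
    l > j at all. *)
Lemma sloped_kernel i (j : 'I_N) i' (l : 'I_N) : (i <= rho j)%N -> (i' <= rho l)%N ->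
  (l = j -> i != i') -> exists d, sloped x0 (fun x => kernel x i j i' l) d /\
  forall h, d (row_mx h 0) = if (l < j)%N then - uvar (row_mx h 0) i j / beta i j ^+ 2
    else if (j < l)%N then 0 else
      - (uvar (row_mx h 0) i j - uvar (row_mx h 0) i' l) / (beta i j - beta i' l) ^+ 2.
Proof.
move=> ij il ne; have su := sloped_uvar i j; have su' := sloped_uvar i' l.
have sr a b := sloped_coord x0 (rshift (n * N) (mxvec_index a b)).
have r0 a b : x0 0 (rshift (n * N) (mxvec_index a b)) = 0 by rewrite row_mxEr mxE.
have rh (h : 'rV[C]_(n * N)) a b : (row_mx h 0 : V) 0 (rshift (n * N) (mxvec_index a b)) = 0.
  by rewrite row_mxEr mxE.
have ub := uvar_base ij; have ub' := uvar_base il.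
rewrite /kernel; have [lt|lt|e] := ltngtP l j.
- eexists; split.
    apply: slopedV (slopedB su (slopedM su' (sr l j))) _.
    by rewrite r0 mulr0 subr0 ub beta_neq0.
  by move=> h /=; rewrite r0 rh ub !mulr0 !subr0 addr0 subr0.
- eexists; split.
    apply: slopedM (sr j l) (slopedV (slopedB (slopedM (sr j l) su) su') _).
    by rewrite r0 mul0r sub0r ub' oppr_eq0 beta_neq0.
  by move=> h /=; rewrite r0 rh !mul0r addr0.
have {}e : l = j by apply: val_inj.
have nz : beta i j - beta i' l != 0.
  by rewrite subr_eq0 e; apply: beta_neq => //; [rewrite -e | exact: ne].
eexists; split.
  by apply: slopedV (slopedB su su') _; rewrite ub ub'.
by move=> h /=; rewrite ub ub'.
Qed.

Lemma scale_sum (j : 'I_N) (P : pred 'I_N) (q : pred nat) (X : C) (Y : 'I_N -> C) :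
  (forall l : 'I_N, (l < j)%N -> P l = q l) ->
  \sum_(l < N | P l) (if (l < j)%N then X else if (j < l)%N then 0 else Y l) =
  (\sum_(l < j) q l)%:R * X + (P j)%:R * Y j.
Proof.
move=> Pq; rewrite natr_sum (big_ord_widen N (fun l => (q l)%:R : C)) ?(ltnW (ltn_ord j)) //.
rewrite mulr_suml big_mkcond /= (bigD1 j) //= !ltnn addrC.
have -> : \sum_(l < N | (l < j)%N) (q l)%:R * X = \sum_(l < N | l != j) (l < j)%N%:R * ((q l)%:R * X) :> C.
  rewrite big_mkcond [RHS]big_mkcond; apply: eq_bigr => l _.
  case: (eqVneq l j) => [->|_]; first by rewrite ltnn.
  by case: ifP => _; rewrite ?mul1r ?mul0r.
congr (_ + _); last by case: (P j); rewrite ?mul1r ?mul0r.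
apply: eq_bigr => l lj; case: (ltngtP l j) => [lt|lt|/val_inj e].
- by rewrite Pq //; case: (q l); rewrite ?mul1r ?mul0r.
- by case: (P l); rewrite mul0r.
- by rewrite e eqxx in lj.
Qed.

(** At ratios 0 the terms with l < j only depend on j and are counted by curvature. *)
Lemma bethe_base i (j : 'I_N) : (i < n)%N -> bethe_eq x0 i j = 0.
Proof.
move=> iN; rewrite /bethe_eq; case: ifP => act; last first.
  have := uvar_row base_point 0 (Ordinal iN) j; rewrite /= => ->.
  rewrite mxvecE mxE /=; case: ifP => ij; last by rewrite subrr.
  by move: act; rewrite ij andbT; case: (i) => // _; rewrite beta0 subrr.
case: i act {iN} => // i /= ij.
have S k (Q : pred 'I_N) (q : pred nat) : (forall l, Q l -> (k <= rho l)%N) -> (forall l : 'I_N, (l < j)%N -> Q l = q l) ->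
    \sum_(l < N | Q l) kernel x0 i.+1 j k l =
    (\sum_(l < j) q l)%:R * (beta i.+1 j)^-1 + (Q j)%:R * (beta i.+1 j - beta k j)^-1.
  move=> Qk Qq; rewrite -(scale_sum _ (fun l : 'I_N => (beta i.+1 j - beta k l)^-1) Qq); apply: eq_bigr => l Ql.
  by rewrite kernel_base // Qk.
rewrite -mulr_sumr (S i.+1 _ (fun l => (i < rho l)%N)); last 2 first.
- by move=> l /andP[].
- by move=> l lt; rewrite -val_eqE /= ltn_eqF.
rewrite (S i _ (fun l => (i <= rho l)%N)) // (S i.+2 _ (fun l => (i.+1 < rho l)%N)) //.
rewrite eqxx mul0r addr0 (ltnW ij) mul1r -(base_equation C W (ltn_ord j) ij) -curvature /reach_count.
ring.
Qed.

(** Only the values of the differential on the directions of w matter for the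
    implicit function theorem, and these have short expressions. *)
Definition sloped_in_w (f : V -> C) (D : 'rV[C]_(n * N) -> C) : Prop :=
  exists d, sloped x0 f d /\ forall h, d (row_mx h 0) = D h.

Lemma sloped_in_wB f g D E : sloped_in_w f D -> sloped_in_w g E ->
  sloped_in_w (fun x => f x - g x) (fun h => D h - E h).
Proof.
move=> [d [fd dE]] [e [ge eE]]; exists (fun h => d h - e h); split; first exact: slopedB.
by move=> h; rewrite dE eE.
Qed.

Lemma sloped_in_wZ c f D : sloped_in_w f D -> sloped_in_w (fun x => c * f x) (fun h => c * D h).
Proof.
move=> [d [fd dE]]; exists (fun h => c * d h); split; first exact: slopedZ.
by move=> h; rewrite dE.
Qed.

Lemma sloped_in_w_sum (P : pred 'I_N) f D : (forall l, P l -> sloped_in_w (f l) (D l)) ->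
  sloped_in_w (fun x => \sum_(l < N | P l) f l x) (fun h => \sum_(l < N | P l) D l h).
Proof.
move=> fD; have /fin_all_exists[d hd] : forall l, exists d, P l -> sloped x0 (f l) d /\
    forall h, d (row_mx h 0) = D l h.
  move=> l; have [Pl|nPl] := boolP (P l); last by exists (fun=> 0).
  by have [d hd] := fD l Pl; exists d.
exists (fun h => \sum_(l < N | P l) d l h); split.
  by apply: sloped_sum => l /hd[].
by move=> h; apply: eq_bigr => l /hd[].
Qed.

(** The differential of bethe_eq at the base point, restricted to ratios 0: the
    system decouples into a tridiagonal one for each j. *)
Definition bethe_slope i (j : 'I_N) (h : 'rV[C]_(n * N)) : C :=
  let u i := uvar (row_mx h 0) i j in
  if (0 < i <= rho j)%N then
    ((cnt rho j i.-1)%:R - (cnt rho j i)%:R) / beta i j ^+ 2 * u i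
    + ((beta i j - beta i.-1 j) ^+ 2)^-1 * (u i - u i.-1)
    + (i < rho j)%N%:R * (((beta i j - beta i.+1 j) ^+ 2)^-1 * (u i - u i.+1))
  else u i.

Lemma sloped_bethe i (j : 'I_N) : sloped_in_w (fun x => bethe_eq x i j) (bethe_slope i j).
Proof.
rewrite /bethe_eq /bethe_slope; case: (boolP (0 < i <= rho j)%N) => act; last first.
  exists (fun h => uvar h i j - 0); split; last by move=> h; rewrite subr0.
  by apply: slopedB; [exact: sloped_uvar | exact: sloped_cst].
case: i act => // i /= ij.
have S k (Q : pred 'I_N) (q : pred nat) : (forall l, Q l -> (k <= rho l)%N) ->
    (forall l, Q l -> l = j -> i.+1 != k) -> (forall l : 'I_N, (l < j)%N -> Q l = q l) ->
    sloped_in_w (fun x => \sum_(l < N | Q l) kernel x i.+1 j k l)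
    (fun h => (\sum_(l < j) q l)%:R * (- uvar (row_mx h 0) i.+1 j / beta i.+1 j ^+ 2) +
      (Q j)%:R * (- (uvar (row_mx h 0) i.+1 j - uvar (row_mx h 0) k j) / (beta i.+1 j - beta k j) ^+ 2)).
  move=> Qk Qj Qq; have [|d [fd dE]] := @sloped_in_w_sum Q (fun l x => kernel x i.+1 j k l)
    (fun l h => if (l < j)%N then - uvar (row_mx h 0) i.+1 j / beta i.+1 j ^+ 2
    else if (j < l)%N then 0 else
      - (uvar (row_mx h 0) i.+1 j - uvar (row_mx h 0) k l) / (beta i.+1 j - beta k l) ^+ 2).
    move=> l Ql; exact: (sloped_kernel ij (Qk l Ql) (Qj l Ql)).
  exists d; split; first exact: fd.
  by move=> h; rewrite dE -(scale_sum _ (fun l : 'I_N =>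
    - (uvar (row_mx h 0) i.+1 j - uvar (row_mx h 0) k l) / (beta i.+1 j - beta k l) ^+ 2) Qq).
have p1 (l : 'I_N) : (l != j) && (i < rho l)%N -> (i < rho l)%N by case/andP.
have p2 (l : 'I_N) : (l != j) && (i < rho l)%N -> l = j -> i.+1 != i.+1 by case/andP => /eqP.
have p3 (l : 'I_N) : (l < j)%N -> (l != j) && (i < rho l)%N = (i < rho l)%N.
  by move=> lt; rewrite -val_eqE /= ltn_eqF.
have p4 (l : 'I_N) : (i <= rho l)%N -> l = j -> i.+1 != i by rewrite gtn_eqF.
have p5 (l : 'I_N) : (i.+1 < rho l)%N -> l = j -> i.+1 != i.+2 by rewrite ltn_eqF.
have h1 := S i.+1 (fun l => (l != j) && (i < rho l)%N) (fun l => (i < rho l)%N) p1 p2 p3.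
have h2 := S i (fun l => (i <= rho l)%N) (fun l => (i <= rho l)%N) (fun l h => h) p4 (fun l _ => erefl).
have h3 := S i.+2 (fun l => (i.+1 < rho l)%N) (fun l => (i.+1 < rho l)%N) (fun l h => h) p5 (fun l _ => erefl).
have [d [fd dE]] := sloped_in_wB (sloped_in_wB (sloped_in_wZ 2 h1) h2) h3.
exists d; split.
  by under eq_fun do rewrite -mulr_sumr.
move=> h; rewrite dE eqxx mul0r addr0 (ltnW ij) mul1r.
rewrite -[(cnt rho j i)%:R - (cnt rho j i.+1)%:R]opprB -curvature /reach_count; ring.
Qed.

Lemma bethe_slope_inj (h : 'rV[C]_(n * N)) :
  (forall i (j : 'I_N), (i < n)%N -> bethe_slope i j h = 0) -> h = 0.
Proof.
move=> H; suff U0 (i : 'I_n) j : uvar (row_mx h 0) i j = 0.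
  apply/rowP => k; case/mxvec_indexP: k => i j.
  by rewrite mxE -(uvar_row h 0 i j) U0.
have [ij|ji] := leqP i (rho j); last first.
  by have := H i j (ltn_ord i); rewrite /bethe_slope [(i <= rho j)%N]leqNgt ji andbF.
apply: (@tridiagonal_injective C (rho j) (fun i => uvar (row_mx h 0) i j)
  (fun i => ((cnt rho j i.-1)%:R - (cnt rho j i)%:R) / beta i j ^+ 2)
  (fun i => ((beta i j - beta i.-1 j) ^+ 2)^-1) (fun i => ((beta i j - beta i.+1 j) ^+ 2)^-1) _ _ _ ij).
  by have := H 0%N j (leq_ltn_trans (leq0n i) (ltn_ord i)).
move=> {ij} {}i /andP[]; case: i => // i _ ij /=.
have b1 := beta_gt0 C W (ltn_ord j) ij.
have b2 := beta_decr C W (ltn_ord j) ij.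
have real_sq (x y : C) : 0 <= x -> 0 <= y -> 0 <= (x - y) ^+ 2.
  by move=> hx hy; rewrite real_exprn_even_ge0 // rpredB // ger0_real.
split.
- rewrite divr_ge0 ?exprn_ge0 ?(ltW b1) // subr_ge0 ler_nat.
  exact: (word_lattice W) (ltnW (ltn_ord j)).
- rewrite invr_gt0 lt0r expf_neq0 ?real_sq ?(ltW b1) ?(ltW (lt_trans b1 b2)) //.
  by rewrite subr_eq0 lt_eqF.
- have [lt|ge] := ltnP i.+1 (rho j).
    by rewrite invr_ge0 real_sq ?(ltW b1) ?(ltW (beta_gt0 C W (ltn_ord j) lt)).
  rewrite invr_ge0 real_sq ?(ltW b1) // /beta_of; apply: prodr_ge0 => r _.
  by rewrite divr_ge0 ?addr_ge0.
by have := H i.+1 j (row_lt ij); rewrite /bethe_slope /= ij.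
Qed.

Lemma bethe_solution : exists g : 'rV[C]_(N * N) -> 'rV[C]_(n * N),
  [/\ forall k, (fun r => g r 0 k) @ nbhs (0 : 'rV[C]_(N * N)) --> base_point 0 k,
      \forall r \near (0 : 'rV[C]_(N * N)), forall (i : 'I_n) j, bethe_eq (row_mx (g r) r) i j = 0 &
      \forall r \near (0 : 'rV[C]_(N * N)), forall k, differentiable (fun r => g r 0 k) r].
Proof.
have sl k : sloped_in_w (fun x => mxvec (\matrix_(i < n, j < N) bethe_eq x i j) 0 k)
    (fun h => mxvec (\matrix_(i < n, j < N) bethe_slope i j h) 0 k).
  case/mxvec_indexP: k => i j; have [d [fd dE]] := sloped_bethe i j.
  exists d; split; first by under eq_fun do rewrite mxvecE mxE.
  by move=> h; rewrite dE mxvecE mxE.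
have [d hd] := fin_all_exists sl.
have [||g [g1 g2 g3]] := @implicit_function R (n * N) (N * N) base_point 0 _ d (fun k => (hd k).1).
- case/mxvec_indexP => i j; rewrite mxvecE mxE; exact: bethe_base (ltn_ord i).
- move=> h hz; apply: bethe_slope_inj => i j iN.
  have := hz (mxvec_index (Ordinal iN) j); rewrite (hd _).2 mxvecE mxE; exact.
exists g; split=> //; apply: filterS g2 => r gr i j.
by have := gr (mxvec_index i j); rewrite mxvecE mxE.
Qed.

End BetheSystem.

(** * The critical family of a tableau *)
Section Family.
Variables (R : realType) (N : nat) (lam : seq nat) (rho : nat -> nat).
Hypothesis W : lattice_word rho N lam.
Notation C := (Cplx R).
Notation n := (size lam).
Notation AZ := (@asymptotic_zone R N).
Notation beta := (beta_of C rho).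

Lemma word_indexing i : exists g : 'I_(below lam i) -> 'I_N,
  injective g /\ forall j, (exists a, g a = j) <-> (i <= rho j)%N.
Proof.
pose P := [pred j : 'I_N | (i <= rho j)%N].
have card : below lam i = #|P|.
  rewrite -(cnt_below W i) -sum1_card [RHS]big_mkcond.
  by apply: eq_bigr => j _; rewrite inE; case: (i <= rho j)%N.
exists (fun a => enum_val (cast_ord card a)); split.
  by move=> a b /enum_val_inj /cast_ord_inj.
move=> j; split=> [[a <-]|Pj]; first by have := enum_valP (cast_ord card a); rewrite inE.
exists (cast_ord (esym card) (enum_rank_in (Pj : j \in P) j)).
by rewrite cast_ordKV enum_rankK_in.
Qed.

(** Two functions of different scales, or of the same scale with different leading
    coefficients, differ near the asymptotic zone. *)
Lemma scale_separated (f f' : 'rV[C]_N -> C) (j l : 'I_N) (b b' : C) :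
  (fun z => f z / z 0 j) @ AZ --> b -> (fun z => f' z / z 0 l) @ AZ --> b' ->
  b != 0 -> b' != 0 -> (j = l -> b != b') -> \forall z \near AZ, f z != f' z.
Proof.
move=> fb fb' b0 b0' bb'.
wlog jl : f f' j l b b' fb fb' b0 b0' bb' / (j <= l)%N => [wl|].
  have [h|h] := leqP j l; first exact: (wl f f' j l b b').
  have := wl f' f l j b' b fb' fb b0' b0 _ (ltnW h).
  by move=> H; apply: filterS (H _) => [z|e]; rewrite eq_sym // e ltnn in h *; rewrite bb'.
have [k ck k0] : exists2 k : C, (fun z : 'rV[C]_N => f z / z 0 l - f' z / z 0 l) @ AZ --> k & k != 0.
  move: jl; rewrite leq_eqVlt => /orP[/eqP/val_inj e|lt].
    subst l; exists (b - b'); first exact: cvgB fb fb'.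
    by rewrite subr_eq0 bb'.
  exists (b * 0 - b'); last by rewrite mulr0 sub0r oppr_eq0.
  apply: cvgB fb'.
  have h : (fun z : 'rV[C]_N => (f z / z 0 j) * (z 0 j / z 0 l)) @ AZ --> b * 0.
    exact: cvgM fb (zone_ratio_cvg lt).
  apply: cvg_trans h; apply: near_eq_cvg; apply: filterS (near_coord_neq0 R j) => z zj.
  by rewrite mulrA divfK.
apply: filterS (cvgr_neq0 k ck k0) => z; apply: contraNneq => ->.
by rewrite subrr.
Qed.

Definition ratios (z : 'rV[C]_N) : 'rV[C]_(N * N) :=
  mxvec (\matrix_(j < N, l < N) if (j < l)%N then z 0 j / z 0 l else 0).

Lemma ratios_cvg : ratios @ AZ --> (0 : 'rV[C]_(N * N)).
Proof.
apply: cvg_row => k; case/mxvec_indexP: k => j l; rewrite mxE.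
under eq_fun do rewrite mxvecE mxE.
case: (boolP (j < l)%N) => jl; last exact: cvg_cst.
exact: zone_ratio_cvg.
Qed.

Lemma ratios_differentiable (z : 'rV[C]_N) : (forall j, z 0 j != 0) -> differentiable ratios z.
Proof.
move=> z0; rewrite (_ : ratios = \sum_(k < N * N) (fun w => ratios w 0 k *: (delta_mx 0 k : 'rV[C]_(N * N)))).
  apply: differentiable_sum => k; apply: differentiableZl.
  case/mxvec_indexP: k => j l.
  rewrite (_ : (fun w => _) = fun w : 'rV[C]_N => if (j < l)%N then w 0 j / w 0 l else 0); last first.
    by apply/funext => w; rewrite mxvecE mxE.
  case: (boolP (j < l)%N) => jl; last exact: differentiable_cst.
  apply: differentiableM; first exact: differentiable_coord.
  by apply: differentiableV; [exact: differentiable_coord | exact: z0].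
by apply/funext => w; rewrite fct_sumE [LHS]row_sum_delta.
Qed.

Variable g : 'rV[C]_(N * N) -> 'rV[C]_(n * N).

Definition scaled (z : 'rV[C]_N) i j : C := uvar (row_mx (g (ratios z)) (ratios z)) i j.

Lemma position_difference (z : 'rV[C]_N) i (j : 'I_N) i' l : (forall k, z 0 k != 0) ->
  (scaled z i j * z 0 j - scaled z i' l * z 0 l)^-1 =
  kernel (row_mx (g (ratios z)) (ratios z)) i j i' l / z 0 j.
Proof.
move=> z0; rewrite /kernel -/(scaled z i j) -/(scaled z i' l) !rvar_row !mxvecE !mxE.
have zj := z0 j; have zl := z0 l.
case: (ltngtP l j) => [lt|lt|/val_inj e].
- rewrite -invfM; congr (_^-1); rewrite mulrBl; congr (_ - _).
  by rewrite -mulrA divfK.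
- have -> : scaled z i j * z 0 j - scaled z i' l * z 0 l =
      z 0 l * (z 0 j / z 0 l * scaled z i j - scaled z i' l) by field.
  rewrite invfM; move: (z 0 j / z 0 l * _ - _)^-1 => B.
  by field; rewrite zj zl.
by rewrite e -mulrBl invfM.
Qed.

Hypothesis g_cvg : forall k, (fun r => g r 0 k) @ nbhs (0 : 'rV[C]_(N * N)) --> base_point R N lam rho 0 k.

Lemma scaled_cvg i (j : 'I_N) : (i <= rho j)%N -> (fun z => scaled z i j) @ AZ --> beta i j.
Proof.
move=> ij; have iN := row_lt W ij; pose k := mxvec_index (Ordinal iN) j.
have E z : scaled z i j = g (ratios z) 0 k by exact: (uvar_row _ _ (Ordinal iN) j).
have B : base_point R N lam rho 0 k = beta i j by rewrite mxvecE mxE /= ij.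
have cc : (fun z => g (ratios z) 0 k) @ AZ --> base_point R N lam rho 0 k.
  by move=> A hA; exact: (ratios_cvg (g_cvg hA)).
rewrite -B; apply: cvg_trans cc; apply: near_eq_cvg; apply: nearW => z; exact: esym (E z).
Qed.

Variable idx : forall i : nat, 'I_(below lam i) -> 'I_N.
Hypothesis idx_inj : forall i, injective (@idx i).
Hypothesis idx_image : forall i j, (exists a, @idx i a = j) <-> (i <= rho j)%N.

Definition family (z : 'rV[C]_N) : tvars R lam := fun i a => scaled z i (@idx i a) * z 0 (@idx i a).

Lemma idx_le i a : (i <= rho (@idx i a))%N.
Proof. by apply/idx_image; exists a. Qed.

Lemma family_cvg i (a : 'I_(below lam i)) :
  (fun z => family z a / z 0 (idx a)) @ AZ --> beta i (idx a).
Proof.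
apply: cvg_trans (scaled_cvg (idx_le a)); apply: near_eq_cvg.
by apply: filterS (near_coord_neq0 R (idx a)) => z zj; rewrite mulfK.
Qed.

Lemma coord_cvg (k : 'I_N) : (fun z : 'rV[C]_N => z 0 k / z 0 k) @ AZ --> (1 : C).
Proof.
by apply: cvg_near_cst; apply: filterS (near_coord_neq0 R k) => z zk; rewrite divff.
Qed.

Lemma near_all_zone (I : finType) (P : I -> set 'rV[C]_N) :
  (forall i, AZ (P i)) -> AZ [set z | forall i, P i z].
Proof. by move=> h; exact: (@filter_forall _ _ _ AZ _ h). Qed.

Lemma family_nondegenerate : \forall z \near AZ, nondegenerate (family z) z.
Proof.
have beta_pos i a := beta_neq0 R W (@idx_le i a).
have N1 : AZ [set z : 'rV[C]_N | forall k l : 'I_N, k != l -> z 0 k != z 0 l].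
  apply: near_all_zone => k; apply: near_all_zone => l.
  have [->|kl] := eqVneq k l; first by apply: filterS (near_coord_neq0 R l) => z _ /=; rewrite eqxx.
  have H := scale_separated (coord_cvg k) (coord_cvg l) (oner_neq0 _) (oner_neq0 _).
  by apply: filterS (H _) => [z h _|e]; [exact: h | rewrite e eqxx in kl].
have N2 : AZ [set z : 'rV[C]_N | forall (k : 'I_N) (a : 'I_(below lam 1)), z 0 k != family z a].
  apply: near_all_zone => k; apply: near_all_zone => a.
  have H := scale_separated (coord_cvg k) (@family_cvg _ a) (oner_neq0 _) (beta_pos _ _).
  apply: H.
  by move=> _; rewrite -(beta0 C rho (idx a)); apply: (beta_neq R W) => //; exact: idx_le.
have N3 : AZ [set z : 'rV[C]_N | forall (i : 'I_n) (a b : 'I_(below lam i)), a != b -> family z a != family z b].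
  apply: near_all_zone => i; apply: near_all_zone => a; apply: near_all_zone => b.
  have [->|ab] := eqVneq a b; first by apply: filterS (near_coord_neq0 R (idx b)) => z _ /=; rewrite eqxx.
  have H := scale_separated (@family_cvg _ a) (@family_cvg _ b) (beta_pos _ _) (beta_pos _ _).
  by apply: filterS (H _) => [z h _|/idx_inj e]; [exact: h | rewrite e eqxx in ab].
have N4 : AZ [set z : 'rV[C]_N | forall (i : 'I_n) (a : 'I_(below lam i)) (b : 'I_(below lam i.+1)),
    family z a != family z b].
  apply: near_all_zone => i; apply: near_all_zone => a; apply: near_all_zone => b.
  apply: (scale_separated (@family_cvg _ a) (@family_cvg _ b) (beta_pos _ _) (beta_pos _ _)) => e.
  rewrite e; apply: (beta_neq R W); [by rewrite -e; exact: idx_le | exact: idx_le | by rewrite ltn_eqF].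
apply: filterS (filterI (filterI N1 N2) (filterI N3 N4)) => z [[h1 h2] [h3 h4]].
have lt i (a : 'I_(below lam i)) : (i < n)%N := row_lt W (idx_le a).
split; [exact: h1 | exact: h2 | |].
  by move=> i a b _; exact: (h3 (Ordinal (lt i a))).
by move=> i a b _; exact: (h4 (Ordinal (lt i a))).
Qed.

Lemma level_sum (z : 'rV[C]_N) (x : C) k : (forall l, scaled z 0 l = 1) ->
  \sum_(w <- level (family z) (fun j => z 0 j) k) (x - w)^-1 =
  \sum_(l < N | (k <= rho l)%N) (x - scaled z k l * z 0 l)^-1.
Proof.
move=> u0; case: k => [|k]; rewrite big_image /=.
  by apply: eq_bigr => l _; rewrite u0 mul1r.
exact: (sum_indexing (fun l : 'I_N => (x - scaled z k.+1 l * z 0 l)^-1) (@idx_inj k.+1) (idx_image k.+1)).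
Qed.

Lemma solution_critical (z : 'rV[C]_N) : (forall j, z 0 j != 0) ->
  (forall (i : 'I_n) j, bethe_eq rho (row_mx (g (ratios z)) (ratios z)) i j = 0) ->
  nondegenerate (family z) z -> critical_point (family z) z.
Proof.
move=> z0 sol nd; split; first exact: nd.
have u0 l : scaled z 0 l = 1.
  have := sol (Ordinal (row_lt W (leq0n (rho l)))) l; rewrite /bethe_eq /=.
  by move/eqP; rewrite subr_eq0 => /eqP.
move=> i a i0; have ij := idx_le a.
have := sol (Ordinal (row_lt W ij)) (idx a); rewrite /bethe_eq /= i0 ij /=.
rewrite dmaster_dtE // !level_sum // => /(congr1 (fun c => c / z 0 (idx a))); rewrite mul0r => E0; apply: etrans E0.
rewrite !mulrBl !mulr_suml; congr (_ - _ - _).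
- have := @sum_indexing C _ _ (@idx i) _ (fun l => if l != idx a then
     2 / (family z a - scaled z i l * z 0 l) else 0) (@idx_inj i) (idx_image i).
  rewrite -!big_mkcondr /= => E.
  transitivity (\sum_(b < below lam i | idx b != idx a)
     2 / (family z a - scaled z i (idx b) * z 0 (idx b))).
    by apply: eq_bigl => b; rewrite (inj_eq (@idx_inj i)).
  rewrite E; apply: eq_big => [l|l _]; first by rewrite andbC.
  by rewrite position_difference // mulrA.
- by apply: eq_bigr => l _; rewrite position_difference.
- by apply: eq_bigr => l _; rewrite position_difference.
Qed.

Hypothesis g_solves : \forall r \near (0 : 'rV[C]_(N * N)),
  forall (i : 'I_n) j, bethe_eq rho (row_mx (g r) r) i j = 0.
Hypothesis g_diff : \forall r \near (0 : 'rV[C]_(N * N)), forall k, differentiable (fun r => g r 0 k) r.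

Lemma family_critical : critical_family family.
Proof.
have h1 : AZ [set z | forall (i : 'I_n) j, bethe_eq rho (row_mx (g (ratios z)) (ratios z)) i j = 0].
  exact: (ratios_cvg g_solves).
have h2 : AZ [set z | forall k, differentiable (fun r => g r 0 k) (ratios z)].
  exact: (ratios_cvg g_diff).
have h3 : AZ [set z : 'rV[C]_N | forall j, z 0 j != 0].
  by apply: near_all_zone => j; exact: near_coord_neq0.
apply: filterS (filterI (filterI h1 h2) (filterI h3 family_nondegenerate)) => z [[s d] [z0 nd]].
split; first exact: solution_critical.
move=> i a i0; pose k := mxvec_index (Ordinal (row_lt W (idx_le a))) (idx a).
rewrite (_ : (fun w => _) = (fun w : 'rV[C]_N => g (ratios w) 0 k) * (fun w => w 0 (idx a))).
  apply: differentiableM; last exact: differentiable_coord.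
  apply: (@differentiable_comp _ _ _ _ ratios (fun r => g r 0 k)); last exact: d.
  exact: ratios_differentiable.
apply/funext => w; rewrite /family /scaled; congr (_ * _).
exact: (uvar_row _ _ (Ordinal (row_lt W (idx_le a))) (idx a)).
Qed.

End Family.

Theorem tableau_critical_family (R : realType) (N : nat) (lam : seq nat)
    (hlam : is_partition_of N lam) (T : std_tableau N lam) :
  exists t : 'rV[Cplx R]_N -> tvars R lam,
    critical_family t /\ has_tableau_asymptotics T (tableau_beta T) t.
Proof.
have W := word_of_lattice hlam T.
have [g [g1 g2 g3]] := bethe_solution R W.
have [idx hidx] : exists idx : forall i, 'I_(below lam i) -> 'I_N, forall i,
    injective (idx i) /\ forall j, (exists a, idx i a = j) <-> (i <= word_of T j)%N.
  have /(_ _)/cid h := word_indexing W.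
  by exists (fun i => sval (h i)) => i; exact: (svalP (h i)).
have idx_inj i := (hidx i).1; have idx_im i := (hidx i).2.
exists (family g idx); split; first exact: (family_critical W g1 idx_inj idx_im g2 g3).
apply: (tableau_asymptotics (t := family g idx) (idx := idx) W (fun j => erefl)).
  exact: (family_nondegenerate W g1 idx_inj idx_im).
move=> i i0; split; [exact: idx_inj | exact: idx_im | move=> a].
exact: (family_cvg W g1 idx_im).
Qed.

Theorem theorem6p1 (R : realType) (N : nat) (lam : seq nat)
    (hlam : is_partition_of N lam) :
  exists beta : std_tableau N lam -> nat -> 'I_N -> rat,
    (forall T : std_tableau N lam,
      (forall (j : 'I_N) (i : nat), (0 < i < row_of T j)%N ->
         0 < beta T i j < 1) /\
      exists t : 'rV[Cplx R]_N -> tvars R lam,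
        critical_family t /\ has_tableau_asymptotics T (beta T) t) /\
    (forall t : 'rV[Cplx R]_N -> tvars R lam, critical_family t ->
      exists T : std_tableau N lam, has_tableau_asymptotics T (beta T) t).
Proof.
exists (@tableau_beta N lam); split; last exact: critical_family_tableau.
move=> T; split; last exact: tableau_critical_family.
move=> j i; rewrite row_ofE ltnS => /andP[i0 ij].
have W := word_of_lattice hlam T.
by rewrite (beta_gt0 rat W (ltn_ord j) ij) (beta_upper rat W (ltn_ord j)) ?i0.
Qed.
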